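(* Let $T$ be a bounded linear operator on a complex Banach space $X$, and let $K$ be a component of the spectrum $\sigma(T)$ which is closed and open in $\sigma(T)$ and such that $K\subset\{z\in\mathbb{C}:|z|\le 1\}$ and $A=K\cap\mathbb{T}$ is a finite set $A=\{e^{i\alpha_1},\dots,e^{i\alpha_m}\}$, where $\alpha_1,\dots,\alpha_m\in\mathbb{R}$ are linearly independent over the field of rationals. Then $T$ is not frequently hypercyclic.
   Context: $\mathbb{T}=\{z\in\mathbb{C}:|z|=1\}$. The lower density of a discrete set $\Lambda\subset\mathbb{C}$ is $\underline{\mathrm{dens}}(\Lambda)=\liminf_{r\to\infty}\#\{\lambda\in\Lambda:|\lambda|\le r\}/r$. A bounded operator $T$ on a Banach space $X$ is frequently hypercyclic if there exists $x\in X$ such that for every non-empty open set $U\subset X$ the set $\{n\in\mathbb{N}:T^nx\in U\}$ has positive lower density. Real numbers $\alpha_1,\dots,\alpha_m$ are linearly independent over the field of rationals if $c_1\alpha_1+\dots+c_m\alpha_m=0$ with $c_1,\dots,c_m\in\mathbb{Z}$ implies $c_1=\dots=c_m=0$. *)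

(* Defs.v *)
From HB Require Import structures.
From mathcomp Require Import all_boot all_order all_algebra.
From mathcomp Require Import complex.
From mathcomp Require Import all_classical all_reals all_analysis.
Set Implicit Arguments.
Unset Strict Implicit.
Unset Printing Implicit Defensive.
Import Order.TTheory GRing.Theory Num.Theory.
Import numFieldNormedType.Exports.
Local Open Scope classical_set_scope.
Local Open Scope complex_scope.
Local Open Scope ring_scope.

Definition expi (R : realType) (a : R) : R[i] := cos a +i* sin a.

Definition Q_independent (R : realType) (m : nat) (alpha : 'I_m -> R) : Prop :=
  forall c : 'I_m -> int,
    \sum_(j < m) (c j)%:~R * alpha j = 0 -> forall j, c j = 0.

(* [counting] is the cardinality for finite sets and +oo for infinite ones. *)
Definition lower_density (R : realType) (L : set R[i]) : \bar R :=
  limf_einf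
    (fun r : R =>
       (@counting _ R (L `&` [set z : R[i] | (`|z| <= r%:C)%R]) * (r^-1)%:E)%E)
    (pinfty_nbhs R).

Section Operators.
Variables (R : realType) (X : completeNormedModType R[i]).

(* For a linear map, being bounded near 0 is the existence of M with
   |T x| <= M |x| for all x; see [linear_boundedP]. *)
Definition bounded_operator (T : {linear X -> X}) : Prop :=
  bounded_near T (nbhs (0 : X)).

(* [R[i]^o] is R[i] as a normed space over itself: the concrete type [R[i]]
   carries no topology in the library. *)
Definition spectrum (T : {linear X -> X}) : set R[i]^o :=
  [set z | ~ exists S : {linear X -> X},
    [/\ bounded_operator S,
        forall x, S (z *: x - T x) = x &
        forall x, z *: S x - T (S x) = x]].

Definition frequently_hypercyclic (T : {linear X -> X}) : Prop :=
  exists x : X, forall U : set X, open U -> U !=set0 ->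
    (0 < lower_density
           [set (n%:R : R[i]) | n in [set n : nat | U (iter n T x)]])%E.

End Operators.

(* Main.v *)
From HB Require Import structures.
Require Import Defs.
From mathcomp Require Import all_boot all_order all_algebra ssrAC.
From mathcomp Require Import complex.
From mathcomp Require Import all_classical all_reals all_analysis.
From mathcomp Require Import lra ring zify.
Set Implicit Arguments.
Unset Strict Implicit.
Unset Printing Implicit Defensive.
Import Order.TTheory GRing.Theory Num.Theory.
Import numFieldNormedType.Exports.
Local Open Scope classical_set_scope.
Local Open Scope complex_scope.
Local Open Scope ring_scope.

(** Let K be the closed and open part of the spectrum, L the finite set of its
    unimodular points, P the Riesz projection of K up to a nonzero factor, and
    p the product of the factors X - l over l in L.  Let x be an orbit vector
    that returns with positive lower density to every open set, and y = P x.

    Cutting P with bump functions around the points of L splits the projected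
    orbit as T^n P y = sum_l l^n q_l(n) + (exponentially small).  Writing
    z^n = l^n sum_k C(n,k) (z/l - 1)^k near l shows that q_l(n) is a binomial
    series in n whose coefficients decay like eta^k, where eta is as small as
    one pleases: it is enough to shrink the bumps.  Hence, on an interval
    [0, N], q_l agrees up to a negligible error with a vector-valued
    polynomial of degree at most D = N / Delta, and Delta is arbitrary
    ([spectral_split], [binomial_tail]).

    Suppose that p(T) P^2 is not 0.  A norming functional f of one of its
    values ([hahn_banach]) yields an open set, the vectors u with |u| < B0 and
    f(p(T) P^2 u) > 1, which the orbit visits at a set S of times of lower
    density at least d > 0.  Two counting arguments single out a time n in S:

    - the projected orbit grows subexponentially from each time of S on, so
      for most n in S its past obeys |T^(n-k) y| <= B tau^k with a rate tau
      that the geometric weights rho^k of the pieces absorb ([pliss],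
      [few_failures]); then |q_l(n)| <= A with A independent of Delta
      ([amplitude]);

    - a real polynomial of degree at most D crosses the finitely many levels of
      mesh kappa in [-A, A] at most O(D) times, a small fraction of N when Delta
      is large, so for most n each q_l moves by at most kappa in the direction
      of f during the next #L steps ([sign_changes], [levels]).

    At a time n of S with both properties, p(T) P^2 T^n x = sum_k p_k T^(n+k) P y
    is seen by f as sum_l l^n p(l) q_l(n) up to a small error, and p(l) = 0.
    This contradicts f(p(T) P^2 T^n x) > 1, so p(T) P^2 = 0 ([recurrence_zero]).

    On the other hand P^2 is not 0, because approximate eigenvectors at a point
    of K of maximal real part are nearly scaled by P ([projection_sq_neq0]).
    Removing the factors T - l one by one, some operator V, not 0 and commuting
    with T, satisfies T V = l V with |l| = 1.  Then |V T^n x| = |V x| for all n,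
    and the orbit misses the open set |V u| > |V x| ([eigen_not_frequent]).

    The holomorphic calculus is obtained from area integrals of the resolvent
    against the d-bar derivative of a cutoff (Cauchy-Pompeiu) instead of contour
    integrals: no contour around K has to be built, supports can be prescribed
    freely, and the only integration theorem involved is that the integral of
    the d-bar derivative of a compactly supported function vanishes
    ([plane_int_stokes]), which dyadic Riemann sums give by telescoping. *)

(** * Real-valued norms *)

Section RealNorm.
Variable R : realType.
Notation C := R[i].

(** The norm of a normed module over [R[i]] takes values in [R[i]]; its real part
    is compared with real numbers below. *)
Definition nrm (V : normedZmodType C) (v : V) : R := complex.Re `|v|.

Lemma norm_nrm (V : normedZmodType C) (v : V) : `|v| = (nrm v)%:C.
Proof. by rewrite /nrm RRe_real // normr_real. Qed.

Lemma nrm_ge0 (V : normedZmodType C) (v : V) : 0 <= nrm v.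
Proof. by rewrite -ler0c -norm_nrm normr_ge0. Qed.

Lemma nrm0 (V : normedZmodType C) : nrm (0 : V) = 0.
Proof. by rewrite /nrm normr0. Qed.

Lemma nrm_eq0 (V : normedZmodType C) (v : V) : nrm v = 0 -> v = 0.
Proof. by move=> h; apply/eqP; rewrite -normr_eq0 norm_nrm h. Qed.

Lemma nrm_gt0 (V : normedZmodType C) (v : V) : v != 0 -> 0 < nrm v.
Proof.
move=> v0; rewrite lt_neqAle nrm_ge0 andbT eq_sym; apply/eqP => /nrm_eq0 h.
by rewrite h eqxx in v0.
Qed.

Lemma nrmD (V : normedZmodType C) (v w : V) : nrm (v + w) <= nrm v + nrm w.
Proof. by rewrite -lecR rmorphD /= -!norm_nrm ler_normD. Qed.

Lemma nrmN (V : normedZmodType C) (v : V) : nrm (- v) = nrm v.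
Proof. by rewrite /nrm normrN. Qed.

Lemma nrmBC (V : normedZmodType C) (v w : V) : nrm (v - w) = nrm (w - v).
Proof. by rewrite /nrm distrC. Qed.

Lemma nrmB (V : normedZmodType C) (v w : V) : nrm (v - w) <= nrm v + nrm w.
Proof. by rewrite -[nrm w]nrmN nrmD. Qed.

Lemma nrm_tri (V : normedZmodType C) (u v w : V) :
  nrm (v - w) <= nrm (v - u) + nrm (u - w).
Proof. by apply: le_trans (nrmD _ _); rewrite addrA subrK. Qed.

Lemma nrmZ (V : normedModType C) (a : C) (v : V) : nrm (a *: v) = nrm a * nrm v.
Proof. by rewrite /nrm normrZ (norm_nrm a) (norm_nrm v) -rmorphM /=. Qed.

Lemma nrmM (a b : C) : nrm (a * b) = nrm a * nrm b.
Proof. by rewrite /nrm normrM (norm_nrm a) (norm_nrm b) -rmorphM /=. Qed.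

Lemma nrmX (a : C) n : nrm (a ^+ n) = nrm a ^+ n.
Proof.
elim: n => [|n IH]; first by rewrite !expr0 /nrm normr1.
by rewrite !exprS nrmM IH.
Qed.

Lemma nrm_sum (V : normedZmodType C) (I : Type) (s : seq I) (P : pred I) (F : I -> V) :
  nrm (\sum_(i <- s | P i) F i) <= \sum_(i <- s | P i) nrm (F i).
Proof.
elim/big_rec2 : _ => [|i y x _ h]; first by rewrite nrm0.
by apply: le_trans (nrmD _ _) _; rewrite lerD2l.
Qed.

Lemma nrmR (x : R) : nrm (x%:C : C) = `|x|.
Proof. by rewrite /nrm normc_def /= expr0n /= addr0 sqrtr_sqr. Qed.

Lemma nrm1 : nrm (1 : C) = 1.
Proof. by rewrite /nrm normr1. Qed.

Lemma nrmi : nrm ('i%C : C) = 1.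
Proof. by rewrite /nrm normc_def /= expr0n /= add0r expr1n sqrtr1. Qed.

Lemma nrm_sqr (z : C) : nrm z ^+ 2 = complex.Re z ^+ 2 + complex.Im z ^+ 2.
Proof. by apply: (@complexI R); rewrite add_Re2_Im2 norm_nrm -rmorphXn. Qed.

Lemma Re_le (z : C) : `|complex.Re z| <= nrm z.
Proof.
rewrite -(@ler_sqr R) ?nnegrE ?nrm_ge0 // -normrX ger0_norm ?sqr_ge0 // nrm_sqr.
by rewrite lerDl sqr_ge0.
Qed.

Lemma Im_le (z : C) : `|complex.Im z| <= nrm z.
Proof.
rewrite -(@ler_sqr R) ?nnegrE ?nrm_ge0 // -normrX ger0_norm ?sqr_ge0 // nrm_sqr.
by rewrite lerDr sqr_ge0.
Qed.

Lemma nrm_le (z : C) : nrm z <= `|complex.Re z| + `|complex.Im z|.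
Proof.
rewrite {1}[z]complexE.
by apply: le_trans (nrmD _ _) _; rewrite nrmM nrmi mul1r !nrmR.
Qed.

Lemma nrmV (z : C) : nrm z^-1 = (nrm z)^-1.
Proof.
have [->|z0] := eqVneq z 0; first by rewrite invr0 nrm0 invr0.
have n0 : nrm z != 0 by rewrite gt_eqF // nrm_gt0.
by apply: (mulfI n0); rewrite -nrmM !mulfV // nrm1.
Qed.

End RealNorm.

(** * Convergence of sequences *)

Section Convergence.
Variable R : realType.
Notation C := R[i].

Definition seqlim (V : normedZmodType C) (s : nat -> V) (l : V) :=
  forall e : R, 0 < e -> exists N, forall n, (N <= n)%N -> nrm (s n - l) < e.

Lemma small_eq0 (x : R) : (forall e, 0 < e -> x <= e) -> x <= 0.
Proof. by move=> h; apply/ler_addgt0Pr => e /h; rewrite add0r. Qed.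

Lemma seqlim_bound (V : normedZmodType C) (s : nat -> V) l B N :
  seqlim s l -> (forall n, (N <= n)%N -> nrm (s n) <= B) -> nrm l <= B.
Proof.
move=> sl sB; apply/ler_addgt0Pr => e /sl[M hM].
have h1 := hM _ (leq_maxr N M); have h2 := sB _ (leq_maxl N M).
rewrite -(subKr (s (maxn N M)) l); apply: le_trans (nrmB _ _) _.
by rewrite lerD // ltW.
Qed.

Lemma seqlim_unique (V : normedZmodType C) (s : nat -> V) l l' :
  seqlim s l -> seqlim s l' -> l = l'.
Proof.
move=> h1 h2; apply/eqP; rewrite -subr_eq0; apply/eqP; apply: nrm_eq0.
apply/eqP; rewrite eq_le nrm_ge0 andbT; apply: small_eq0 => e e0.
have e2 : 0 < e / 2 by lra.
have [N hN] := h1 _ e2; have [M hM] := h2 _ e2.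
have {}hN := hN _ (leq_maxl N M); have {}hM := hM _ (leq_maxr N M).
have := nrm_tri (s (maxn N M)) l l'; rewrite (nrmBC l (s _)); lra.
Qed.

Lemma seqlimD (V : normedZmodType C) (s t : nat -> V) l l' :
  seqlim s l -> seqlim t l' -> seqlim (fun n => s n + t n) (l + l').
Proof.
move=> h1 h2 e e0; have e2 : 0 < e / 2 by lra.
have [N hN] := h1 _ e2; have [M hM] := h2 _ e2.
exists (maxn N M) => n; rewrite geq_max => /andP[/hN h3 /hM h4].
rewrite opprD addrACA; apply: le_lt_trans (nrmD _ _) _; lra.
Qed.

Lemma seqlim_map (V W : normedZmodType C) (f : V -> W) M s l :
  (forall x y, nrm (f x - f y) <= M * nrm (x - y)) -> seqlim s l ->
  seqlim (fun n => f (s n)) (f l).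
Proof.
move=> fM sl e e0.
have M1 : 0 < `|M| + 1 by rewrite ltr_pwDr.
have [N hN] := sl _ (divr_gt0 e0 M1).
exists N => n /hN; rewrite ltr_pdivlMr // => h; apply: le_lt_trans (fM _ _) _.
apply: le_lt_trans h; rewrite mulrC ler_wpM2l ?nrm_ge0 //.
by have := ler_norm M; lra.
Qed.

Lemma seqlim0 (V : normedZmodType C) (s : nat -> V) l : seqlim (fun n => s n - l) 0 -> seqlim s l.
Proof. by move=> h e /h[N hN]; exists N => n /hN; rewrite subr0. Qed.

Lemma seqlim_eq (V : normedZmodType C) (s t : nat -> V) l N :
  (forall n, (N <= n)%N -> s n = t n) -> seqlim s l -> seqlim t l.
Proof.
move=> st sl e /sl[M hM]; exists (maxn N M) => n.
by rewrite geq_max => /andP[/st <- /hM].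
Qed.

Lemma half_lt (B e : R) : 0 < e -> exists N, forall n, (N <= n)%N -> B / 2 ^+ n < e.
Proof.
move=> e0; exists (Num.Def.truncn (`|B| / e)).+1 => n hn.
rewrite ltr_pdivrMr ?exprn_gt0 //.
apply: le_lt_trans (ler_norm B) _; rewrite mulrC -ltr_pdivrMr //.
apply: lt_le_trans (truncnS_gt _) _.
rewrite -natrX ler_nat; apply: leq_trans hn _.
by rewrite ltnW // ltn_expl.
Qed.

Lemma seqlim_half0 (V : normedZmodType C) (s : nat -> V) B N :
  (forall n, (N <= n)%N -> nrm (s n) <= B / 2 ^+ n) -> seqlim s 0.
Proof.
move=> h e e0; have [M hM] := half_lt B e0.
exists (maxn N M) => n; rewrite geq_max => /andP[/h h1 /hM h2].
by rewrite subr0; apply: le_lt_trans h2.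
Qed.

Variable X : completeNormedModType C.

Lemma geom_tail (s : nat -> X) B N :
  (forall n, (N <= n)%N -> nrm (s n.+1 - s n) <= B / 2 ^+ n) ->
  forall n k, (N <= n)%N -> nrm (s (n + k)%N - s n) <= 2 * B / 2 ^+ n.
Proof.
move=> h n k hn.
have B0 : 0 <= B.
  have := le_trans (nrm_ge0 _) (h _ hn).
  by rewrite pmulr_lge0 // invr_gt0 exprn_gt0.
suff : nrm (s (n + k)%N - s n) <= 2 * B / 2 ^+ n - 2 * B / 2 ^+ (n + k).
  move=> h1; apply: le_trans h1 _; rewrite gerDl oppr_le0.
  by apply: divr_ge0; [exact: mulr_ge0 | exact: exprn_ge0].
elim: k => [|k IH]; first by rewrite addn0 !subrr nrm0.
apply: le_trans (nrm_tri (s (n + k)%N) _ _) _.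
rewrite addnS; have := h (n + k)%N (leq_trans hn (leq_addr _ _)).
have -> : B / 2 ^+ (n + k) = 2 * B / 2 ^+ (n + k) - 2 * B / 2 ^+ (n + k).+1.
  by rewrite exprS; field; rewrite expf_neq0.
move: IH; lra.
Qed.

(** Increments decaying like 2^-n are the only form in which completeness is
    used: Neumann series and dyadic Riemann sums both converge in this way. *)
Lemma complete_seqlim (s : nat -> X) B N :
  (forall n, (N <= n)%N -> nrm (s n.+1 - s n) <= B / 2 ^+ n) ->
  exists l, seqlim s l.
Proof.
move=> /geom_tail h.
have : cvg (s @ \oo).
  apply/cauchy_cvgP/cauchy_exP => e /= e0.
  have er : 0 < complex.Re e by move: e0; rewrite ltcE => /andP[].
  have eE : e = (complex.Re e)%:C by rewrite RRe_real // gtr0_real.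
  have [M hM] := half_lt (2 * B) er.
  pose n := maxn N M.
  exists (s n); exists n => // k /= hk.
  rewrite -ball_normE /ball_ /= norm_nrm eE ltcR nrmBC -(subnKC hk).
  apply: le_lt_trans (h _ _ (leq_maxl N M)) _.
  by apply: hM; rewrite leq_maxr.
move=> /cvg_ex[l sl]; exists l => e e0.
have e0' : (0 : C) < e%:C by rewrite ltcR.
have /cvgrPdist_lt /(_ _ e0') [M _ hM] := sl.
by exists M => n /hM /=; rewrite distrC norm_nrm ltcR.
Qed.

End Convergence.

(** * Compactness of discs *)

Section Compactness.
Variable R : realType.
Notation C := R[i].

(** Compactness of a closed disc in quantitative form: [M] measures at once the
    size of a neighbourhood (the ball of radius [M^-1]) and the property holding
    there, so a finite subcover gives the largest of finitely many constants. *)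
Lemma box_cover (A : R) (Q : R -> C -> Prop) :
  (forall M M' z, M <= M' -> Q M z -> Q M' z) ->
  (forall z0, exists2 M, 0 < M & forall z, M * nrm (z - z0) < 1 -> Q M z) ->
  exists2 M, 0 < M & forall z, nrm z <= A -> Q M z.
Proof.
move=> Qmono Qloc.
have cK : compact (`[- A, A]%classic `*` `[- A, A]%classic : set (R * R)).
  by apply: compact_setX; apply: segment_compact.
have /compact_near_coveringP := cK.
move=> /(_ R (pinfty_nbhs R) (fun M p => Q M (p.1 +i* p.2)) _).
case.
  move=> [x0 y0] _; have [M M0 hM] := Qloc (x0 +i* y0).
  have e0 : 0 < (4 * M)^-1 by rewrite invr_gt0 mulr_gt0.
  exists (ball (x0, y0) (4 * M)^-1, [set M' | M <= M']); first split => /=.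
  - exact: nbhsx_ballx.
  - by exists M; split; [exact: num_real | move=> ? /ltW].
  move=> [[x y] M'] /= [[/= h1 h2] h3]; apply: (Qmono _ _ _ h3); apply: hM.
  rewrite mulrC -ltr_pdivlMr // mul1r.
  apply: le_lt_trans (nrm_le _) _ => /=.
  have E : M^-1 = (4 * M)^-1 + 3 * (4 * M)^-1 by field; rewrite gt_eqF.
  move: h1 h2; rewrite /ball /= !(distrC x0) !(distrC y0) E; lra.
move=> M1 [_ hM1].
exists (Num.max M1 0 + 1); first by rewrite ltr_pwDr // le_max lexx orbT.
move=> z zA; have -> : z = (complex.Re z) +i* (complex.Im z) by case: z {zA}.
apply: (hM1 (Num.max M1 0 + 1) _ (_, _)).
  by apply: le_lt_trans (_ : Num.max M1 0 < _); rewrite ?le_max ?lexx // ltrDl.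
have := Re_le z; have := Im_le z; rewrite !ler_norml => /andP[h1 h2] /andP[h3 h4].
by split => /=; rewrite in_itv /=; apply/andP; split; lra.
Qed.

End Compactness.

(** * Difference quotients for d-bar *)

Section Smooth.
Variable R : realType.
Notation C := R[i].
Implicit Types V : normedModType C.

(** One constant serves as Lipschitz bound and as inverse radius of the ball on
    which it holds; enlarging it weakens the property, so constants coming from
    several properties can be added. *)
Definition lip_near V (f : C -> V) (z0 : C) (M : R) :=
  forall z w, M * nrm (z - z0) < 1 -> M * nrm (w - z0) < 1 ->
    nrm (f z - f w) <= M * nrm (z - w).

Definition lip_at V (f : C -> V) z0 := exists2 M, 0 < M & lip_near f z0 M.

Definition bnd_near V (f : C -> V) (z0 : C) (M : R) :=
  forall z, M * nrm (z - z0) < 1 -> nrm (f z) <= M.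

(** Up to O(h^2) this is h (f_x + i f_y), that is, 2h times the d-bar derivative
    of [f]. *)
Definition dstep V (f : C -> V) (z : C) (h : R) : V :=
  f (z + h%:C) - f z + 'i *: (f (z + 'i * h%:C) - f z).

Definition dbar_near V (f g : C -> V) (z0 : C) (M : R) :=
  forall z h, M * nrm (z - z0) < 1 -> 0 < h -> M * h < 1 ->
    nrm (dstep f z h - h%:C *: g z) <= M * h ^+ 2.

Definition dbar_at V (f g : C -> V) z0 := exists2 M, 0 < M & dbar_near f g z0 M.

(** [g] is twice the d-bar derivative of [f], with an error O(h^2) on [dstep]: at
    mesh h, [g] is then [dstep] / h up to O(h), uniformly on a grid. *)
Definition smooth_at V (f g : C -> V) z0 :=
  [/\ lip_at f z0, lip_at g z0 & dbar_at f g z0].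

Lemma lt1_mono (M M' a : R) : M <= M' -> 0 <= a -> M' * a < 1 -> M * a < 1.
Proof. by move=> MM' a0; apply: le_lt_trans; apply: ler_wpM2r. Qed.

Lemma lip_mono V (f : C -> V) z0 M M' : M <= M' -> lip_near f z0 M -> lip_near f z0 M'.
Proof.
move=> MM' h z w h1 h2.
have h3 := h z w (lt1_mono MM' (nrm_ge0 _) h1) (lt1_mono MM' (nrm_ge0 _) h2).
by apply: le_trans h3 _; rewrite ler_wpM2r ?nrm_ge0.
Qed.

Lemma bnd_mono V (f : C -> V) z0 M M' : M <= M' -> bnd_near f z0 M -> bnd_near f z0 M'.
Proof.
move=> MM' h z h1; apply: le_trans (MM').
exact/h/(lt1_mono MM' (nrm_ge0 _) h1).
Qed.

Lemma dbar_mono V (f g : C -> V) z0 M M' : M <= M' -> dbar_near f g z0 M -> dbar_near f g z0 M'.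
Proof.
move=> MM' h z t h1 t0 h2.
have h3 := h z t (lt1_mono MM' (nrm_ge0 _) h1) t0 (lt1_mono MM' (ltW t0) h2).
by apply: le_trans h3 _; rewrite ler_wpM2r ?sqr_ge0.
Qed.

Lemma lip_bnd V (f : C -> V) z0 : lip_at f z0 ->
  exists M, [/\ 0 < M, lip_near f z0 M & bnd_near f z0 M].
Proof.
move=> [M M0 hM].
have M1 : 0 < M + 1 + nrm (f z0) by have := nrm_ge0 (f z0); lra.
have MM : M <= M + 1 + nrm (f z0) by have := nrm_ge0 (f z0); lra.
exists (M + 1 + nrm (f z0)); split => //; first exact: lip_mono hM.
move=> z hz; have h0 : M * nrm (z0 - z0) < 1 by rewrite subrr nrm0 mulr0.
have h1 := hM z z0 (lt1_mono MM (nrm_ge0 _) hz) h0.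
have h2 := lt1_mono MM (nrm_ge0 _) hz.
rewrite -[f z](subrK (f z0)); apply: le_trans (nrmD _ _) _; lra.
Qed.

Lemma lip_eq V (f f' : C -> V) z0 N : 0 < N ->
  (forall z, N * nrm (z - z0) < 1 -> f z = f' z) -> lip_at f z0 -> lip_at f' z0.
Proof.
move=> N0 ff [M M0 hM]; exists (M + N); first by rewrite addr_gt0.
have MM : M <= M + N by lra.
have NM : N <= M + N by lra.
move=> z w hz hw; rewrite -!ff ?(lt1_mono NM) ?nrm_ge0 //.
exact: (lip_mono MM hM).
Qed.

Lemma lip_cst V (v : V) z0 : lip_at (fun=> v) z0.
Proof. by exists 1 => // z w _ _; rewrite subrr nrm0 mul1r nrm_ge0. Qed.

Lemma lipD V (f g : C -> V) z0 : lip_at f z0 -> lip_at g z0 ->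
  lip_at (fun z => f z + g z) z0.
Proof.
move=> [M M0 hM] [N N0 hN]; exists (M + N); first by rewrite addr_gt0.
move=> z w hz hw; rewrite opprD addrACA; apply: le_trans (nrmD _ _) _.
by rewrite mulrDl lerD //; [apply: hM | apply: hN];
  apply: lt1_mono _ (nrm_ge0 _) _; try eassumption; lra.
Qed.

Lemma lipN V (f : C -> V) z0 : lip_at f z0 -> lip_at (fun z => - f z) z0.
Proof.
move=> [M M0 hM]; exists M => // z w hz hw.
by rewrite -opprD nrmN; apply: hM.
Qed.

Lemma lipZ V (u : C -> C^o) (f : C -> V) z0 : lip_at u z0 -> lip_at f z0 ->
  lip_at (fun z => u z *: f z) z0.
Proof.
move=> /lip_bnd[M [M0 hM bM]] /lip_bnd[N [N0 hN bN]].
have MN : 0 < M * N by rewrite mulr_gt0.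
have E1 : M <= 2 * (M * N) + M + N by lra.
have E2 : N <= 2 * (M * N) + M + N by lra.
exists (2 * (M * N) + M + N); first by lra.
move=> z w hz hw.
have -> : u z *: f z - u w *: f w = u z *: (f z - f w) + (u z - u w) *: f w.
  by rewrite scalerBr scalerBl addrA subrK.
apply: le_trans (nrmD _ _) _; rewrite !nrmZ.
apply: (@le_trans _ _ (M * (N * nrm (z - w)) + (M * nrm (z - w)) * N)).
  apply: lerD; apply: ler_pM; rewrite ?nrm_ge0 //.
  - by apply: bM; apply: lt1_mono E1 (nrm_ge0 _) _.
  - by apply: hN; apply: lt1_mono E2 (nrm_ge0 _) _.
  - by apply: hM; apply: lt1_mono E1 (nrm_ge0 _) _.
  - by apply: bN; apply: lt1_mono E2 (nrm_ge0 _) _.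
have := nrm_ge0 (z - w); nra.
Qed.

Lemma dstepE V (f : C -> V) z h :
  dstep f z h = (f (z + h%:C) - f z) + 'i *: (f (z + 'i * h%:C) - f z).
Proof. by []. Qed.

Lemma nrm_ih (h : R) : 0 < h -> nrm ('i * h%:C : C) = h.
Proof. by move=> h0; rewrite nrmM nrmi mul1r nrmR gtr0_norm. Qed.

Lemma nrm_h (h : R) : 0 < h -> nrm (h%:C : C) = h.
Proof. by move=> h0; rewrite nrmR gtr0_norm. Qed.

Lemma step_near (M : R) (z z0 d : C) (h : R) : 0 < M -> 2 * M * nrm (z - z0) < 1 ->
  2 * M * h < 1 -> nrm d = h -> M * nrm (z + d - z0) < 1.
Proof.
move=> M0 h1 h2 dh; rewrite addrAC.
have : nrm (z - z0 + d) <= nrm (z - z0) + h by rewrite -dh nrmD.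
move: (nrm (z - z0 + d)) => c; nra.
Qed.

(** Leibniz rule: the increment of a product is the sum of the two first order
    terms and of a product of increments, which is O(h^2) because both factors
    are Lipschitz. *)
Lemma smoothZ V (u u' : C -> C^o) (f f' : C -> V) z0 :
  smooth_at u u' z0 -> smooth_at f f' z0 ->
  smooth_at (fun z => u z *: f z) (fun z => u' z *: f z + u z *: f' z) z0.
Proof.
move=> [lu lu' [Mu Mu0 hu]] [lf lf' [Mf Mf0 hf]]; split.
- exact: lipZ.
- by apply: lipD; apply: lipZ.
move: lu lf => /lip_bnd[M [M0 hM bM]] /lip_bnd[N [N0 hN bN]].
have [m m0 [Em1 Em2 Em3 Em4]] : exists2 m, 0 < m & [/\ M <= m, N <= m, Mu <= m & Mf <= m].
  by exists (M + N + Mu + Mf); [lra | split; lra].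
move: {hM}(lip_mono Em1 hM) {bM}(bnd_mono Em1 bM) => hM bM.
move: {hN}(lip_mono Em2 hN) {bN}(bnd_mono Em2 bN) => hN bN.
move: {hu}(dbar_mono Em3 hu) {hf}(dbar_mono Em4 hf) => hu hf.
clear Em1 Em2 Em3 Em4 M N Mu Mf M0 N0 Mu0 Mf0.
have mm : 0 < m ^+ 2 by rewrite exprn_gt0.
exists (2 * m + 4 * m ^+ 2); first by lra.
move=> z h hz h0 hh.
have hz2 : 2 * m * nrm (z - z0) < 1.
  by apply: lt1_mono _ (nrm_ge0 _) hz; lra.
have hh2 : 2 * m * h < 1 by apply: lt1_mono _ (ltW h0) hh; lra.
have hz1 : m * nrm (z - z0) < 1 by apply: lt1_mono _ (nrm_ge0 _) hz2; lra.
have hh1 : m * h < 1 by apply: lt1_mono _ (ltW h0) hh2; lra.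
have n1 := step_near m0 hz2 hh2 (nrm_h h0).
have n2 := step_near m0 hz2 hh2 (nrm_ih h0).
set z1 := z + h%:C in n1 *; set z2 := z + 'i * h%:C in n2 *.
have d1 : nrm (z1 - z) = h by rewrite /z1 addrC addKr nrm_h.
have d2 : nrm (z2 - z) = h by rewrite /z2 addrC addKr nrm_ih.
have key : dstep (fun z => u z *: f z) z h - h%:C *: (u' z *: f z + u z *: f' z) =
   (dstep u z h - h%:C *: u' z) *: f z + u z *: (dstep f z h - h%:C *: f' z)
   + (u z1 - u z) *: (f z1 - f z) + 'i *: ((u z2 - u z) *: (f z2 - f z)).
  have prodB (w : C) : u w *: f w - u z *: f z =
      (u w - u z) *: f z + u z *: (f w - f z) + (u w - u z) *: (f w - f z).
    by rewrite -addrA -scalerDl [u z + _]addrC subrK scalerBl scalerBr addrC addrA subrK.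
  rewrite !dstepE -/z1 -/z2 !prodB.
  move: (u z1 - u z) (u z2 - u z) (f z1 - f z) (f z2 - f z) => U1 U2 F1 F2.
  rewrite !(scalerDl, scalerDr, scalerN, scaleNr, opprD, scalerA, scaleNr).
  rewrite [u z * h%:C]mulrC [u z * 'i]mulrC.
  by rewrite (AC ((3*3)*2) ((((1*4)*7)*((2*5)*8))*3*6)).
rewrite key.
apply: le_trans (nrmD _ _) _; rewrite !nrmZ nrmi mul1r.
apply: le_trans (lerD (nrmD _ _) (lexx _)) _; rewrite !nrmZ.
apply: le_trans (lerD (lerD (nrmD _ _) (lexx _)) (lexx _)) _; rewrite !nrmZ.
have a1 : nrm (dstep u z h - h%:C *: u' z) * nrm (f z) <= (m * h ^+ 2) * m.
  by apply: ler_pM; rewrite ?nrm_ge0 // ?hu ?bN.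
have a2 : nrm (u z) * nrm (dstep f z h - h%:C *: f' z) <= m * (m * h ^+ 2).
  by apply: ler_pM; rewrite ?nrm_ge0 // ?hf ?bM.
have a3 : nrm (u z1 - u z) * nrm (f z1 - f z) <= (m * h) * (m * h).
  by rewrite -d1; apply: ler_pM; rewrite ?nrm_ge0 // ?hM ?hN.
have a4 : nrm (u z2 - u z) * nrm (f z2 - f z) <= (m * h) * (m * h).
  by rewrite -d2; apply: ler_pM; rewrite ?nrm_ge0 // ?hM ?hN.
have h2 : 0 <= h ^+ 2 by rewrite sqr_ge0.
nra.
Qed.

End Smooth.

(** * Smooth functions and bumps *)

Section SmoothFunctions.
Variable R : realType.
Notation C := R[i].

Lemma smooth_eq (V : normedModType C) (f g f' g' : C -> V) z0 N : 0 < N ->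
  (forall z, N * nrm (z - z0) < 1 -> f z = f' z /\ g z = g' z) ->
  smooth_at f g z0 -> smooth_at f' g' z0.
Proof.
move=> N0 E [lf lg [M M0 hM]]; split.
- by apply: (lip_eq N0 _ lf) => z /E[].
- by apply: (lip_eq N0 _ lg) => z /E[].
exists (M + 2 * N); first by rewrite addr_gt0 ?mulr_gt0.
have E1 : M <= M + 2 * N by lra.
have E2 : 2 * N <= M + 2 * N by lra.
have E3 : N <= M + 2 * N by lra.
move=> z h hz h0 hh.
have n1 := step_near N0 (lt1_mono E2 (nrm_ge0 _) hz) (lt1_mono E2 (ltW h0) hh) (nrm_h h0).
have n2 := step_near N0 (lt1_mono E2 (nrm_ge0 _) hz) (lt1_mono E2 (ltW h0) hh) (nrm_ih h0).
have [e1 e2] := E _ (lt1_mono E3 (nrm_ge0 _) hz).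
rewrite /dstep -e1 -e2 -(E _ n1).1 -(E _ n2).1.
exact: (dbar_mono E1 hM).
Qed.

Lemma smooth_cst (V : normedModType C) (v : V) z0 : smooth_at (fun=> v) (fun=> 0) z0.
Proof.
split; [exact: lip_cst | exact: lip_cst | exists 1 => // z h _ h0 _].
by rewrite /dstep subrr !scaler0 addr0 subrr nrm0 mul1r sqr_ge0.
Qed.

Lemma smoothD (V : normedModType C) (f f' g g' : C -> V) z0 :
  smooth_at f f' z0 -> smooth_at g g' z0 ->
  smooth_at (fun z => f z + g z) (fun z => f' z + g' z) z0.
Proof.
move=> [lf lf' [M M0 hM]] [lg lg' [N N0 hN]]; split; [exact: lipD | exact: lipD |].
exists (M + N); first by rewrite addr_gt0.
have E1 : M <= M + N by lra.
have E2 : N <= M + N by lra.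
move=> z h hz h0 hh.
have h1 := hM z h (lt1_mono E1 (nrm_ge0 _) hz) h0 (lt1_mono E1 (ltW h0) hh).
have h2 := hN z h (lt1_mono E2 (nrm_ge0 _) hz) h0 (lt1_mono E2 (ltW h0) hh).
have -> : dstep (fun z => f z + g z) z h - h%:C *: (f' z + g' z) =
   (dstep f z h - h%:C *: f' z) + (dstep g z h - h%:C *: g' z).
  rewrite /dstep !scalerDr !scalerN !scalerDr !opprD.
  by rewrite (AC (((2*2)*(2*2))*2) (((1*3)*(5*7)*9)*((2*4)*(6*8)*10))).
rewrite mulrDl; apply: le_trans (nrmD _ _) _; exact: lerD.
Qed.

Lemma smooth_id z0 : smooth_at (fun z : C => z : C^o) (fun=> 0) z0.
Proof.
split; [|exact: lip_cst|]; exists 1 => //; first by move=> z w _ _; rewrite mul1r.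
move=> z h _ h0 _.
rewrite /dstep scaler0 subr0 [z + h%:C]addrC addrK [z + 'i * _]addrC addrK.
rewrite /GRing.scale /= mulrA -expr2 sqr_i mulN1r subrr nrm0 mul1r.
by rewrite sqr_ge0.
Qed.

(** The square of the positive part has a Lipschitz derivative: it is smooth
    enough here, and replaces the usual exponential in bump functions. *)
Definition pos (x : R) := Num.max 0 x.

Lemma pos_lip a b : `|pos a - pos b| <= `|a - b|.
Proof.
rewrite /pos; case: (leP 0 a); case: (leP 0 b) => // h1 h2.
- by rewrite subr0 !ger0_norm //; lra.
- by rewrite sub0r normrN ger0_norm // ltr0_norm; lra.
- by rewrite subrr normr0.
Qed.

Lemma pos_sqr a b : `|pos a ^+ 2 - pos b ^+ 2 - 2 * pos b * (a - b)| <= (a - b) ^+ 2.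
Proof.
have s1 := sqr_ge0 a; have s2 := sqr_ge0 b; have s3 := sqr_ge0 (a - b).
rewrite /pos ler_norml; case: (leP 0 a) => ha; case: (leP 0 b) => hb;
  rewrite ?expr0n /= ?(mulr0, mul0r, subr0, sub0r); apply/andP; split; nra.
Qed.

Lemma lip_real (u v : C -> R) z0 : (forall z w, `|v z - v w| <= `|u z - u w|) ->
  lip_at (fun z => (u z)%:C : C^o) z0 -> lip_at (fun z => (v z)%:C : C^o) z0.
Proof.
move=> E [M M0 hM]; exists M => // z w hz hw; apply: le_trans (hM z w hz hw).
by rewrite -!rmorphB /= !nrmR.
Qed.

(** Chain rule for the square of the positive part, from the second order Taylor
    bound [pos_sqr]. *)
Lemma smooth_pos (u : C -> R) (g : C -> C^o) z0 :
  smooth_at (fun z => (u z)%:C : C^o) g z0 ->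
  smooth_at (fun z => (pos (u z) ^+ 2)%:C : C^o) (fun z => (2 * pos (u z))%:C *: g z) z0.
Proof.
move=> [lu lg [M1 M10 hM]].
have lp : lip_at (fun z => (pos (u z))%:C : C^o) z0.
  by apply: lip_real lu => z w; apply: pos_lip.
split.
- have E z : (pos (u z) ^+ 2)%:C = (pos (u z))%:C *: ((pos (u z))%:C : C^o) :> C^o.
    by rewrite expr2 rmorphM.
  under [X in lip_at X]eq_fun do rewrite E.
  exact: lipZ.
- apply: lipZ => //.
  have E z : (2 * pos (u z))%:C = (2%:C : C^o) *: ((pos (u z))%:C : C^o) :> C^o.
    by rewrite rmorphM.
  under [X in lip_at X]eq_fun do rewrite E.
  exact: lipZ (lip_cst _ _) lp.
move: lu lp => /lip_bnd[M2 [M20 hu bu]] /lip_bnd[M3 [M30 hp bp]].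
have [m m0 [E1 E2 E3]] : exists2 m, 0 < m & [/\ M1 <= m, M2 <= m & M3 <= m].
  by exists (M1 + M2 + M3); [lra | split; lra].
move: {hM}(dbar_mono E1 hM) {hu}(lip_mono E2 hu) {bp}(bnd_mono E3 bp) => hM hu bp.
clear hp bu E1 E2 E3 M1 M2 M3 M10 M20 M30.
have mm : 0 < m ^+ 2 by rewrite exprn_gt0.
exists (2 * m + 4 * m ^+ 2); first by lra.
move=> z h hz h0 hh.
have hz2 : 2 * m * nrm (z - z0) < 1.
  by apply: lt1_mono _ (nrm_ge0 _) hz; lra.
have hh2 : 2 * m * h < 1 by apply: lt1_mono _ (ltW h0) hh; lra.
have hz1 : m * nrm (z - z0) < 1 by apply: lt1_mono _ (nrm_ge0 _) hz2; lra.
have hh1 : m * h < 1 by apply: lt1_mono _ (ltW h0) hh2; lra.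
have n1 := step_near m0 hz2 hh2 (nrm_h h0).
have n2 := step_near m0 hz2 hh2 (nrm_ih h0).
have {}hM := hM z h hz1 h0 hh1.
move: hM; rewrite /dstep.
set z1 := z + h%:C in n1 *; set z2 := z + 'i * h%:C in n2 * => hM.
have d1 : nrm (z1 - z) = h by rewrite /z1 addrC addKr nrm_h.
have d2 : nrm (z2 - z) = h by rewrite /z2 addrC addKr nrm_ih.
have k w : m * nrm (w - z0) < 1 -> nrm (w - z) = h ->
   nrm ((pos (u w) ^+ 2 - pos (u z) ^+ 2 - 2 * pos (u z) * (u w - u z))%:C : C) <= m ^+ 2 * h ^+ 2.
  move=> nw dw; rewrite nrmR; apply: le_trans (pos_sqr _ _) _.
  have := hu w z nw hz1; rewrite -rmorphB /= nrmR dw => h1.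
  rewrite -(@real_normK _ (u w - u z)) ?num_real // -exprMn lerXn2r ?nnegrE //.
  by rewrite mulr_ge0 ?ltW.
have -> : (pos (u z1) ^+ 2)%:C - (pos (u z) ^+ 2)%:C +
   'i *: ((pos (u z2) ^+ 2)%:C - (pos (u z) ^+ 2)%:C) - h%:C *: ((2 * pos (u z))%:C *: g z) =
   (2 * pos (u z))%:C *: ((u z1)%:C - (u z)%:C + 'i *: ((u z2)%:C - (u z)%:C) - h%:C *: g z)
   + (pos (u z1) ^+ 2 - pos (u z) ^+ 2 - 2 * pos (u z) * (u z1 - u z))%:C
   + 'i *: (pos (u z2) ^+ 2 - pos (u z) ^+ 2 - 2 * pos (u z) * (u z2 - u z))%:C :> C^o.
  by rewrite /GRing.scale /= !(rmorphB, rmorphM, rmorphXn, rmorph1) /=; ring.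
apply: le_trans (nrmD _ _) _.
apply: le_trans (lerD (nrmD _ _) (lexx _)) _; rewrite !nrmZ nrmi mul1r.
have a1 := k _ n1 d1; have a2 := k _ n2 d2.
have a3 : nrm ((2 * pos (u z))%:C : C) <= 2 * m.
  by rewrite rmorphM /= nrmM nrmR ger0_norm // ler_wpM2l // bp.
have : nrm ((2 * pos (u z))%:C : C) *
  nrm ((u z1)%:C - (u z)%:C + 'i *: ((u z2)%:C - (u z)%:C) - h%:C *: g z) <= (2 * m) * (m * h ^+ 2).
  by apply: ler_pM; rewrite ?nrm_ge0.
have : 0 <= h ^+ 2 by rewrite sqr_ge0.
nra.
Qed.

Definition sqd (c z : C) : R := (complex.Re (z - c)) ^+ 2 + (complex.Im (z - c)) ^+ 2.

Lemma sqdE c z : sqd c z = nrm (z - c) ^+ 2.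
Proof. by rewrite nrm_sqr. Qed.

Lemma lip_dist (c : C) z0 : lip_at (fun z => (nrm (z - c))%:C : C^o) z0.
Proof.
exists 1 => // z w _ _; rewrite -rmorphB /= nrmR mul1r ler_norml.
have h1 := nrm_tri w z c; have h2 := nrm_tri z w c.
by rewrite (nrmBC w z) in h2; apply/andP; split; lra.
Qed.

Lemma smooth_sqd (c : C) z0 :
  smooth_at (fun z => (sqd c z)%:C : C^o) (fun z => 2%:R * (z - c)) z0.
Proof.
split.
- under [X in lip_at X]eq_fun do rewrite sqdE expr2 rmorphM.
  exact: (@lipZ _ _ (fun z => (nrm (z - c))%:C) (fun z => (nrm (z - c))%:C : C^o)
    _ (lip_dist c z0) (lip_dist c z0)).
- exists 2 => // z w _ _.
  rewrite -mulrBr opprB addrA subrK nrmM ler_wpM2r ?nrm_ge0 //.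
  by have := nrmR (2 : R); rewrite rmorphMn /= ger0_norm // => <-.
exists 2 => // z h _ h0 _.
have -> : dstep (fun z => (sqd c z)%:C : C^o) z h - h%:C *: (2%:R * (z - c)) =
   (h ^+ 2)%:C * (1 + 'i) :> C^o.
  rewrite /dstep /GRing.scale /= /sqd.
  case: z c => [a b] [p q]; apply/eqP; rewrite eq_complex; simpc => /=.
  by apply/andP; split; apply/eqP; ring.
rewrite nrmM nrmR ger0_norm ?sqr_ge0 // mulrC ler_wpM2r ?sqr_ge0 //.
by apply: le_trans (nrmD _ _) _; rewrite nrm1 nrmi.
Qed.

(** [sd] is twice the d-bar derivative of [sv]. *)
Record smoothfun := SFun { sv :> C -> C^o; sd : C -> C^o; sP : forall z0, smooth_at sv sd z0 }.

Definition sf_cst (c : C) := SFun (smooth_cst (c : C^o)).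
Definition sf_id := SFun smooth_id.
Definition sf_add (u v : smoothfun) := SFun (fun z => smoothD (sP u z) (sP v z)).
Definition sf_mul (u v : smoothfun) := SFun (fun z => smoothZ (sP u z) (sP v z)).
Definition sf_sub (u v : smoothfun) := sf_add u (sf_mul (sf_cst (-1)) v).
Lemma svD u v z : sf_add u v z = u z + v z. Proof. by []. Qed.
Lemma sdD u v z : sd (sf_add u v) z = sd u z + sd v z. Proof. by []. Qed.
Lemma svM u v z : sf_mul u v z = u z * v z. Proof. by []. Qed.
Lemma sdM u v z : sd (sf_mul u v) z = sd u z * v z + u z * sd v z. Proof. by []. Qed.
Lemma svB u v z : sf_sub u v z = u z - v z.
Proof. by rewrite svD svM mulN1r. Qed.
Lemma sdB u v z : sd (sf_sub u v) z = sd u z - sd v z.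
Proof. by rewrite sdD sdM mul0r add0r mulN1r. Qed.

Fixpoint sf_exp (u : smoothfun) n := if n is n'.+1 then sf_mul u (sf_exp u n') else sf_cst 1.

(** With t = |z - c|^2 / r^2, the function 1 - pos(1 - pos(2 - t)^2)^2 is 1 for
    t <= 1 and 0 for t >= 2; its derivative is a real multiple of z - c, because
    that of t is. *)
Lemma smooth_bump c (r : R) z0 :
  smooth_at (fun z => (1 - pos (1 - pos (2 - sqd c z / r ^+ 2) ^+ 2) ^+ 2)%:C : C^o)
   (fun z => (- (8 / r ^+ 2 * pos (1 - pos (2 - sqd c z / r ^+ 2) ^+ 2)
        * pos (2 - sqd c z / r ^+ 2)))%:C * (z - c) : C^o) z0.
Proof.
have h1 : smooth_at (fun z => (2 - sqd c z / r ^+ 2)%:C : C^o)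
    (fun z => (- 2 / r ^+ 2)%:C * (z - c)) z0.
  have := smoothD (smooth_cst (2%:C : C^o) z0)
    (smoothZ (smooth_cst ((- (r ^+ 2)^-1)%:C : C^o) z0) (smooth_sqd c z0)).
  apply: (@smooth_eq _ _ _ _ _ z0 1) => // z _; split.
    by rewrite /GRing.scale /= -rmorphM -rmorphD /= mulNr mulrC.
  rewrite add0r scale0r add0r /GRing.scale /= mulrA; congr (_ * _).
  by rewrite !rmorphM !rmorphN /= rmorphMn /=; ring.
have h2 := smooth_pos h1.
have h3 : smooth_at (fun z => (1 - pos (2 - sqd c z / r ^+ 2) ^+ 2)%:C : C^o)
    (fun z => (4 / r ^+ 2 * pos (2 - sqd c z / r ^+ 2))%:C * (z - c)) z0.
  have := smoothD (smooth_cst (1%:C : C^o) z0)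
    (smoothZ (smooth_cst ((- 1)%:C : C^o) z0) h2).
  apply: (@smooth_eq _ _ _ _ _ z0 1) => // z _; split.
    by rewrite /GRing.scale /= -rmorphM -rmorphD /= mulN1r.
  rewrite add0r scale0r add0r /GRing.scale /= !mulrA; congr (_ * _).
  by rewrite -!rmorphM /=; congr (_%:C); ring.
have h4 := smooth_pos h3.
have := smoothD (smooth_cst (1%:C : C^o) z0)
    (smoothZ (smooth_cst ((- 1)%:C : C^o) z0) h4).
apply: (@smooth_eq _ _ _ _ _ z0 1) => // z _; split.
  by rewrite /GRing.scale /= -rmorphM -rmorphD /= mulN1r.
rewrite add0r scale0r add0r /GRing.scale /= !mulrA; congr (_ * _).
by rewrite -!rmorphM /=; congr (_%:C); ring.
Qed.

Definition sf_bump c r := SFun (smooth_bump c r).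

Lemma bump1 c (r : R) z : 0 < r -> nrm (z - c) <= r -> sf_bump c r z = 1 /\ sd (sf_bump c r) z = 0.
Proof.
move=> r0 h.
have : sqd c z / r ^+ 2 <= 1.
  by rewrite ler_pdivrMr ?exprn_gt0 // mul1r sqdE lerXn2r // nnegrE ?nrm_ge0 ?(ltW r0).
rewrite /=; move: (sqd c z / r ^+ 2) => t t1.
have -> : pos (2 - t) = 2 - t by rewrite /pos max_r //; lra.
have -> : pos (1 - (2 - t) ^+ 2) = 0 by rewrite /pos max_l //; nra.
by rewrite expr0n subr0 mulr0 mul0r oppr0 mul0r.
Qed.

Lemma bump0 c (r : R) z : 0 < r -> 2 * r <= nrm (z - c) -> sf_bump c r z = 0 /\ sd (sf_bump c r) z = 0.
Proof.
move=> r0 h.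
have : 2 <= sqd c z / r ^+ 2.
  by rewrite ler_pdivlMr ?exprn_gt0 // sqdE; nra.
rewrite /=; move: (sqd c z / r ^+ 2) => t t1.
have -> : pos (2 - t) = 0 by rewrite /pos max_l //; lra.
have -> : pos (1 - 0 ^+ 2) = 1 by rewrite /pos expr0n subr0 max_r.
by rewrite expr1n subrr mulr0 oppr0 mul0r.
Qed.

End SmoothFunctions.

(** * Integration over a square *)

Section Integral.
Variable R : realType.
Notation C := R[i].
Variable o : C.

(** Dyadic grid of mesh 2^-k of the square of side 8 centred at [o]; this square
    contains the disc of radius 3 around [o], outside which the cutoffs vanish. *)
Definition grid_pt k (i j : nat) : C :=
  o + ((i%:R / 2 ^+ k - 4) +i* (j%:R / 2 ^+ k - 4)).

Definition grid_size k := (8 * 2 ^ k)%N.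

Definition grid_sum (V : normedModType C) (g : C -> V) k : V :=
  ((4 ^+ k)^-1)%:C *: \sum_(0 <= i < grid_size k) \sum_(0 <= j < grid_size k) g (grid_pt k i j).

Lemma pow2_gt0 k : (0 : R) < 2 ^+ k. Proof. by rewrite exprn_gt0. Qed.

Lemma grid_sizeR k : ((grid_size k)%:R : R) = 8 * 2 ^+ k.
Proof. by rewrite /grid_size natrM natrX. Qed.

Lemma grid_pt_bound k i j : (i < grid_size k)%N -> (j < grid_size k)%N -> nrm (grid_pt k i j) <= nrm o + 8.
Proof.
have coord (n : nat) : (n < grid_size k)%N -> `|n%:R / 2 ^+ k - 4| <= (4 : R).
  move=> hn; have : (n%:R : R) <= 8 * 2 ^+ k by rewrite -grid_sizeR ler_nat ltnW.
  rewrite -ler_pdivrMr ?pow2_gt0 // => h1.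
  have : (0 : R) <= n%:R / 2 ^+ k by rewrite divr_ge0 // ltW ?pow2_gt0.
  by move=> h2; rewrite ler_norml; apply/andP; split; lra.
move=> /coord hi /coord hj; apply: le_trans (nrmD _ _) _; rewrite lerD2l.
by apply: le_trans (nrm_le _) _ => /=; lra.
Qed.

Lemma sum_double (V : zmodType) (F : nat -> V) n :
  \sum_(0 <= i < 2 * n) F i = \sum_(0 <= i < n) (F (2 * i)%N + F (2 * i).+1).
Proof.
elim: n => [|n IH]; first by rewrite muln0 !big_geq.
have -> : (2 * n.+1 = (2 * n).+2)%N by rewrite mulnS.
by rewrite !big_nat_recr //= IH addrA.
Qed.

Lemma nrm_sum2 (V : normedModType C) (F : nat -> nat -> V) n m b :
  (forall i j, (i < n)%N -> (j < m)%N -> nrm (F i j) <= b) ->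
  nrm (\sum_(0 <= i < n) \sum_(0 <= j < m) F i j) <= n%:R * (m%:R * b).
Proof.
move=> h; apply: le_trans (nrm_sum _ _ _) _.
rewrite (_ : n%:R * _ = \sum_(0 <= i < n) \sum_(0 <= j < m) b).
  rewrite !big_mkord; apply: ler_sum => i _; apply: le_trans (nrm_sum _ _ _) _.
  by rewrite !big_mkord; apply: ler_sum => j _; apply: h.
by rewrite !sumr_const_nat !subn0 !mulr_natl.
Qed.

Lemma grid_sum_bound (V : normedModType C) (g : C -> V) k b :
  (forall i j, (i < grid_size k)%N -> (j < grid_size k)%N -> nrm (g (grid_pt k i j)) <= b) ->
  nrm (grid_sum g k) <= 64 * b.
Proof.
move=> h; rewrite /grid_sum nrmZ nrmR ger0_norm ?invr_ge0 ?exprn_ge0 //.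
rewrite mulrC ler_pdivrMr ?exprn_gt0 //.
apply: le_trans (nrm_sum2 h) _.
rewrite grid_sizeR (_ : (4 : R) ^+ k = 2 ^+ k * 2 ^+ k); last by rewrite -exprMn -natrM.
by rewrite le_eqVlt; apply/orP; left; apply/eqP; ring.
Qed.

Lemma grid_sumD (V : normedModType C) (g g' : C -> V) k :
  grid_sum (fun z => g z + g' z) k = grid_sum g k + grid_sum g' k.
Proof.
rewrite /grid_sum -scalerDr -big_split /=; congr (_ *: _).
by apply: eq_bigr => i _; rewrite big_split.
Qed.

Lemma grid_sum_map (V W : normedModType C) (f : V -> W) (g : C -> V) k :
  (forall x y, f (x + y) = f x + f y) -> (forall a x, f (a *: x) = a *: f x) ->
  grid_sum (fun z => f (g z)) k = f (grid_sum g k).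
Proof.
move=> fD fZ; have f0 : f 0 = 0 by rewrite -(scale0r 0) fZ scale0r.
rewrite /grid_sum fZ (big_morph f fD f0); congr (_ *: _).
by apply: eq_bigr => i _; rewrite (big_morph f fD f0).
Qed.

Lemma unif_lip (V : normedModType C) (g : C -> V) A : (forall z, lip_at g z) ->
  exists2 M, 0 < M & forall z, nrm z <= A ->
    forall w, M * nrm (w - z) < 1 -> nrm (g z - g w) <= M * nrm (z - w).
Proof.
move=> lg; apply: (@box_cover R A (fun M z => forall w, M * nrm (w - z) < 1 ->
    nrm (g z - g w) <= M * nrm (z - w))).
  move=> M M' z MM' h w h1.
  apply: le_trans (h w (lt1_mono MM' (nrm_ge0 _) h1)) _.
  by rewrite ler_wpM2r ?nrm_ge0.
move=> z0; have [M M0 hM] := lg z0; exists (2 * M); first by rewrite mulr_gt0.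
move=> z hz w hw.
have h1 : M * nrm (z - z0) < 1 by apply: lt1_mono _ (nrm_ge0 _) hz; lra.
apply: le_trans (hM z w h1 _) _.
  by have := nrm_tri z w z0; move: (nrm (w - z0)) => c; nra.
by rewrite ler_wpM2r ?nrm_ge0 //; lra.
Qed.

Lemma unif_bnd (V : normedModType C) (g : C -> V) A : (forall z, lip_at g z) ->
  exists2 M, 0 < M & forall z, nrm z <= A -> nrm (g z) <= M.
Proof.
move=> lg; apply: (@box_cover R A (fun M z => nrm (g z) <= M)).
  by move=> M M' z MM' h; apply: le_trans MM'.
by move=> z0; have [M [M0 _ hM]] := lip_bnd (lg z0); exists M.
Qed.

Lemma unif_dbar (V : normedModType C) (f g : C -> V) A : (forall z, dbar_at f g z) ->
  exists2 M, 0 < M & forall z, nrm z <= A ->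
    forall h, 0 < h -> M * h < 1 -> nrm (dstep f z h - h%:C *: g z) <= M * h ^+ 2.
Proof.
move=> lg; apply: (@box_cover R A (fun M z => forall h, 0 < h -> M * h < 1 ->
    nrm (dstep f z h - h%:C *: g z) <= M * h ^+ 2)).
  move=> M M' z MM' H h h0 h1.
  apply: le_trans (H h h0 (lt1_mono MM' (ltW h0) h1)) _.
  by rewrite ler_wpM2r ?sqr_ge0.
by move=> z0; have [M M0 hM] := lg z0; exists M => // z hz h h0 h1; apply: hM.
Qed.

Lemma grid_pt_refine k i j (a b : nat) : (a <= 1)%N -> (b <= 1)%N ->
  nrm (grid_pt k.+1 (2 * i + a) (2 * j + b) - grid_pt k i j) <= (2 ^+ k)^-1.
Proof.
move=> a1 b1.
have -> : grid_pt k.+1 (2 * i + a) (2 * j + b) - grid_pt k i j =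
    (((2 * i + a)%:R / 2 ^+ k.+1 - 4) +i* ((2 * j + b)%:R / 2 ^+ k.+1 - 4))
    - ((i%:R / 2 ^+ k - 4) +i* (j%:R / 2 ^+ k - 4)) by rewrite /grid_pt; ring.
have e (n c : nat) : ((2 * n + c)%:R / 2 ^+ k.+1 - 4) - (n%:R / 2 ^+ k - 4) = c%:R / 2 / 2 ^+ k :> R.
  by rewrite exprS natrD natrM; field; rewrite expf_neq0.
apply: le_trans (nrm_le _) _; rewrite /= !e.
have p0 := pow2_gt0 k.
rewrite !ger0_norm ?divr_ge0 ?(ltW p0) // -mulrDl ler_pdivrMr // mulVf ?gt_eqF //.
have : (a%:R : R) <= 1 by rewrite lern1.
have : (b%:R : R) <= 1 by rewrite lern1.
lra.
Qed.

(** Refining the grid replaces each value by the mean of four values at distance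
    at most 2^-k. *)
Lemma grid_sum_step (V : normedModType C) (g : C -> V) M k : 0 < M ->
  (forall z, nrm z <= nrm o + 8 ->
    forall w, M * nrm (w - z) < 1 -> nrm (g z - g w) <= M * nrm (z - w)) ->
  M / 2 ^+ k < 1 ->
  nrm (grid_sum g k.+1 - grid_sum g k) <= 64 * M / 2 ^+ k.
Proof.
move=> M0 hg hk.
pose D i j := (g (grid_pt k.+1 (2 * i + 0) (2 * j + 0)) - g (grid_pt k i j))
           + (g (grid_pt k.+1 (2 * i + 0) (2 * j + 1)) - g (grid_pt k i j))
           + ((g (grid_pt k.+1 (2 * i + 1) (2 * j + 0)) - g (grid_pt k i j))
           + (g (grid_pt k.+1 (2 * i + 1) (2 * j + 1)) - g (grid_pt k i j))).
have -> : grid_sum g k.+1 - grid_sum g k =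
   ((4 ^+ k.+1)^-1)%:C *: \sum_(0 <= i < grid_size k) \sum_(0 <= j < grid_size k) D i j.
  rewrite /grid_sum.
  have -> : ((4 ^+ k)^-1)%:C = ((4 ^+ k.+1)^-1)%:C * 4 :> C.
    rewrite (_ : (4 : C) = 4%:C); last by rewrite rmorphMn.
    rewrite -rmorphM /=; congr (_%:C); rewrite exprS.
    by field; rewrite expf_neq0.
  rewrite -scalerA -scalerBr; congr (_ *: _).
  have -> : grid_size k.+1 = (2 * grid_size k)%N by rewrite /grid_size expnS mulnCA.
  rewrite sum_double scaler_sumr -sumrB; apply: eq_bigr => i _.
  rewrite !sum_double scaler_sumr -big_split -sumrB; apply: eq_bigr => j _ /=.
  rewrite /D !addn0 !addn1.
  have -> : (4 : C) *: g (grid_pt k i j) = g (grid_pt k i j) + g (grid_pt k i j) + (g (grid_pt k i j) + g (grid_pt k i j)).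
    by rewrite (_ : (4 : C) = (1 + 1) + (1 + 1)); [rewrite !scalerDl !scale1r | ring].
  by rewrite !opprD (AC ((2*2)*(2*2)) (((1*5)*(2*6))*((3*7)*(4*8)))).
have d i j a b : (i < grid_size k)%N -> (j < grid_size k)%N -> (a <= 1)%N -> (b <= 1)%N ->
   nrm (g (grid_pt k.+1 (2 * i + a) (2 * j + b)) - g (grid_pt k i j)) <= M / 2 ^+ k.
  move=> hi hj ha hb; rewrite nrmBC.
  have h1 := grid_pt_refine k i j ha hb.
  have h2 : M * nrm (grid_pt k.+1 (2 * i + a) (2 * j + b) - grid_pt k i j) <= M / 2 ^+ k.
    by rewrite ler_wpM2l ?(ltW M0).
  by apply: le_trans (hg _ (grid_pt_bound hi hj) _ (le_lt_trans h2 hk)) _; rewrite nrmBC.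
rewrite nrmZ nrmR ger0_norm ?invr_ge0 ?exprn_ge0 //.
rewrite mulrC ler_pdivrMr ?exprn_gt0 //.
apply: le_trans (nrm_sum2 (b := 4 * (M / 2 ^+ k)) _) _.
  move=> i j hi hj; apply: le_trans (nrmD _ _) _.
  apply: le_trans (lerD (nrmD _ _) (nrmD _ _)) _.
  have := d i j 0 0 hi hj isT isT; have := d i j 0 1 hi hj isT isT.
  have := d i j 1 0 hi hj isT isT; have := d i j 1 1 hi hj isT isT.
  rewrite /=; lra.
rewrite grid_sizeR (_ : (4 : R) ^+ k.+1 = 4 * (2 ^+ k * 2 ^+ k)); last first.
  by rewrite exprS -exprMn -natrM.
have p0 := pow2_gt0 k.
by rewrite le_eqVlt; apply/orP; left; apply/eqP; field; rewrite gt_eqF.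
Qed.

Variable X : completeNormedModType C.

Definition plane_int (g : C -> X) : X :=
  if pselect (exists l, seqlim (grid_sum g) l) is left e then projT1 (cid e) else 0.

Lemma plane_int_lim g : (forall z, lip_at g z) -> seqlim (grid_sum g) (plane_int g).
Proof.
move=> lg; have [M M0 hM] := unif_lip (nrm o + 8) lg.
rewrite /plane_int; case: pselect => [e|ne]; first by case: (cid e).
case: ne; have [N hN] := half_lt M ltr01.
apply: (@complete_seqlim _ _ _ (64 * M) N) => n /hN h.
exact: (grid_sum_step M0 hM h).
Qed.

Lemma plane_int_unique g l : seqlim (grid_sum g) l -> plane_int g = l.
Proof.
move=> h; rewrite /plane_int; case: pselect => [e|]; last by case; exists l.
by case: (cid e) => l' /= h'; apply: seqlim_unique h' h.
Qed.

Lemma plane_intD g g' : (forall z, lip_at g z) -> (forall z, lip_at g' z) ->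
  plane_int (fun z => g z + g' z) = plane_int g + plane_int g'.
Proof.
move=> /plane_int_lim h /plane_int_lim h'; apply: plane_int_unique.
by apply: (seqlim_eq (N := 0%N) _ (seqlimD h h')) => n _; rewrite grid_sumD.
Qed.

Lemma plane_int_map (f : X -> X) M g : (forall x y, f (x + y) = f x + f y) ->
  (forall a x, f (a *: x) = a *: f x) -> (forall x, nrm (f x) <= M * nrm x) ->
  (forall z, lip_at g z) -> plane_int (fun z => f (g z)) = f (plane_int g).
Proof.
move=> fD fZ fM /plane_int_lim h; apply: plane_int_unique.
have fB x y : nrm (f x - f y) <= M * nrm (x - y).
  by rewrite -scaleN1r -fZ -fD scaleN1r.
by apply: (seqlim_eq (N := 0%N) _ (seqlim_map fB h)) => n _; rewrite grid_sum_map.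
Qed.

Lemma plane_int_bound g b : (forall z, lip_at g z) ->
  (forall z, nrm z <= nrm o + 8 -> nrm (g z) <= b) -> nrm (plane_int g) <= 64 * b.
Proof.
move=> /plane_int_lim h hb; apply: (seqlim_bound (N := 0) h) => k _.
by apply: grid_sum_bound => i j hi hj; apply/hb/grid_pt_bound.
Qed.

Lemma grid_ptS1 k i j : grid_pt k i.+1 j = grid_pt k i j + ((2 ^+ k)^-1)%:C.
Proof.
rewrite /grid_pt -addrA; congr (_ + _); apply/eqP; rewrite eq_complex /= addr0 eqxx andbT.
by apply/eqP; rewrite -natr1 mulrDl mul1r addrAC.
Qed.

Lemma grid_ptS2 k i j : grid_pt k i j.+1 = grid_pt k i j + 'i * ((2 ^+ k)^-1)%:C.
Proof.
rewrite /grid_pt -addrA; congr (_ + _); apply/eqP; rewrite eq_complex /=.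
rewrite !mul0r !mul1r subr0 addr0 eqxx /= add0r.
by apply/eqP; rewrite -natr1 mulrDl mul1r addrAC.
Qed.

Lemma grid_pt_edge k i j : (i == 0)%N || (i == grid_size k)%N || (j == 0)%N || (j == grid_size k)%N ->
  3 <= nrm (grid_pt k i j - o).
Proof.
have p0 := pow2_gt0 k.
have e n : (n == 0)%N || (n == grid_size k)%N -> 4 <= `|n%:R / 2 ^+ k - 4| :> R.
  case/orP => /eqP ->; first by rewrite mul0r sub0r normrN ger0_norm.
  rewrite grid_sizeR -mulrA mulfV ?gt_eqF // ger0_norm; lra.
rewrite /grid_pt addrC addKr -orbA => /orP[/e h|/e h].
  have := le_trans h (Re_le ((i%:R / 2 ^+ k - 4) +i* (j%:R / 2 ^+ k - 4))).
  by apply: le_trans; lra.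
have := le_trans h (Im_le ((i%:R / 2 ^+ k - 4) +i* (j%:R / 2 ^+ k - 4))).
by apply: le_trans; lra.
Qed.

(** For a compactly supported function the sum of its steps [dstep] over the
    grid telescopes to 0 along rows and along columns, while h times the Riemann
    summand of the derivative differs from [dstep] by O(h^2) only. *)
Lemma plane_int_stokes (f g : C -> X) : (forall z, smooth_at f g z) ->
  (forall z, 3 <= nrm (z - o) -> f z = 0) -> plane_int g = 0.
Proof.
move=> sf f0; apply: plane_int_unique.
have [M M0 hM] : exists2 M, 0 < M & forall z, nrm z <= nrm o + 8 ->
    forall h, 0 < h -> M * h < 1 -> nrm (dstep f z h - h%:C *: g z) <= M * h ^+ 2.
  by apply: unif_dbar => z; case: (sf z).
have [N hN] := half_lt M ltr01.
apply: (@seqlim_half0 _ _ _ (64 * M) N) => k /hN hk.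
have p0 := pow2_gt0 k.
pose h : R := (2 ^+ k)^-1; have h0 : 0 < h by rewrite invr_gt0.
have Z : \sum_(0 <= i < grid_size k) \sum_(0 <= j < grid_size k) dstep f (grid_pt k i j) h = 0.
  rewrite /dstep; under eq_bigr do rewrite big_split /=.
  rewrite big_split /= exchange_big /= big1_seq ?add0r.
    rewrite big1_seq // => i _; rewrite -scaler_sumr.
    under eq_bigr do rewrite -grid_ptS2.
    by rewrite telescope_sumr // !f0 ?subrr ?scaler0 //; apply: grid_pt_edge; rewrite eqxx ?orbT.
  move=> j _; under eq_bigr do rewrite -grid_ptS1.
  by rewrite telescope_sumr // !f0 ?subrr //; apply: grid_pt_edge; rewrite eqxx ?orbT.
have -> : grid_sum g k = grid_sum (fun z => - (h^-1)%:C *: (dstep f z h - h%:C *: g z)) k.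
  rewrite /grid_sum; congr (_ *: _).
  transitivity (\sum_(0 <= i < grid_size k) \sum_(0 <= j < grid_size k)
     (- (h^-1)%:C *: dstep f (grid_pt k i j) h + g (grid_pt k i j))).
    under [RHS]eq_bigr do rewrite big_split /=.
    rewrite big_split /=; under [X in _ = X + _]eq_bigr do rewrite -scaler_sumr.
    by rewrite -scaler_sumr Z scaler0 add0r.
  apply: eq_bigr => i _; apply: eq_bigr => j _.
  rewrite scalerBr scaleNr -scaleNr scalerA mulNr -rmorphM /= mulVf ?gt_eqF //.
  by rewrite scaleN1r opprK.
rewrite -mulrA; apply: grid_sum_bound => i j hi hj.
rewrite nrmZ nrmN nrmR ger0_norm ?invr_ge0 ?(ltW h0) //.
rewrite mulrC ler_pdivrMr ?invr_gt0 // -mulrA -expr2.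
exact: hM (grid_pt_bound hi hj) _ h0 hk.
Qed.

End Integral.

(** * Bounded operators *)

Section BoundedOperators.
Variables (R : realType) (X : completeNormedModType R[i]).
Notation C := R[i].

(** Bounded linear operators as bare functions: the operators below are built by
    choice and integration and would otherwise need a structure each. *)
Definition blin (A : X -> X) :=
  [/\ forall x y, A (x + y) = A x + A y, forall a x, A (a *: x) = a *: A x
    & exists2 M : R, 0 < M & forall x, nrm (A x) <= M * nrm x].

Lemma blin_linear A : blin A -> exists2 S : {linear X -> X}, bounded_operator S & S =1 A.
Proof.
move=> [AD AZ [M M0 AM]].
have lA : linear A by move=> a x y; rewrite AD AZ.
pose S : {linear X -> X} := HB.pack A (GRing.isLinear.Build _ _ _ _ A lA).
exists S => //; apply/linear_boundedP.
exists M%:C; split; first by rewrite complex_real.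
move=> r hr x; apply: (@le_trans _ _ (M%:C * `|x|)); last by rewrite ler_wpM2r // ltW.
  by rewrite (norm_nrm (S x)) (norm_nrm x) -rmorphM lecR; apply: AM.
Qed.

Lemma linear_blin (S : {linear X -> X}) : bounded_operator S -> blin S.
Proof.
move=> /linear_boundedP[M [Mr hM]]; split.
- by move=> x y; rewrite linearD.
- by move=> a x; rewrite linearZZ.
exists (`|complex.Re M| + 1); first by rewrite ltr_wpDl.
move=> x; have h : M < (`|complex.Re M| + 1)%:C.
  rewrite -[X in X < _]RRe_real // ltcR.
  by have := ler_norm (complex.Re M); lra.
by have := hM _ h x; rewrite (norm_nrm (S x)) (norm_nrm x) -rmorphM lecR.
Qed.

Lemma blin0 A : blin A -> A 0 = 0.
Proof. by move=> [_ AZ _]; rewrite -{1}(scale0r (0 : X)) AZ scale0r. Qed.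

Lemma blinN A x : blin A -> A (- x) = - A x.
Proof. by move=> [_ AZ _]; rewrite -scaleN1r AZ scaleN1r. Qed.

Lemma blinB A x y : blin A -> A (x - y) = A x - A y.
Proof. by move=> bA; rewrite -blinN //; case: bA. Qed.

Lemma blin_sum A (I : Type) (s : seq I) (P : pred I) (F : I -> X) : blin A ->
  A (\sum_(i <- s | P i) F i) = \sum_(i <- s | P i) A (F i).
Proof. by move=> bA; apply: big_morph; [case: bA | apply: blin0]. Qed.

Lemma blin_id : blin (fun x => x).
Proof. by split => //; exists 1 => // x; rewrite mul1r. Qed.

Lemma blin_cst0 : blin (fun x => 0).
Proof.
split => *; rewrite ?addr0 ?scaler0 //.
by exists 1 => // x; rewrite nrm0 mul1r nrm_ge0.
Qed.

Lemma blin_comp A B : blin A -> blin B -> blin (fun x => A (B x)).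
Proof.
move=> [AD AZ [M M0 AM]] [BD BZ [N N0 BN]]; split => *; rewrite ?(BD, AD, BZ, AZ) //.
exists (M * N); first exact: mulr_gt0.
by move=> x; apply: le_trans (AM _) _; rewrite -mulrA ler_wpM2l ?(ltW M0).
Qed.

Lemma blinD A B : blin A -> blin B -> blin (fun x => A x + B x).
Proof.
move=> [AD AZ [M M0 AM]] [BD BZ [N N0 BN]]; split.
- by move=> x y; rewrite AD BD addrACA.
- by move=> a x; rewrite AZ BZ scalerDr.
exists (M + N); first exact: addr_gt0.
by move=> x; apply: le_trans (nrmD _ _) _; rewrite mulrDl lerD.
Qed.

Lemma blinZ (a : C) A : blin A -> blin (fun x => a *: A x).
Proof.
move=> [AD AZ [M M0 AM]]; split.
- by move=> x y; rewrite AD scalerDr.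
- by move=> b x; rewrite AZ !scalerA mulrC.
exists ((nrm a + 1) * M); first by rewrite mulr_gt0 // ltr_wpDl ?nrm_ge0.
move=> x; rewrite nrmZ -mulrA ler_pM ?nrm_ge0 //; first by rewrite lerDl.
Qed.

Lemma blin_iter A n : blin A -> blin (iter n A).
Proof. by move=> bA; elim: n => [|n IH] /=; [exact: blin_id | exact: blin_comp]. Qed.

Lemma neumann A : blin A -> (forall x, nrm (A x) <= nrm x / 2) ->
  exists B, [/\ blin B, forall x, B (x - A x) = x, forall x, B x - A (B x) = x
    & forall x, nrm (B x) <= 2 * nrm x].
Proof.
move=> bA A2; case: (bA) => AD AZ [M M0 AM].
pose s x n := \sum_(0 <= k < n) iter k A x.
have An n x : nrm (iter n A x) <= nrm x / 2 ^+ n.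
  elim: n => [|n IH] /=; first by rewrite expr0 divr1.
  apply: le_trans (A2 _) _; rewrite exprS invfM mulrCA mulrC ler_wpM2l ?invr_ge0 //.
have cv x : exists l, seqlim (s x) l.
  apply: (@complete_seqlim _ _ _ (nrm x) 0%N) => n _.
  by rewrite /s [X in X - _]big_nat_recr //= [X in X - _]addrC addrK.
pose B x := projT1 (cid (cv x)).
have sB x : seqlim (s x) (B x) by rewrite /B; case: (cid (cv x)).
have AB x y : nrm (A x - A y) <= M * nrm (x - y) by rewrite -blinB.
have Blin0 x : nrm (B x) <= 2 * nrm x.
  apply: (seqlim_bound (N := 0%N) (sB x)) => n _.
  have := @geom_tail _ _ (s x) (nrm x) 0%N _ 0%N n isT.
  rewrite expr0 divr1 add0n [s x 0%N]big_geq // subr0; apply => k _.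
  by rewrite /s [X in X - _]big_nat_recr //= [X in X - _]addrC addrK.
have sA x n : A (s x n) = s (A x) n.
  by rewrite /s blin_sum //; apply: eq_bigr => i _; rewrite -iterS iterSr.
have tele x n : s x n - A (s x n) = x - iter n A x.
  elim: n => [|n IH]; first by rewrite /s big_geq // (blin0 bA) !subrr.
  have -> : s x n.+1 = s x n + iter n A x by rewrite /s big_nat_recr.
  by rewrite AD opprD addrACA IH addrA subrK.
exists B; split => //.
- split; last by exists 2.
  + move=> x y; apply: seqlim_unique (sB _) _.
    apply: (seqlim_eq (N := 0%N) _ (seqlimD (sB x) (sB y))) => n _.
    rewrite /s -big_split /=; apply: eq_bigr => k _.
    by case: (blin_iter k bA) => ->.
  + move=> a x; apply: seqlim_unique (sB _) _.
    have := @seqlim_map _ _ _ (fun v : X => a *: v) (nrm a) _ _ _ (sB x).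
    move=> H; apply: (seqlim_eq (N := 0%N) _ (H _)) => [n _|u v].
      rewrite /s scaler_sumr; apply: eq_bigr => k _.
      by case: (blin_iter k bA).
    by rewrite -scalerBr nrmZ.
- move=> x; apply: seqlim_unique (sB _) _.
  apply: seqlim0; apply: (@seqlim_half0 _ _ _ (nrm x) 0%N) => n _.
  have -> : s (x - A x) n = s x n - A (s x n).
    rewrite sA /s -sumrB; apply: eq_bigr => k _; exact: blinB (blin_iter k bA).
  by rewrite tele addrC addKr nrmN.
- move=> x; apply: seqlim_unique (_ : seqlim (fun n => s x n - A (s x n)) _) _.
    apply: seqlimD (sB x) _.
    have H := @seqlim_map _ _ _ (fun v : X => - A v) M _ _ _ (sB x).
    by apply: H => u v; rewrite -opprD nrmN.
  apply: seqlim0; apply: (@seqlim_half0 _ _ _ (nrm x) 0%N) => n _.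
  by rewrite tele addrC addKr nrmN.
Qed.

End BoundedOperators.

(** * The resolvent *)

Section Resolvent.
Variables (R : realType) (X : completeNormedModType R[i]).
Notation C := R[i].
Variable T : X -> X.
Hypothesis bT : blin T.

Definition inverse_at (z : C) (S : X -> X) :=
  [/\ blin S, forall x, S (z *: x - T x) = x & forall x, z *: S x - T (S x) = x].

Definition in_resolvent (z : C) := exists S, inverse_at z S.

(** The value 0 on the spectrum makes the resolvent total; it is only integrated
    against functions vanishing near the spectrum. *)
Definition resolvent (z : C) : X -> X :=
  if pselect (in_resolvent z) is left e then projT1 (cid e) else fun=> 0.

Lemma resolventP z : in_resolvent z -> inverse_at z (resolvent z).
Proof. by move=> rz; rewrite /resolvent; case: pselect => // e; case: (cid e). Qed.

Lemma resolvent_blin z : blin (resolvent z).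
Proof.
rewrite /resolvent; case: pselect => [e|_]; last exact: blin_cst0.
by case: (cid e) => S [].
Qed.

Lemma inverse_unique z S : inverse_at z S -> resolvent z =1 S.
Proof.
move=> iS x; have [_ h _] := resolventP (ex_intro _ S iS).
by case: iS => _ _ h2; rewrite -{1}[x]h2 h.
Qed.

Lemma resolvent_comm z x : resolvent z (T x) = T (resolvent z x).
Proof.
have [rz|nz] := pselect (in_resolvent z); last first.
  by rewrite /resolvent; case: pselect => // _; rewrite (blin0 bT).
have [bS h1 h2] := resolventP rz; have [_ SZ _] := bS.
apply/oppr_inj/(addrI (z *: resolvent z x)).
by rewrite h2 -SZ -(blinB _ _ bS) h1.
Qed.

(** z - T = (z0 - T)(1 + (z - z0) S), and the second factor is inverted by a
    Neumann series. *)
Lemma res_pert z0 S M : inverse_at z0 S -> 0 < M -> (forall x, nrm (S x) <= M * nrm x) ->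
  forall z, 2 * M * nrm (z - z0) < 1 ->
  in_resolvent z /\ forall x, nrm (resolvent z x) <= 2 * M * nrm x.
Proof.
move=> [bS h1 h2] M0 SM z hz; have [SD SZ _] := bS.
have bA : blin (fun x => - (z - z0) *: S x) by apply: blinZ.
have A2 x : nrm (- (z - z0) *: S x) <= nrm x / 2.
  rewrite nrmZ nrmN; have := SM x; have := nrm_ge0 (z - z0); have := nrm_ge0 x.
  move: hz; move: (nrm _) (nrm _) (nrm _) => a b c; nra.
have [B [bB B1 B2 BM]] := neumann bA A2.
have iz : inverse_at z (fun x => B (S x)).
  split; first exact: blin_comp.
  - move=> x; rewrite -[RHS]B1; congr B.
    have -> : z *: x - T x = (z0 *: x - T x) + (z - z0) *: x.
      by rewrite scalerBl [RHS]addrC addrA subrK.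
    by rewrite SD h1 SZ scaleNr opprK.
  - move=> x; set u := B (S x).
    have E : z0 *: (u - (- (z - z0) *: S u)) - T (u - (- (z - z0) *: S u)) = x.
      by rewrite /u B2 h2.
    rewrite -[RHS]E scaleNr opprK scalerDr (_ : T (_ + _) = T u + (z - z0) *: T (S u)); last first.
      by case: bT => TD TZ _; rewrite TD TZ.
    rewrite scalerA mulrC -scalerA opprD addrACA -scalerBr h2.
    by rewrite scalerBl [RHS]addrC addrA subrK.
split; first by exists (fun x => B (S x)).
move=> x; rewrite (inverse_unique iz); apply: le_trans (BM _) _.
by rewrite -mulrA ler_wpM2l.
Qed.

Lemma res_near z0 : in_resolvent z0 -> exists2 M, 0 < M & forall z, M * nrm (z - z0) < 1 ->
  in_resolvent z /\ forall x, nrm (resolvent z x) <= M * nrm x.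
Proof.
move=> [S iS]; have [[_ _ [M M0 SM]] _ _] := iS.
by exists (2 * M); [rewrite mulr_gt0 | exact: res_pert iS M0 SM].
Qed.

Lemma res_identity z w x : in_resolvent z -> in_resolvent w ->
  resolvent z x - resolvent w x = - (z - w) *: resolvent z (resolvent w x).
Proof.
move=> /resolventP[bz z1 z2] /resolventP[bw w1 w2]; have [_ SZ _] := bz.
rewrite -{1}[x]w2 -SZ -[X in _ - X]z1 -(blinB _ _ bz); congr (resolvent z _).
by rewrite opprB addrA subrK scaleNr scalerBl opprB.
Qed.

(** Applying the resolvent identity twice expands R(w) - R(z) into
    -(w - z) R(z)^2 plus a term of order (w - z)^2; in [dstep] the linear terms of
    the two directions cancel, which is the Cauchy-Riemann equation. *)
Lemma smooth_resolvent x z0 : in_resolvent z0 -> smooth_at (fun z => resolvent z x) (fun=> 0) z0.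
Proof.
move=> rz0; have [M M0 hM] := res_near rz0.
have MM : 0 <= M ^+ 2 * nrm x by rewrite mulr_ge0 ?nrm_ge0 ?sqr_ge0.
have M2 z w y : M * nrm (z - z0) < 1 -> M * nrm (w - z0) < 1 ->
    nrm (resolvent z (resolvent w y)) <= M ^+ 2 * nrm y.
  move=> /hM[_ h1] /hM[_ h2]; apply: le_trans (h1 _) _.
  by rewrite expr2 -mulrA ler_wpM2l ?(ltW M0).
split; [ | exact: lip_cst | ].
- exists (M + M ^+ 2 * nrm x); first by rewrite ltr_pwDl.
  have E : M <= M + M ^+ 2 * nrm x by rewrite lerDl.
  move=> z w hz hw.
  have {}hz := lt1_mono E (nrm_ge0 _) hz; have {}hw := lt1_mono E (nrm_ge0 _) hw.
  rewrite res_identity; [|by case: (hM z hz)|by case: (hM w hw)].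
  rewrite nrmZ nrmN mulrC ler_wpM2r ?nrm_ge0 //.
  by apply: le_trans (M2 _ _ _ hz hw) _; rewrite lerDr ltW.
have M3 : 0 <= M ^+ 3 * nrm x by rewrite mulr_ge0 ?nrm_ge0 // exprn_ge0 // ltW.
exists (2 * M + 2 * (M ^+ 3 * nrm x)); first by apply: ltr_pwDl; [exact: mulr_gt0 | exact: mulr_ge0].
move=> z h hz h0 hh.
have E : 2 * M <= 2 * M + 2 * (M ^+ 3 * nrm x) by lra.
have hz2 := lt1_mono E (nrm_ge0 _) hz; have hh2 := lt1_mono E (ltW h0) hh.
have hz1 : M * nrm (z - z0) < 1 by apply: lt1_mono _ (nrm_ge0 _) hz2; lra.
have n1 := step_near M0 hz2 hh2 (nrm_h h0).
have n2 := step_near M0 hz2 hh2 (nrm_ih h0).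
have [rz bz] := hM _ hz1.
(* Second order expansion of the resolvent at z. *)
have second w : M * nrm (w - z0) < 1 ->
  resolvent w x - resolvent z x = - (w - z) *: resolvent z (resolvent z x) + (w - z) ^+ 2 *: resolvent w (resolvent z (resolvent z x)).
  move=> /hM[rw _]; rewrite (res_identity _ rw rz).
  have [_ Z _] := resolvent_blin w.
  rewrite -[resolvent w (resolvent z x)](subrK (resolvent z (resolvent z x))) (res_identity _ rw rz).
  by rewrite scalerDr scalerA mulrNN -expr2 addrC.
rewrite /dstep (second _ n1) (second _ n2) scaler0 subr0.
rewrite ![z + _]addrC !addrK scalerDr !scalerA.
rewrite (_ : 'i * - ('i * h%:C) = h%:C :> C); last first.
  by rewrite mulrN mulrA -expr2 sqr_i mulN1r opprK.
rewrite scaleNr addrACA addNr add0r.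
have b3 w : M * nrm (w - z0) < 1 -> nrm (resolvent w (resolvent z (resolvent z x))) <= M ^+ 3 * nrm x.
  move=> hw; apply: le_trans (M2 _ _ _ hw hz1) _.
  by rewrite [M ^+ 3]exprSr -mulrA ler_wpM2l ?sqr_ge0 //; case: (hM z hz1).
apply: le_trans (nrmD _ _) _; rewrite !nrmZ (nrmM 'i) nrmi mul1r !nrmX nrm_ih // nrm_h //.
rewrite mulrDl; apply: le_trans (_ : _ <= 2 * (M ^+ 3 * nrm x) * h ^+ 2) _; last first.
  by rewrite lerDr mulr_ge0 ?sqr_ge0 // mulr_ge0 // ltW.
have := b3 _ n1; have := b3 _ n2; rewrite ![_ + z]addrC.
have : 0 <= h ^+ 2 by rewrite sqr_ge0.
move: (nrm _) (nrm (resolvent (z + _) _)) (M ^+ 3 * nrm x) (h ^+ 2) => a b c d; nra.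
Qed.

End Resolvent.

(** * Cutoff functions *)

Section Cutoff.
Variable R : realType.
Notation C := R[i].

Definition near_pt (z : C) (P : C -> Prop) :=
  exists2 M : R, 0 < M & forall w, M * nrm (w - z) < 1 -> P w.

Definition closed_pts (S : C -> Prop) := forall z, ~ S z -> near_pt z (fun w => ~ S w).

Lemma near_pt_self z (P : C -> Prop) : near_pt z P -> P z.
Proof. by move=> [M _]; apply; rewrite subrr nrm0 mulr0. Qed.

Lemma near_pt_imp z (P Q : C -> Prop) : (forall w, P w -> Q w) -> near_pt z P -> near_pt z Q.
Proof. by move=> PQ [M M0 hM]; exists M => // w /hM/PQ. Qed.

Lemma near_pt_and z (P Q : C -> Prop) : near_pt z P -> near_pt z Q -> near_pt z (fun w => P w /\ Q w).
Proof.
move=> [M M0 hM] [N N0 hN]; exists (M + N); first exact: addr_gt0.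
move=> w hw; split; [apply: hM | apply: hN]; apply: lt1_mono _ (nrm_ge0 _) hw; lra.
Qed.

Lemma closed_ptsU (S S' : C -> Prop) : closed_pts S -> closed_pts S' -> closed_pts (fun z => S z \/ S' z).
Proof.
move=> cS cS' z /not_orP[nS nS'].
by apply: near_pt_imp (near_pt_and (cS _ nS) (cS' _ nS')) => w [h1 h2] [].
Qed.

Definition bumps r (l : seq C) : smoothfun R :=
  foldr (fun c acc => sf_mul (sf_sub (sf_cst 1) (sf_bump c r)) acc) (sf_cst 1) l.

Lemma bumps_hit r l z c : 0 < r -> c \in l -> nrm (z - c) <= r ->
  bumps r l z = 0 /\ sd (bumps r l) z = 0.
Proof.
move=> r0; elim: l => // a l IH; rewrite inE => /orP[/eqP <- h|cl h].
  have [b1 b2] := bump1 r0 h.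
  by rewrite svM sdM svB sdB b1 b2 !subrr !mul0r addr0.
have [b1 b2] := IH cl h.
by rewrite svM sdM -/(bumps r l) b1 b2 !mulr0 addr0.
Qed.

Lemma bumps_miss r l z : 0 < r -> (forall c, c \in l -> 2 * r <= nrm (z - c)) ->
  bumps r l z = 1 /\ sd (bumps r l) z = 0.
Proof.
move=> r0; elim: l => // a l IH h.
have [] := IH _; first by move=> c cl; apply: h; rewrite inE cl orbT.
have [b1 b2] := bump0 r0 (h a (mem_head _ _)).
rewrite svM sdM -/(bumps r l) svB sdB b1 b2 => -> ->.
by rewrite !subr0 mulr0 mul0r addr0 mulr1.
Qed.

Lemma grid_pt_cover k (z : C) : nrm z <= 1 -> exists i j,
  [/\ (i < grid_size k)%N, (j < grid_size k)%N & nrm (z - grid_pt 0 k i j) <= 2 / 2 ^+ k].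
Proof.
move=> z1; have p0 := pow2_gt0 R k.
have coord (x : R) : `|x| <= 1 -> exists i, (i < grid_size k)%N /\ `|x - (i%:R / 2 ^+ k - 4)| <= (2 ^+ k)^-1.
  rewrite ler_norml => /andP[h1 h2].
  have q0 : 0 <= (x + 4) * 2 ^+ k by rewrite mulr_ge0 ?(ltW p0) //; lra.
  have /andP[t1 t2] := truncn_itv q0.
  exists (Num.truncn ((x + 4) * 2 ^+ k)); split.
    by rewrite -(ltr_nat R) grid_sizeR; apply: le_lt_trans t1 _; rewrite ltr_pM2r //; lra.
  move: t1 t2; rewrite -[X in _ < X -> _]natr1; move: (Num.truncn _)%:R => t.
  rewrite -ler_pdivrMr // => t1 t2.
  have t3 : x + 4 < t / 2 ^+ k + (2 ^+ k)^-1.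
    have -> : t / 2 ^+ k + (2 ^+ k)^-1 = (t + 1) / 2 ^+ k by ring.
    by rewrite ltr_pdivlMr.
  by rewrite ler_norml; apply/andP; split; lra.
have [i [hi ei]] := coord _ (le_trans (Re_le z) z1).
have [j [hj ej]] := coord _ (le_trans (Im_le z) z1).
exists i, j; split => //; apply: le_trans (nrm_le _) _.
move: ei ej; rewrite /grid_pt add0r; case: z {z1} => a b /=.
move: (_^-1) (i%:R * _) (j%:R * _) => u v w; lra.
Qed.

(** By compactness, [K] keeps a distance 4r from [F].  Then 1 minus the product
    of (1 - bump of radius r), over the centres of a fine grid lying close to [K],
    is 1 near [K] and 0 near [F]. *)
Lemma cutoff (K F : C -> Prop) : (forall z, K z -> nrm z <= 1) ->
  closed_pts K -> closed_pts F -> (forall z, K z -> ~ F z) ->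
  exists chi : smoothfun R,
    (forall z, K z -> near_pt z (fun w => chi w = 1 /\ sd chi w = 0)) /\
    (forall z, F z -> near_pt z (fun w => chi w = 0 /\ sd chi w = 0)).
Proof.
move=> K1 cK cF KF.
have [M M0 hM] : exists2 M, 0 < M & forall z, nrm z <= 1 ->
    K z -> forall w, M * nrm (w - z) < 1 -> ~ F w.
  apply: (@box_cover R 1 (fun M z => K z -> forall w, M * nrm (w - z) < 1 -> ~ F w)).
    by move=> M M' z MM' h Kz w hw; apply: h => //; exact: lt1_mono MM' (nrm_ge0 _) hw.
  move=> z0; have [Kz0|nKz0] := pselect (K z0).
    have [M M0 hM] := cF _ (KF _ Kz0); exists (2 * M); first by rewrite mulr_gt0.
    move=> z hz _ w hw; apply: hM.
    have := nrm_tri z w z0; move: hz hw; move: (nrm _) (nrm _) (nrm _) => a b c; nra.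
  by have [M M0 hM] := cK _ nKz0; exists M => // z /hM.
(* M bounds the inverse of the distance from K to F, so 4 r is below it. *)
pose r : R := (4 * M)^-1; have r0 : 0 < r by rewrite invr_gt0 mulr_gt0.
have rM : M * (4 * r) = 1 by rewrite /r; field; rewrite gt_eqF.
have [k hk] : exists k, 2 / 2 ^+ k <= r / 2.
  have r2 : 0 < r / 2 by lra.
  have [N hN] := half_lt 2 r2.
  by exists N; apply/ltW/hN.
pose l := [seq c <- [seq grid_pt 0 k i j | i <- iota 0 (grid_size k), j <- iota 0 (grid_size k)]
           | `[< exists2 z, K z & nrm (z - c) <= r / 2 >]].
exists (sf_sub (sf_cst 1) (bumps r l)); split => [z Kz|z Fz]; exists (2 / r);
    rewrite ?divr_gt0 // => w; rewrite mulrAC ltr_pdivrMr // => hw.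
  have [i [j [hi hj hz]]] := grid_pt_cover k (K1 _ Kz).
  have cl : grid_pt 0 k i j \in l.
    rewrite mem_filter; apply/andP; split.
      by apply/asboolP; exists z => //; apply: le_trans hk.
    by apply: allpairs_f; rewrite mem_iota.
  have [] := bumps_hit (z := w) r0 cl.
    by apply: le_trans (nrm_tri z _ _) _; lra.
  by rewrite svB sdB => -> ->; rewrite !subr0.
have [] := bumps_miss (z := w) (l := l) r0.
  move=> c; rewrite mem_filter => /andP[/asboolP[y Ky hy] _].
  have h1 : 4 * r <= nrm (z - y).
    rewrite leNgt; apply/negP => h2; apply: (hM y (K1 _ Ky) Ky z) => //.
    by rewrite -rM ltr_pM2l.
  have h2 := nrm_tri w z y; have h3 := nrm_tri c w y.
  by rewrite (nrmBC z w) in h2; rewrite (nrmBC c y) in h3; lra.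
by rewrite svB sdB => -> ->; rewrite subrr subr0.
Qed.

End Cutoff.

(** * Integrals of the resolvent *)

Section Calculus.
Variables (R : realType) (X : completeNormedModType R[i]).
Notation C := R[i].
Variable T : X -> X.
Hypothesis bT : blin T.
Variable o : C.
Implicit Types g u : C -> C^o.

(** The functions against which the resolvent can be integrated. *)
Definition spectral_weight (g : C -> C^o) :=
  (forall z, lip_at g z) /\ forall z, ~ in_resolvent T z -> near_pt z (fun w => g w = 0).

(** For [g] = [sd chi] with [chi] equal to 1 near one clopen part of the spectrum
    and to 0 near the other, this is the Cauchy-Pompeiu form of the Riesz
    projection of the first part, up to the factor -2 pi; multiplying [g] by a
    function u holomorphic near the support of [chi] composes it with u(T). *)
Definition resolvent_int (g : C -> C^o) (x : X) : X := plane_int o (fun z => g z *: resolvent T z x).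
Definition scalar_int (g : C -> C^o) (x : X) : X := plane_int o (fun z => g z *: x).

Notation J := resolvent_int.
Notation E := scalar_int.

Lemma lip_near_pt (V : normedModType C) (f f' : C -> V) z :
  near_pt z (fun w => f w = f' w) -> lip_at f z -> lip_at f' z.
Proof. by move=> [M M0 hM]; apply: lip_eq M0 hM. Qed.

Lemma smooth_near_pt (V : normedModType C) (f g f' g' : C -> V) z :
  near_pt z (fun w => f w = f' w /\ g w = g' w) -> smooth_at f g z -> smooth_at f' g' z.
Proof. by move=> [M M0 hM]; apply: smooth_eq M0 hM. Qed.

Lemma lipJ g x : spectral_weight g -> forall z, @lip_at R X (fun z => g z *: resolvent T z x) z.
Proof.
move=> [lg g0] z; have [rz|nz] := pselect (in_resolvent T z).
  by apply: lipZ; [exact: lg | case: (smooth_resolvent bT x rz)].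
apply: lip_near_pt (lip_cst 0 z); apply: near_pt_imp (g0 z nz) => w ->.
by rewrite scale0r.
Qed.

Lemma lipE g x : (forall z, lip_at g z) -> forall z, @lip_at R X (fun z => g z *: x) z.
Proof. by move=> lg z; apply: lipZ (lg z) (lip_cst x z). Qed.

Lemma spectral_weightM g u : spectral_weight g -> (forall z, lip_at u z) -> spectral_weight (fun z => g z * u z).
Proof.
move=> [lg g0] lu; split; first by move=> z; apply: lipZ (lg z) (lu z).
by move=> z nz; apply: near_pt_imp (g0 z nz) => w ->; rewrite mul0r.
Qed.

Lemma spectral_weightD g g' : spectral_weight g -> spectral_weight g' -> spectral_weight (fun z => g z + g' z).
Proof.
move=> [lg g0] [lg' g0']; split; first by move=> z; apply: lipD.
move=> z nz; apply: near_pt_imp (near_pt_and (g0 z nz) (g0' z nz)) => w [-> ->].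
by rewrite addr0.
Qed.

Lemma spectral_weightN g : spectral_weight g -> spectral_weight (fun z => - g z).
Proof.
move=> [lg g0]; split; first by move=> z; apply: lipN.
by move=> z nz; apply: near_pt_imp (g0 z nz) => w ->; rewrite oppr0.
Qed.

Lemma JD g g' x : spectral_weight g -> spectral_weight g' -> J (fun z => g z + g' z) x = J g x + J g' x.
Proof.
move=> ag ag'; rewrite /resolvent_int -plane_intD; [|exact: lipJ|exact: lipJ].
by congr plane_int; apply/funext => z; rewrite scalerDl.
Qed.

Lemma JN g x : spectral_weight g -> J (fun z => - g z) x = - J g x.
Proof.
move=> ag; rewrite /resolvent_int -scaleN1r -(@plane_int_map _ o _ (fun v : X => -1 *: v) 1).
- by congr plane_int; apply/funext => z; rewrite scaleNr scaleN1r.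
- by move=> u v; rewrite scalerDr.
- by move=> a v; rewrite !scalerA mulrC.
- by move=> v; rewrite nrmZ nrmN nrm1.
- exact: lipJ.
Qed.

Lemma JB g g' x : spectral_weight g -> spectral_weight g' -> J (fun z => g z - g' z) x = J g x - J g' x.
Proof. by move=> ag ag'; rewrite JD ?JN //; exact: spectral_weightN. Qed.

(** The spectral weight [g] is fixed and the bound depends on [u] only through
    its size on the support of [g]: this turns information on supports into
    estimates of powers of [T]. *)
Lemma J_bound g : spectral_weight g -> exists2 M, 0 < M & forall (u : C -> C^o) b x, (forall z, lip_at u z) ->
  (forall z, g z != 0 -> nrm (u z) <= b) -> 0 <= b ->
  nrm (J (fun z => g z * u z) x) <= M * b * nrm x.
Proof.
move=> ag; have [lg g0] := ag.
have [M M0 hM] : exists2 M, 0 < M & forall z, nrm z <= nrm o + 8 ->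
    forall x, nrm (g z *: resolvent T z x) <= M * nrm x.
  apply: (@box_cover R _ (fun M z => forall x, nrm (g z *: resolvent T z x) <= M * nrm x)).
    by move=> M M' z MM' h x; apply: le_trans (h x) _; rewrite ler_wpM2r ?nrm_ge0.
  move=> z0; have [rz|nz] := pselect (in_resolvent T z0); last first.
    have [M M0 hM] := g0 z0 nz; exists M => // z /hM -> x.
    by rewrite scale0r nrm0 mulr_ge0 ?nrm_ge0 ?(ltW M0).
  have [M [M0 _ hM]] := lip_bnd (lg z0); have [N N0 hN] := res_near bT rz.
  have MN : 0 < M * N by apply: mulr_gt0.
  exists (M * N + M + N); first by lra.
  move=> z hz x; rewrite nrmZ.
  apply: (@le_trans _ _ (M * (N * nrm x))).
    apply: ler_pM; rewrite ?nrm_ge0 //.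
      by apply: hM; apply: lt1_mono _ (nrm_ge0 _) hz; lra.
    by apply: (hN z _).2; apply: lt1_mono _ (nrm_ge0 _) hz; lra.
  by rewrite mulrA ler_wpM2r ?nrm_ge0 //; lra.
exists (64 * M); first by rewrite mulr_gt0.
move=> u b x lu ub b0; rewrite -!mulrA; apply: plane_int_bound; first exact/lipJ/spectral_weightM.
move=> z zA; rewrite mulrC -scalerA nrmZ.
have [->|gz] := eqVneq (g z) 0.
  by rewrite scale0r nrm0 mulr0 !mulr_ge0 ?nrm_ge0 ?(ltW M0).
by rewrite mulrCA ler_pM ?nrm_ge0 ?ub ?hM.
Qed.

Lemma E_bound g x b : (forall z, lip_at g z) -> (forall z, nrm (g z) <= b) ->
  nrm (E g x) <= 64 * (b * nrm x).
Proof.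
move=> lg gb; apply: plane_int_bound; first exact: lipE.
by move=> z _; rewrite nrmZ ler_wpM2r ?nrm_ge0.
Qed.

Lemma J_blin g : spectral_weight g -> blin (J g).
Proof.
move=> ag; split.
- move=> x y; rewrite /resolvent_int -plane_intD; [|exact: lipJ|exact: lipJ].
  congr plane_int; apply/funext => z; have [-> _ _] := resolvent_blin T z.
  by rewrite scalerDr.
- move=> a x; rewrite /resolvent_int -(@plane_int_map _ o _ (fun v : X => a *: v) (nrm a)).
  + congr plane_int; apply/funext => z; have [_ -> _] := resolvent_blin T z.
    by rewrite !scalerA mulrC.
  + by move=> u v; rewrite scalerDr.
  + by move=> c v; rewrite !scalerA mulrC.
  + by move=> v; rewrite nrmZ.
  + exact: lipJ.
have [M M0 hM] := J_bound ag; exists M => // x.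
have := hM (fun=> 1) 1 x _ _ ler01; rewrite mulr1.
have -> : (fun z => g z * 1) = g by apply/funext => z; rewrite mulr1.
by apply => [z|z _]; [exact: lip_cst | rewrite nrm1].
Qed.

Lemma J_comm (A : X -> X) g x : blin A -> (forall y, A (T y) = T (A y)) -> spectral_weight g ->
  J g (A x) = A (J g x).
Proof.
move=> bA AT ag; have [AD AZ [M _ AM]] := bA.
rewrite /resolvent_int -(@plane_int_map _ o _ A M) //; last exact: lipJ.
congr plane_int; apply/funext => z; rewrite AZ.
have [rz|nz] := pselect (in_resolvent T z); last by rewrite (near_pt_self (ag.2 z nz)) !scale0r.
have [bR R1 R2] := resolventP rz; congr (_ *: _).
by rewrite -{1}[x]R2 (blinB _ _ bA) AZ AT R1.
Qed.

(** z R(z) = 1 + T R(z). *)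
Lemma J_mulz g x : spectral_weight g -> J (fun z => g z * z) x = T (J g x) + E g x.
Proof.
move=> ag; have [TD TZ [M _ TM]] := bT.
rewrite /resolvent_int -(@plane_int_map _ o _ T M) //; last exact: lipJ.
rewrite /scalar_int -plane_intD.
- congr plane_int; apply/funext => z; rewrite TZ -scalerDr -scalerA.
  have [rz|nz] := pselect (in_resolvent T z); last by rewrite (near_pt_self (ag.2 z nz)) !scale0r.
  have [_ _ R2] := resolventP rz; congr (_ *: _).
  by rewrite -[X in _ + X]R2 addrC subrK.
- move=> z; have := lipJ (T x) ag z; apply: lip_near_pt.
  by exists 1 => // w _; rewrite resolvent_comm // TZ.
- exact: lipE ag.1.
Qed.

Lemma J_stokes (f g : C -> C^o) x : (forall z, smooth_at f g z) ->
  (forall z, ~ in_resolvent T z -> near_pt z (fun w => f w = 0 /\ g w = 0)) ->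
  (forall z, 3 <= nrm (z - o) -> f z = 0) -> J g x = 0.
Proof.
move=> sf f0 fA; apply: (@plane_int_stokes _ o _ (fun z => f z *: resolvent T z x)).
  move=> z; have [rz|nz] := pselect (in_resolvent T z).
    apply: smooth_near_pt (smoothZ (sf z) (smooth_resolvent bT x rz)).
    by exists 1 => // w _; rewrite scaler0 addr0.
  apply: smooth_near_pt (smooth_cst 0 z); apply: near_pt_imp (f0 z nz) => w [-> ->].
  by rewrite !scale0r.
by move=> z /fA ->; rewrite scale0r.
Qed.

Lemma E_stokes (f g : C -> C^o) x : (forall z, smooth_at f g z) ->
  (forall z, 3 <= nrm (z - o) -> f z = 0) -> E g x = 0.
Proof.
move=> sf fA; apply: (@plane_int_stokes _ o _ (fun z => f z *: x)).
  move=> z; apply: smooth_near_pt (smoothZ (sf z) (smooth_cst x z)).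
  by exists 1 => // w _; rewrite scaler0 addr0.
by move=> z /fA ->; rewrite scale0r.
Qed.

Lemma ED g g' x : (forall z, lip_at g z) -> (forall z, lip_at g' z) ->
  E (fun z => g z + g' z) x = E g x + E g' x.
Proof.
move=> ag ag'; rewrite /scalar_int -plane_intD; [|exact: lipE|exact: lipE].
by congr plane_int; apply/funext => z; rewrite scalerDl.
Qed.

End Calculus.

(** * The Cauchy kernel against a bump *)

Section InverseKernel.
Variable R : realType.
Notation C := R[i].

Lemma smooth_inv (c z0 : C) : z0 != c -> smooth_at (fun z => (z - c)^-1 : C^o) (fun=> 0) z0.
Proof.
move=> zc; have d0 : 0 < nrm (z0 - c) by rewrite nrm_gt0 // subr_eq0.
set d := nrm (z0 - c) in d0; pose M := 2 / d.
have M0 : 0 < M by rewrite divr_gt0.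
have dM : d * M = 2 by rewrite /M; field; rewrite gt_eqF.
have far z : M * nrm (z - z0) < 1 -> z - c != 0 /\ nrm (z - c)^-1 <= M.
  move=> hz; have h1 : d <= nrm (z - z0) + nrm (z - c).
    by have := nrm_tri z z0 c; rewrite (nrmBC z0 z).
  have h2 : 1 < M * nrm (z - c) by nra.
  have n0 : 0 < nrm (z - c) by have := nrm_ge0 (z - c); nra.
  split; last by rewrite nrmV -[_^-1]mul1r ler_pdivrMr // ltW.
  by apply/eqP => e; rewrite e nrm0 ltxx in n0.
have M2 : 0 < M ^+ 2 by rewrite exprn_gt0.
split; [ | exact: lip_cst | ].
- exists (M + M ^+ 2); first by lra.
  move=> z w hz hw.
  have [z1 z2] : z - c != 0 /\ nrm (z - c)^-1 <= M.
    by apply: far; apply: lt1_mono _ (nrm_ge0 _) hz; lra.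
  have [w1 w2] : w - c != 0 /\ nrm (w - c)^-1 <= M.
    by apply: far; apply: lt1_mono _ (nrm_ge0 _) hw; lra.
  have -> : (z - c)^-1 - (w - c)^-1 = - (z - w) * ((z - c)^-1 * (w - c)^-1).
    by field; rewrite z1 w1.
  rewrite nrmM nrmN mulrC ler_wpM2r ?nrm_ge0 // nrmM.
  apply: (@le_trans _ _ (M * M)); first by apply: ler_pM; rewrite ?nrm_ge0.
  by rewrite -expr2; lra.
have M3 : 0 < M ^+ 3 by rewrite exprn_gt0.
exists (2 * M + 2 * M ^+ 3); first by lra.
move=> z h hz h0 hh.
have E : 2 * M <= 2 * M + 2 * M ^+ 3 by lra.
have hz2 := lt1_mono E (nrm_ge0 _) hz; have hh2 := lt1_mono E (ltW h0) hh.
have hz1 : M * nrm (z - z0) < 1 by apply: lt1_mono _ (nrm_ge0 _) hz2; lra.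
have [p1 p2] := far _ (step_near M0 hz2 hh2 (nrm_h h0)).
have [q1 q2] := far _ (step_near M0 hz2 hh2 (nrm_ih h0)).
have [r1 r2] := far _ hz1.
have -> : dstep (fun z => (z - c)^-1 : C^o) z h - h%:C *: (0 : C^o) =
  h%:C ^+ 2 * ((z - c)^-1 * (z - c)^-1 * (z + h%:C - c)^-1)
  - 'i * h%:C ^+ 2 * ((z - c)^-1 * (z - c)^-1 * (z + 'i * h%:C - c)^-1) :> C^o.
  rewrite scaler0 subr0 /dstep /GRing.scale /=.
  have i2 : 'i * 'i = -1 :> C by rewrite -expr2 sqr_i.
  move: ('i : C) i2 p1 q1 => I i2 p1 q1.
  by field: i2; rewrite p1 q1 r1.
have b w : nrm (w - c)^-1 <= M -> nrm ((z - c)^-1 * (z - c)^-1 * (w - c)^-1) <= M ^+ 3.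
  move=> hw; rewrite !nrmM exprSr expr2.
  by apply: ler_pM; rewrite ?mulr_ge0 ?nrm_ge0 //; apply: ler_pM; rewrite ?nrm_ge0.
apply: le_trans (nrmB _ _) _.
have n1 a : nrm (h%:C ^+ 2 * a : C) = h ^+ 2 * nrm a by rewrite nrmM nrmX nrm_h.
have n2 a : nrm ('i * h%:C ^+ 2 * a : C) = h ^+ 2 * nrm a by rewrite -mulrA nrmM nrmi mul1r n1.
rewrite n1 n2; have := b _ p2; have := b _ q2.
have : 0 <= h ^+ 2 by rewrite sqr_ge0.
move: (nrm _) (nrm _) => a a' ha; nra.
Qed.

Lemma seqlim_lower (V : normedZmodType C) (s : nat -> V) l B N :
  seqlim s l -> (forall n, (N <= n)%N -> B <= nrm (s n)) -> B <= nrm l.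
Proof.
move=> sl sB; apply/ler_addgt0Pr => e /sl[M hM].
have h1 := hM _ (leq_maxr N M); have h2 := sB _ (leq_maxl N M).
apply: le_trans h2 _; rewrite -[s _](subrK l).
by apply: le_trans (nrmD _ _) _; rewrite addrC lerD2l ltW.
Qed.

(** Minus the quotient of the derivative of a unit bump by z - c. *)
Definition bump_kernel (c z : C) : R :=
  8 * pos (1 - pos (2 - sqd c z) ^+ 2) * pos (2 - sqd c z).

Lemma pos_ge0 (x : R) : 0 <= pos x. Proof. by rewrite /pos le_max lexx. Qed.

Lemma bump_kernelE c z : sd (sf_bump c 1) z * (z - c)^-1 = - (bump_kernel c z)%:C.
Proof.
rewrite /= expr1n !divr1 -/(bump_kernel c z) rmorphN /=.
have [->|zc] := eqVneq z c; last by rewrite mulfK // subr_eq0.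
have -> : bump_kernel c c = 0; last by rewrite !oppr0 !mul0r.
have p2 : pos (2 - sqd c c) = 2 :> R.
  by rewrite sqdE subrr nrm0 expr0n subr0 /pos max_r.
have p3 : pos (1 - 2 ^+ 2) = 0 :> R by rewrite /pos max_l //; lra.
by rewrite /bump_kernel p2 p3 mulr0 mul0r.
Qed.

Lemma bump_kernel_ge0 c z : 0 <= bump_kernel c z.
Proof. by rewrite /bump_kernel !mulr_ge0 ?pos_ge0. Qed.

(** On this cell t = |z - c|^2 lies in [5/4, 53/32], inside the annulus where the
    bump decreases. *)
Lemma bump_kernel_ge1 c (a b : R) : 1 <= a <= 9 / 8 -> 1 / 2 <= b <= 5 / 8 ->
  1 <= bump_kernel c (c + (a +i* b)).
Proof.
move=> /andP[a1 a2] /andP[b1 b2].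
rewrite /bump_kernel /sqd (_ : c + (a +i* b) - c = a +i* b) /=; last by rewrite addrC addKr.
have : 5 / 4 <= a ^+ 2 + b ^+ 2 by nra.
have : a ^+ 2 + b ^+ 2 <= 53 / 32 by nra.
move: (a ^+ 2 + _) => t t1 t2.
have -> : pos (2 - t) = 2 - t by rewrite /pos max_r //; lra.
have h : (2 - t) ^+ 2 <= 9 / 16 by nra.
have -> : pos (1 - (2 - t) ^+ 2) = 1 - (2 - t) ^+ 2 by rewrite /pos max_r //; lra.
nra.
Qed.

Lemma subsum_le (F : nat -> R) a b n : (forall i, 0 <= F i) -> (a <= b)%N -> (b <= n)%N ->
  \sum_(a <= i < b) F i <= \sum_(0 <= i < n) F i.
Proof.
move=> F0 ab bn; rewrite (@big_cat_nat _ _ _ b 0 n) //= (@big_cat_nat _ _ _ a 0 b) //=.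
have h1 : 0 <= \sum_(0 <= i < a) F i by rewrite sumr_ge0.
have h2 : 0 <= \sum_(b <= i < n) F i by rewrite sumr_ge0.
lra.
Qed.

(** The cell of [bump_kernel_ge1] has side 1/8 and contains 4^k points of the
    grid of mesh 2^-(k+3). *)
Lemma bump_kernel_sum c k :
  4 ^+ k <= \sum_(0 <= i < grid_size (k + 3)) \sum_(0 <= j < grid_size (k + 3)) bump_kernel c (grid_pt c (k + 3) i j).
Proof.
pose q := (2 ^ k)%N.
have gq : grid_size (k + 3) = (64 * q)%N by rewrite /grid_size expnD -/q; lia.
have p0 := pow2_gt0 R k.
(* In mesh units 1/8 the cell is [40, 41] x [36, 37]: the offset 4 is 32/8. *)
have cell i j : (40 * q <= i < 41 * q)%N -> (36 * q <= j < 37 * q)%N ->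
    1 <= bump_kernel c (grid_pt c (k + 3) i j).
  have e (n a : nat) : ((a * q)%:R : R) / 2 ^+ (k + 3) = a%:R / 8.
    by rewrite natrM /q natrX exprD; field; rewrite gt_eqF.
  have le (n a : nat) : (a * q <= n)%N -> (a%:R : R) / 8 <= n%:R / 2 ^+ (k + 3).
    by move=> h; rewrite -(e n) ler_pM2r ?invr_gt0 ?exprn_gt0 // ler_nat.
  have ge (n a : nat) : (n < a * q)%N -> n%:R / 2 ^+ (k + 3) <= (a%:R : R) / 8.
    by move=> h; rewrite -(e n) ler_pM2r ?invr_gt0 ?exprn_gt0 // ler_nat ltnW.
  move=> /andP[/le i1 /ge i2] /andP[/le j1 /ge j2].
  by apply: bump_kernel_ge1; apply/andP; split; lra.
have step1 i : (40 * q <= i < 41 * q)%N ->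
    (q%:R : R) <= \sum_(0 <= j < grid_size (k + 3)) bump_kernel c (grid_pt c (k + 3) i j).
  move=> hi; apply: le_trans (@subsum_le _ (36 * q) (37 * q) _ _ _ _); last 3 first.
  - by move=> j; exact: bump_kernel_ge0.
  - by lia.
  - by rewrite gq; lia.
  have -> : (q%:R : R) = \sum_(36 * q <= j < 37 * q) 1.
    by rewrite sumr_const_nat; congr (_%:R); lia.
  by apply: ler_sum_nat => j hj; apply: cell.
apply: le_trans (@subsum_le _ (40 * q) (41 * q) _ _ _ _); last 3 first.
- by move=> i; apply: sumr_ge0 => j _; exact: bump_kernel_ge0.
- by lia.
- by rewrite gq; lia.
have -> : (4 ^+ k : R) = \sum_(40 * q <= i < 41 * q) q%:R.
  rewrite sumr_const_nat -natrX -mulrnA; congr (_%:R).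
  by rewrite (_ : 41 * q - 40 * q = q)%N; [rewrite /q -expnMn | lia].
by apply: ler_sum_nat => i hi; apply: step1.
Qed.

Variable X : completeNormedModType C.

(** The exact value is the Cauchy-Pompeiu constant, 2 pi in absolute value; a
    positive lower bound is enough to see that the Riesz projection does not
    vanish, and it follows from the constant sign of the kernel. *)
Lemma E_bump_lower c (x : X) :
  nrm x <= 64 * nrm (scalar_int c (fun z => sd (sf_bump c 1) z * (z - c)^-1) x).
Proof.
rewrite mulrC -ler_pdivrMr //.
have -> : (fun z => sd (sf_bump c 1) z * (z - c)^-1) = (fun z => - (bump_kernel c z)%:C).
  by apply/funext => z; rewrite bump_kernelE.
have lk z : @lip_at R C^o (fun z => - (bump_kernel c z)%:C) z.
  apply: lipN; rewrite /bump_kernel.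
  have h (u : C -> R) : lip_at (fun z => (u z)%:C : C^o) z -> lip_at (fun z => (pos (u z))%:C : C^o) z.
    by apply: lip_real => ? ?; exact: pos_lip.
  have hM (u v : C -> R) : lip_at (fun z => (u z)%:C : C^o) z -> lip_at (fun z => (v z)%:C : C^o) z ->
    lip_at (fun z => (u z * v z)%:C : C^o) z.
    move=> hu hv; have := lipZ hu hv; apply: lip_near_pt; exists 1 => // w _.
    by rewrite rmorphM.
  have hB (a : R) (u : C -> R) : lip_at (fun z => (u z)%:C : C^o) z ->
    lip_at (fun z => (a - u z)%:C : C^o) z.
    apply: lip_real => p q; rewrite (_ : a - u p - (a - u q) = u q - u p); first by rewrite distrC.
    by ring.
  have hq : lip_at (fun z => (sqd c z)%:C : C^o) z by case: (smooth_sqd c z).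
  apply: (hM); last by apply: (h); apply: hB.
  apply: (hM (fun=> 8)); first exact: lip_cst.
  apply: (h); apply: (hB); under [X in lip_at X]eq_fun do rewrite expr2.
  by apply: (hM); apply: (h); apply: hB.
rewrite /scalar_int; have L := @plane_int_lim _ c _ _ (lipE x lk).
apply: (seqlim_lower (N := 3) L) => n hn.
rewrite -(subnK hn); move: (n - 3)%N => k.
have -> : grid_sum c (fun z => - (bump_kernel c z)%:C *: x) (k + 3) =
  (- ((4 ^+ (k + 3))^-1 * \sum_(0 <= i < grid_size (k + 3)) \sum_(0 <= j < grid_size (k + 3))
      bump_kernel c (grid_pt c (k + 3) i j)))%:C *: x.
  rewrite /grid_sum.
  under eq_bigr do rewrite -scaler_suml sumrN -rmorph_sum.
  by rewrite -scaler_suml sumrN -rmorph_sum scalerA mulrN -rmorphM -rmorphN.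
rewrite nrmZ nrmR normrN ger0_norm.
  rewrite mulrC ler_wpM2r ?nrm_ge0 // mulrC ler_pdivlMr ?exprn_gt0 //.
  apply: le_trans (bump_kernel_sum c k); rewrite exprD.
  by rewrite (_ : 4 ^+ 3 = 64 :> R) ?[4 ^+ k * _]mulrC ?mulKf //; ring.
rewrite mulr_ge0 ?invr_ge0 ?exprn_ge0 //.
by apply: sumr_ge0 => i _; apply: sumr_ge0 => j _; exact: bump_kernel_ge0.
Qed.

End InverseKernel.

(** * Localization of the Riesz projection *)

Section Localization.
Variables (R : realType) (X : completeNormedModType R[i]).
Notation C := R[i].
Variable T : X -> X.
Hypothesis bT : blin T.
Variables K F : C -> Prop.
Hypothesis KF_spec : forall z, ~ in_resolvent T z <-> K z \/ F z.
Hypothesis K1 : forall z, K z -> nrm z <= 1.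
Hypothesis cK : closed_pts K.
Hypothesis cF : closed_pts F.
Hypothesis KF : forall z, K z -> ~ F z.

(** The point [o] of maximal real part is a boundary point of the spectrum: the
    points slightly to its right are in the resolvent set. *)
Lemma K_extreme : (exists z, K z) ->
  exists2 o, K o & forall z, K z -> complex.Re z <= complex.Re o.
Proof.
move=> [z1 Kz1].
pose S : set R := fun x => exists2 z, K z & complex.Re z = x.
have S1 : has_sup S.
  split; first by exists (complex.Re z1), z1.
  exists 1 => _ [z Kz <-]; apply: le_trans (ler_norm _) _.
  by apply: le_trans (Re_le z) (K1 Kz).
apply: contrapT => nmax.
have lts z : K z -> complex.Re z < sup S.
  move=> Kz; rewrite lt_neqAle; apply/andP; split; last first.
    by apply: sup_upper_bound => //; exists z.
  apply/eqP => e; apply: nmax; exists z => // w Kw; rewrite e.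
  by apply: sup_upper_bound => //; exists w.
have [M M0 hM] : exists2 M, 0 < M & forall z, nrm z <= 1 ->
    K z -> 1 <= M * (sup S - complex.Re z).
  apply: (@box_cover R 1 (fun M z => K z -> 1 <= M * (sup S - complex.Re z))).
    move=> M M' z MM' h Kz; apply: le_trans (h Kz) _.
    by rewrite ler_wpM2r // subr_ge0 ltW // lts.
  move=> z0; have [Kz0|nKz0] := pselect (K z0).
    have d0 := lts _ Kz0; exists (2 / (sup S - complex.Re z0)).
      by rewrite divr_gt0 // subr_gt0.
    move=> z hz _; move: hz.
    rewrite ![2 / _ * _]mulrAC ltr_pdivrMr ?subr_gt0 // ler_pdivlMr ?subr_gt0 // !mul1r => hz.
    have := ler_norm (complex.Re (z - z0)); have := Re_le (z - z0).
    by rewrite raddfB /=; move: d0 hz; move: (nrm _) `|_| => a b; lra.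
  by have [M M0 hM] := cK nKz0; exists M => // z /hM.
have : sup S <= sup S - M^-1.
  apply: ge_sup; first by case: S1.
  move=> _ [z Kz <-]; have := hM z (K1 Kz) Kz.
  by rewrite -ler_pdivrMl // mulr1; lra.
have : 0 < M^-1 by rewrite invr_gt0.
lra.
Qed.

(** If T - o were bounded below, the resolvents at points z close to [o] would be
    bounded by 2/e, and [o] would lie in a disc of the resolvent set around z. *)
Lemma approx_eig o : ~ in_resolvent T o -> (forall e, 0 < e -> exists2 z, nrm (z - o) < e & in_resolvent T z) ->
  forall e, 0 < e -> exists2 x, x != 0 & nrm (T x - o *: x) <= e * nrm x.
Proof.
move=> nr near e e0; apply: contrapT => H.
have low x : e * nrm x <= nrm (T x - o *: x).
  have [->|x0] := eqVneq x 0; first by rewrite nrm0 mulr0 nrm_ge0.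
  by rewrite leNgt; apply/negP => h; apply: H; exists x => //; exact: ltW.
have e4 : 0 < e / 4 by rewrite divr_gt0.
have [z zo rz] := near _ e4.
have [bS S1 S2] := resolventP rz.
apply: nr; apply: (res_pert bT (resolventP rz) (M := 2 / e) _ _ _).1.
- by rewrite divr_gt0.
- move=> x; have := low (resolvent T z x).
  have -> : T (resolvent T z x) - o *: resolvent T z x = (z - o) *: resolvent T z x - x.
    have S2x := S2 x; move: S2x; set y := resolvent T z x => S2x.
    by rewrite -[X in _ = _ - X]S2x scalerBl opprB [RHS]addrC addrA subrK.
  move=> h; have := le_trans h (nrmB _ _); rewrite nrmZ.
  rewrite mulrAC ler_pdivlMr //; have := nrm_ge0 (resolvent T z x).
  move: zo; move: (nrm _) (nrm _) (nrm _) => a b c; nra.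
rewrite (nrmBC o) (_ : 2 * (2 / e) = 4 / e); last by field; rewrite gt_eqF.
by rewrite mulrAC ltr_pdivrMr //; move: zo; move: (nrm _) => a; lra.
Qed.

Definition is_cutoff (chi : smoothfun R) :=
  [/\ forall z, K z -> near_pt z (fun w => chi w = 1 /\ sd chi w = 0),
      forall z, F z -> near_pt z (fun w => chi w = 0 /\ sd chi w = 0)
    & forall z, 2 <= nrm z -> chi z = 0 /\ sd chi z = 0].

Lemma weight_cutoff chi : is_cutoff chi -> spectral_weight T (sd chi).
Proof.
move=> [h1 h2 _]; split=> [z|z /KF_spec[/h1|/h2]]; first by case: (sP chi z).
  by apply: near_pt_imp => w [].
by apply: near_pt_imp => w [].
Qed.

Variable o : C.
Hypothesis o1 : nrm o <= 1.

Lemma far_o z : 3 <= nrm (z - o) -> 2 <= nrm z.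
Proof. by move=> h; have := le_trans h (nrmB z o); have := o1; lra. Qed.

Lemma smooth_lip (u : smoothfun R) z : lip_at u z. Proof. by case: (sP u z). Qed.
Lemma smooth_lipd (u : smoothfun R) z : lip_at (sd u) z. Proof. by case: (sP u z). Qed.

Notation J := (resolvent_int T o).
Notation E := (@scalar_int R X o).

Lemma weight_cutoff_diff chi chi' (u : smoothfun R) : is_cutoff chi -> is_cutoff chi' ->
  spectral_weight T (fun z => (chi z - chi' z) * sd u z).
Proof.
move=> [h1 h2 _] [h1' h2' _]; split=> [z|z /KF_spec[Kz|Fz]].
- apply: (@lipZ _ _ (fun z => chi z - chi' z)); last exact: smooth_lipd.
  by apply: lipD; [exact: smooth_lip | apply: lipN; exact: smooth_lip].
- apply: near_pt_imp (near_pt_and (h1 _ Kz) (h1' _ Kz)) => w [[-> _] [-> _]].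
  by rewrite subrr mul0r.
- apply: near_pt_imp (near_pt_and (h2 _ Fz) (h2' _ Fz)) => w [[-> _] [-> _]].
  by rewrite subrr mul0r.
Qed.

Lemma weight_cutoffM chi (u : smoothfun R) : is_cutoff chi -> spectral_weight T (fun z => sd chi z * u z).
Proof. by move=> hc; apply: spectral_weightM (weight_cutoff hc) _ => z; exact: smooth_lip. Qed.

(** Stokes for (chi - chi') u, which vanishes near the spectrum: for holomorphic
    [u] the choice of the cutoff is immaterial, and otherwise the correction lives
    where the cutoffs differ and [u] is not holomorphic. *)
Lemma J_change chi chi' (u : smoothfun R) x : is_cutoff chi -> is_cutoff chi' ->
  J (fun z => sd chi z * u z) x =
  J (fun z => sd chi' z * u z) x - J (fun z => (chi z - chi' z) * sd u z) x.
Proof.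
move=> hc hc'; have [h1 h2 h3] := hc; have [h1' h2' h3'] := hc'.
have : J (sd (sf_mul (sf_sub chi chi') u)) x = 0.
  apply: (J_stokes bT x (sP _)) => [z /KF_spec[Kz|Fz]|z /far_o z2].
  - apply: near_pt_imp (near_pt_and (h1 _ Kz) (h1' _ Kz)) => w [[e1 e2] [e3 e4]].
    by rewrite svM sdM svB sdB e1 e2 e3 e4 !subrr !mul0r addr0.
  - apply: near_pt_imp (near_pt_and (h2 _ Fz) (h2' _ Fz)) => w [[e1 e2] [e3 e4]].
    by rewrite svM sdM svB sdB e1 e2 e3 e4 !subrr !mul0r addr0.
  - by rewrite svM svB (h3 _ z2).1 (h3' _ z2).1 subrr mul0r.
have -> : sd (sf_mul (sf_sub chi chi') u) = (fun z => (sd chi z * u z - sd chi' z * u z)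
    + (chi z - chi' z) * sd u z).
  by apply/funext => z; rewrite sdM sdB svB mulrBl.
rewrite JD //; [|by apply: spectral_weightD; [|apply: spectral_weightN]; exact: weight_cutoffM|exact: weight_cutoff_diff].
rewrite JB //; [|exact: weight_cutoffM|exact: weight_cutoffM].
by move=> /eqP; rewrite addr_eq0 subr_eq => /eqP ->; rewrite addrC.
Qed.

Lemma exp_id n z : sf_exp (sf_id R) n z = z ^+ n.
Proof. by elim: n => [|n IH]; rewrite ?expr0 // exprS -IH. Qed.

Lemma sd_exp_id n z : sd (sf_exp (sf_id R) n) z = 0.
Proof. by elim: n => [|n IH] //; rewrite (sdM (sf_id R)) IH mulr0 mul0r addr0. Qed.

Definition zpow (u : smoothfun R) n := sf_mul u (sf_exp (sf_id R) n).

Lemma zpowE u n z : zpow u n z = u z * z ^+ n. Proof. by rewrite svM exp_id. Qed.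
Lemma sd_zpow u n z : sd (zpow u n) z = sd u z * z ^+ n.
Proof. by rewrite sdM sd_exp_id mulr0 addr0 exp_id. Qed.

(** z R(z) = 1 + T R(z) leaves the integral of sd chi * u * z^n, which Stokes for
    chi * u * z^n turns into one supported where [u] is not holomorphic. *)
Lemma J_zpowS chi (u : smoothfun R) n x : is_cutoff chi ->
  J (fun z => sd chi z * zpow u n.+1 z) x =
  T (J (fun z => sd chi z * zpow u n z) x) - E (fun z => chi z * sd u z * z ^+ n) x.
Proof.
move=> hc; have [h1 h2 h3] := hc.
have -> : (fun z => sd chi z * zpow u n.+1 z) = (fun z => sd chi z * zpow u n z * z).
  by apply/funext => z; rewrite !zpowE exprSr !mulrA.
rewrite J_mulz //; last exact: weight_cutoffM.
congr (_ + _); apply/eqP; rewrite -addr_eq0; apply/eqP.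
rewrite -ED.
- apply: (E_stokes (f := sf_mul chi (zpow u n))); last first.
    by move=> z /far_o /h3[e _]; rewrite svM e mul0r.
  move=> z; apply: smooth_near_pt (sP (sf_mul chi (zpow u n)) z).
  by exists 1 => // w _; split => //; rewrite sdM sd_zpow !mulrA.
- by move=> z; case: (weight_cutoffM (zpow u n) hc) => h _; apply: h.
- move=> z; have := smooth_lipd (sf_mul (sf_cst 1) (zpow u n)) z.
  move=> h; have := lipZ (smooth_lip chi z) (smooth_lipd (zpow u n) z).
  apply: lip_near_pt; exists 1 => // w _.
  by rewrite sd_zpow [LHS]mulrA.
Qed.

(** R(z) x = (z - o)^-1 x + R(z) (z - o)^-1 (T - o) x shows that the projection
    acts on approximate eigenvectors at [o] almost as the scalar integral of
    [h].  That integral equals the one for a unit bump: the difference is the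
    derivative of (chi - bump) / (z - o), which has no singularity because both
    functions are 1 near [o]. *)
Lemma cut_lower chi x : is_cutoff chi -> K o ->
  let h := fun z => sd chi z * (z - o)^-1 in
  [/\ spectral_weight T h, nrm x <= 64 * nrm (E h x)
    & J (sd chi) x = E h x + J h (T x - o *: x)].
Proof.
move=> hc Ko h; have [h1 h2 h3] := hc; have ac := weight_cutoff hc.
have nb : near_pt o (fun w => sf_bump o 1 w = 1 /\ sd (sf_bump o 1) w = 0).
  by exists 1 => // w; rewrite mul1r => /ltW; apply: bump1.
have lip_h (g : C -> C^o) : (forall z, lip_at g z) -> near_pt o (fun w => g w = 0) ->
    forall z, lip_at (fun z => g z * (z - o)^-1 : C^o) z.
  move=> lg g0 z; have [->|zo] := eqVneq z o.
    apply: lip_near_pt (lip_cst (0 : C^o) o); apply: near_pt_imp g0 => w ->.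
    by rewrite mul0r.
  by apply: lipZ (lg z) _; case: (smooth_inv zo).
have co : near_pt o (fun w => sd chi w = 0) by apply: near_pt_imp (h1 o Ko) => w [].
have bo : near_pt o (fun w => sd (sf_bump o 1) w = 0) by apply: near_pt_imp nb => w [].
have lh := lip_h _ (smooth_lipd chi) co.
have lhb := lip_h _ (smooth_lipd (sf_bump o 1)) bo.
have ah : spectral_weight T h.
  split; first exact: lh.
  by move=> z nz; apply: near_pt_imp (ac.2 z nz) => w; rewrite /h => ->; rewrite mul0r.
split => //.
  apply: le_trans (E_bump_lower o x) _.
  have -> : E h x = E (fun z => sd (sf_bump o 1) z * (z - o)^-1) x +
    E (fun z => (sd chi z - sd (sf_bump o 1) z) * (z - o)^-1) x.
    rewrite -ED //.
      congr plane_int; apply/funext => z; congr (_ *: _).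
      by rewrite /h -mulrDl; congr (_ * _); rewrite [RHS]addrC subrK.
    apply: lip_h => [z|].
      by apply: lipD; [exact: smooth_lipd | apply: lipN; exact: smooth_lipd].
    by apply: near_pt_imp (near_pt_and co bo) => w [-> ->]; rewrite subrr.
  suff -> : E (fun z => (sd chi z - sd (sf_bump o 1) z) * (z - o)^-1) x = 0 by rewrite addr0.
  apply: (@E_stokes _ _ _ (fun z => (chi z - sf_bump o 1 z) * (z - o)^-1)).
    move=> z; have [->|zo] := eqVneq z o.
      apply: smooth_near_pt (smooth_cst (0 : C^o) o).
      apply: near_pt_imp (near_pt_and (h1 o Ko) nb) => w [[-> ->] [-> ->]].
      by rewrite !subrr !mul0r.
    apply: smooth_near_pt (smoothZ (sP (sf_sub chi (sf_bump o 1)) z) (smooth_inv zo)).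
    by exists 1 => // w _; rewrite svB sdB scaler0 addr0.
  move=> z z3; have [-> _] := h3 _ (far_o z3).
  have [|-> _] := @bump0 R o 1 z ltr01; first by rewrite mulr1; move: z3; lra.
  by rewrite subrr mul0r.
rewrite /resolvent_int /scalar_int -plane_intD; [|exact: lipE|exact: lipJ].
congr plane_int; apply/funext => z.
have [rz|nz] := pselect (in_resolvent T z); last first.
  by rewrite /h (near_pt_self (ac.2 z nz)) mul0r !scale0r addr0.
have zo : z - o != 0.
  apply/eqP => /eqP; rewrite subr_eq0 => /eqP e.
  by have /KF_spec := (or_introl Ko : K o \/ F o); rewrite -e.
rewrite /h -!scalerA -scalerDr; congr (_ *: _).
have [bS S1 S2] := resolventP rz.
apply: (scalerI zo); rewrite -scalerDr scalerA mulfV // scale1r.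
have -> : T x - o *: x = (z - o) *: x - (z *: x - T x).
  by rewrite scalerBl opprB [RHS]addrC addrA subrK.
have [_ SZ _] := bS.
by rewrite (blinB _ _ bS) S1 SZ [RHS]addrC subrK.
Qed.

(** On an approximate eigenvector the projection acts almost as a nonzero scalar,
    and its image is again an approximate eigenvector. *)
Lemma projection_sq_neq0 chi : is_cutoff chi -> K o ->
  (forall e, 0 < e -> exists2 z, nrm (z - o) < e & in_resolvent T z) ->
  exists x, J (sd chi) (J (sd chi) x) != 0.
Proof.
move=> hc Ko near; have ac := weight_cutoff hc.
set h := fun z => sd chi z * (z - o)^-1.
have [ah _ _] := cut_lower 0 hc Ko; rewrite -/h in ah.
have bP := J_blin bT o ac; have bJ := J_blin bT o ah.
have [_ _ [Mp Mp0 hMp]] := bP; have [_ _ [Mh Mh0 hMh]] := bJ.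
have A0 : 0 < Mh / 64 + Mh * Mp + 1 by rewrite !addr_gt0 ?divr_gt0 ?mulr_gt0.
have e0 : 0 < (64 * 64 * 2 * (Mh / 64 + Mh * Mp + 1))^-1 by rewrite invr_gt0 !mulr_gt0.
have nro : ~ in_resolvent T o by apply/KF_spec; left.
have [x x0 hx] := approx_eig nro near e0.
exists x; apply/eqP => PP0.
have [_ l1 d1] := cut_lower x hc Ko; rewrite -/h in l1 d1.
have [_ l2 d2] := cut_lower (J (sd chi) x) hc Ko; rewrite -/h in l2 d2.
have nx := nrm_gt0 x0.
set y := T x - o *: x in hx d1.
have e1 : T (J (sd chi) x) - o *: J (sd chi) x = J (sd chi) y.
  have [_ PZ _] := bP.
  by rewrite /y (blinB _ _ bP) PZ (@J_comm _ _ T bT o T (sd chi) x bT).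
rewrite e1 PP0 in d2.
have b1 := hMh y; have b2 := hMh (J (sd chi) y); have b3 := hMp y.
have b4 : nrm (E h x) <= nrm (J (sd chi) x) + nrm (J h y).
  by apply: le_trans (nrmB _ _); rewrite d1 addrK.
have b5 : nrm (E h (J (sd chi) x)) <= nrm (J h (J (sd chi) y)).
  by move/eqP: d2; rewrite eq_sym addr_eq0 => /eqP ->; rewrite nrmN.
move: hx; rewrite mulrC ler_pdivlMr; last by rewrite !mulr_gt0.
have y0 := nrm_ge0 y.
have b6 : nrm (J h (J (sd chi) y)) <= Mh * (Mp * nrm y).
  by apply: le_trans b2 _; rewrite ler_wpM2l // ltW.
move: nx l1 l2 b1 b4 b5 b6 y0; move: (nrm (E h x)) (nrm (E h _)) (nrm (J h _)) (nrm (J h _)) (nrm x) (nrm y) (nrm (J _ x)) => a b c d f g i.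
move=> nx l1 l2 b1 b4 b5 b6 y0 hx.
have q1 : f <= 4096 * (Mh * Mp * g) + 64 * (Mh * g) by lra.
have : g * (64 * 64 * 2 * (Mh / 64 + Mh * Mp + 1)) = 128 * (Mh * g) + 8192 * (Mh * Mp * g) + 8192 * g.
  by field.
lra.
Qed.

Variable L : seq C.
Hypothesis L1 : forall l, l \in L -> nrm l = 1.
Hypothesis KL : forall z, K z -> nrm z = 1 -> z \in L.

(** The part of [K] outside the discs of radius [r] around [L] is compact in the
    open unit disc, hence lies in a smaller disc; the rest of the plane is added
    to the set where the cutoff vanishes. *)
Lemma cut_family r : 0 < r <= 1 -> exists rho chi,
  [/\ 0 < rho < 1, is_cutoff chi & forall z, (chi z != 0) || (sd chi z != 0) ->
    (exists2 l, l \in L & nrm (z - l) < r) \/ nrm z < rho].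
Proof.
move=> /andP[r0 r1].
have [M M0 hM] : exists2 M, 0 < M & forall z, nrm z <= 1 ->
    K z -> (forall l, l \in L -> r <= nrm (z - l)) -> 1 <= M * (1 - nrm z).
  apply: (@box_cover R 1 (fun M z => K z -> (forall l, l \in L -> r <= nrm (z - l)) ->
     1 <= M * (1 - nrm z))).
    move=> M M' z MM' h Kz zl; apply: le_trans (h Kz zl) _.
    by rewrite ler_wpM2r // subr_ge0 K1.
  move=> z0; have [Kz0|nKz0] := pselect (K z0); last first.
    by have [M M0 hM] := cK nKz0; exists M => // z /hM.
  have [z01|] := eqVneq (nrm z0) 1.
    exists r^-1; first by rewrite invr_gt0.
    move=> z; rewrite mulrC ltr_pdivrMr // mul1r => h _ /(_ _ (KL Kz0 z01)).
    by rewrite leNgt h.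
  rewrite neq_lt => /orP[lt1|]; last by rewrite ltNge K1.
  exists (2 / (1 - nrm z0)); first by rewrite divr_gt0 // subr_gt0.
  move=> z hz _ _; move: hz.
  rewrite ![2 / _ * _]mulrAC ltr_pdivrMr ?subr_gt0 // ler_pdivlMr ?subr_gt0 // !mul1r.
  have := nrmD (z - z0) z0; rewrite subrK.
  move: lt1; move: (nrm _) (nrm _) (nrm _) => a b c; lra.
pose rho : R := 1 - (2 * (M + 1))^-1.
have i0 : 0 < (2 * (M + 1))^-1 by rewrite invr_gt0 mulr_gt0 // ltr_wpDr.
have iM : (2 * (M + 1))^-1 * (2 * (M + 1)) = 1 by rewrite mulVf // gt_eqF // mulr_gt0 // ltr_wpDr.
have rho1 : rho < 1 by rewrite /rho; lra.
have rho0 : 0 < rho by rewrite /rho; nra.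
pose G z := rho <= nrm z /\ forall l, l \in L -> r <= nrm (z - l).
have cG : closed_pts G.
  move=> z /not_andP[|].
    move/negP; rewrite -ltNge => h; exists (rho - nrm z)^-1; first by rewrite invr_gt0 subr_gt0.
    move=> w; rewrite mulrC ltr_pdivrMr ?subr_gt0 // mul1r => hw [h2 _].
    have := nrmD (w - z) z; rewrite subrK; move: hw h2; move: (nrm _) (nrm _) (nrm _) => a b c; lra.
  move=> /existsNP[l /not_implyP[lL /negP]]; rewrite -ltNge => h.
  exists (r - nrm (z - l))^-1; first by rewrite invr_gt0 subr_gt0.
  move=> w; rewrite mulrC ltr_pdivrMr ?subr_gt0 // mul1r => hw [_ /(_ l lL) h2].
  by have := nrm_tri z w l; lra.
have KG z : K z -> ~ (F z \/ G z).
  move=> Kz [|[h1 h2]]; first exact: KF.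
  have := hM z (K1 Kz) Kz h2; rewrite /rho in h1.
  have : 0 <= (2 * (M + 1))^-1 by exact: ltW.
  move: (_^-1) iM i0 h1 => i iM i0 h1; nra.
have [chi [c1 c2]] := cutoff K1 cK (closed_ptsU cF cG) KG.
exists rho, chi; split; first by rewrite rho0.
  split => // [z Fz|z z2]; first by apply: c2; left.
  apply: (near_pt_self (c2 z _)); right; split; first by lra.
  move=> l /L1 l1; have := nrmD (z - l) l; rewrite subrK l1.
  move: z2; move: (nrm _) (nrm _) => a b; lra.
move=> z hz; have [//|/not_orP[n1 n2]] := pselect ((exists2 l, l \in L & nrm (z - l) < r) \/ nrm z < rho).
have Gz : G z.
  split; first by rewrite leNgt; apply/negP.
  by move=> l lL; rewrite leNgt; apply/negP => h; apply: n1; exists l.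
have [e1 e2] := near_pt_self (c2 z (or_intror Gz)).
by move: hz; rewrite e1 e2 eqxx.
Qed.

Lemma JZ g (a : C) x : spectral_weight T g -> J (fun z => a * g z) x = a *: J g x.
Proof.
move=> ag; rewrite /resolvent_int -(@plane_int_map _ o _ (fun v : X => a *: v) (nrm a)).
- by congr plane_int; apply/funext => z; rewrite scalerA.
- by move=> u v; rewrite scalerDr.
- by move=> c v; rewrite !scalerA mulrC.
- by move=> v; rewrite nrmZ.
- exact: lipJ.
Qed.

Lemma spectral_weightZ g (a : C) : spectral_weight T g -> spectral_weight T (fun z => a * g z).
Proof.
move=> [lg g0]; split; first by move=> z; apply: lipZ (lip_cst _ _) (lg z).
by move=> z nz; apply: near_pt_imp (g0 z nz) => w ->; rewrite mulr0.
Qed.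

Lemma spectral_weight_sum (I : Type) (s : seq I) (g : I -> C -> C^o) : (forall i, spectral_weight T (g i)) ->
  spectral_weight T (fun z => \sum_(i <- s) g i z).
Proof.
move=> ag; elim: s => [|i s IH].
  under eq_fun do rewrite big_nil.
  by split=> z; [exact: lip_cst | exists 1].
under eq_fun do rewrite big_cons.
exact: spectral_weightD.
Qed.

Lemma J_sum (I : Type) (s : seq I) (g : I -> C -> C^o) x : (forall i, spectral_weight T (g i)) ->
  J (fun z => \sum_(i <- s) g i z) x = \sum_(i <- s) J (g i) x.
Proof.
move=> ag; elim: s => [|i s IH].
  under eq_fun do rewrite big_nil.
  rewrite big_nil -[RHS](scale0r (J (fun=> 0) x)) -JZ.
    by congr J; apply/funext => z; rewrite mulr0.
  by split=> z; [exact: lip_cst | exists 1].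
under eq_fun do rewrite big_cons.
by rewrite big_cons JD ?IH //; exact: spectral_weight_sum.
Qed.

Lemma seq_unif (Q : C -> R -> Prop) (s : seq C) :
  (forall l M M', M <= M' -> Q l M -> Q l M') ->
  (forall l, l \in s -> exists2 M, 0 < M & Q l M) ->
  exists2 M, 0 < M & forall l, l \in s -> Q l M.
Proof.
move=> Qm; elim: s => [|a s IH] H; first by exists 1.
have [M M0 hM] := H a (mem_head _ _).
have [|N N0 hN] := IH; first by move=> l ls; apply: H; rewrite inE ls orbT.
exists (M + N); first exact: addr_gt0.
move=> l; rewrite inE => /orP[/eqP ->|ls].
  by apply: Qm hM; rewrite lerDl ltW.
by apply: Qm (hN l ls); rewrite lerDr ltW.
Qed.

Lemma separation : exists2 r : R, 0 < r <= 1 &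
  forall l l', l \in L -> l' \in L -> l != l' -> 4 * r <= nrm (l - l').
Proof.
have [M M0 hM] : exists2 M, 0 < M & forall l, l \in L -> forall l', l' \in L -> l != l' ->
    1 <= M * nrm (l - l').
  apply: (@seq_unif (fun l M => forall l', l' \in L -> l != l' -> 1 <= M * nrm (l - l'))).
    move=> l M M' MM' h l' l'L ll'; apply: le_trans (h l' l'L ll') _.
    by rewrite ler_wpM2r ?nrm_ge0.
  move=> l lL; apply: (@seq_unif (fun l' M => l != l' -> 1 <= M * nrm (l - l'))).
    move=> l' M M' MM' h ll'; apply: le_trans (h ll') _.
    by rewrite ler_wpM2r ?nrm_ge0.
  move=> l' l'L; have [->|ll'] := eqVneq l l'; first by exists 1.
  have n0 : 0 < nrm (l - l') by rewrite nrm_gt0 // subr_eq0.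
  by exists (nrm (l - l'))^-1; [rewrite invr_gt0 | rewrite mulVf // gt_eqF].
have i0 : 0 < (4 * M + 1)^-1 by rewrite invr_gt0 addr_gt0 // mulr_gt0.
have iM : (4 * M + 1)^-1 * (4 * M + 1) = 1 by rewrite mulVf // gt_eqF // addr_gt0 // mulr_gt0.
exists (4 * M + 1)^-1; first by rewrite i0 invf_le1 ?lerDr ?addr_gt0 ?mulr_ge0 ?mulr_gt0 // ltW.
move=> l l' lL l'L ll'; have := hM l lL l' l'L ll'.
move: (_^-1) i0 iM (nrm (l - l')) (nrm_ge0 (l - l')) => i i0 iM n n0 h.
by rewrite -(ler_pM2l M0); nra.
Qed.

Lemma exp_sf (u : smoothfun R) n z : sf_exp u n z = u z ^+ n.
Proof. by elim: n => [|n IH]; rewrite ?expr0 // exprS -IH. Qed.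

Lemma bump_sep r eta l l' z : (forall l l', l \in L -> l' \in L -> l != l' -> 4 * r <= nrm (l - l')) ->
  0 < eta <= r -> l \in L -> l' \in L -> nrm (z - l') < eta ->
  sf_bump l eta z = (l == l')%:R /\ sd (sf_bump l eta) z = 0.
Proof.
move=> sep /andP[e0 er] lL l'L h.
have [->|ll'] := eqVneq l l'; first exact: bump1 e0 (ltW h).
apply: bump0 => //; have := sep _ _ lL l'L ll'; have := nrm_tri z l l'.
by rewrite (nrmBC l z); lra.
Qed.

Lemma sf_bounded (u : C -> C^o) : (forall z, lip_at u z) -> (forall z, 2 <= nrm z -> u z = 0) ->
  exists2 B, 0 < B & forall z, nrm (u z) <= B.
Proof.
move=> lu u0; have [B B0 hB] := unif_bnd 2 lu; exists B => // z.
have [/hB //|/ltW /u0 ->] := leP (nrm z) 2.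
by rewrite nrm0 ltW.
Qed.

Lemma J_one chi : J (fun z => sd chi z * zpow (sf_cst 1) 0 z) = J (sd chi).
Proof. by congr J; apply/funext => z; rewrite zpowE !mulr1. Qed.

Lemma J_pow chi n x : is_cutoff chi ->
  J (fun z => sd chi z * zpow (sf_cst 1) n z) x = iter n T (J (sd chi) x).
Proof.
move=> hc; elim: n => [|n IH]; first by rewrite J_one.
rewrite J_zpowS // IH (_ : (fun z => _) = (fun=> 0)); last first.
  by apply/funext => z; rewrite mulr0 mul0r.
have h := @E_bound R X o (fun=> 0) x 0 (fun z => lip_cst 0 z) _.
have : nrm (E (fun=> 0) x) <= 0 by rewrite -[X in _ <= X](mulr0 64) -[X in _ * X](mul0r (nrm x)) h // => z; rewrite nrm0.
move=> e; rewrite (_ : E _ x = 0) ?subr0 //; apply: nrm_eq0.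
by apply/eqP; rewrite eq_le e nrm_ge0.
Qed.

(** The cutoff may be replaced by one supported in the disc of radius 1 + e. *)
Lemma projection_growth chi0 : is_cutoff chi0 -> forall e, 0 < e ->
  exists2 M, 0 < M & forall k v, nrm (iter k T (J (sd chi0) v)) <= M * (1 + e) ^+ k * nrm v.
Proof.
move=> hc0 e e0.
have r1 : 0 < Num.min e 1 <= 1 by rewrite lt_min e0 ltr01 ge_min lexx orbT.
have [rho [chi [/andP[rho0 rho1] hc supp]]] := cut_family r1.
have [M M0 hM] := J_bound bT o (weight_cutoff hc).
exists M => // k v.
have -> : J (sd chi0) v = J (sd chi) v.
  rewrite -!J_one (J_change _ _ hc0 hc) (_ : (fun z => (chi0 z - chi z) * _) = (fun z => 0 * sd chi z)).
    by rewrite JZ ?scale0r ?subr0 //; exact: weight_cutoff.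
  by apply/funext => z; rewrite sd_zpow !mul0r mulr0.
rewrite -J_pow //; apply: hM; last by rewrite exprn_ge0 // addr_ge0 ?ltW.
  by move=> z; exact: smooth_lip.
move=> z sz; rewrite zpowE mul1r nrmX lerXn2r ?nnegrE ?nrm_ge0 // ?addr_ge0 ?ltW //.
have [|[l /L1 l1 h]|h] := supp z; [by rewrite sz orbT | | lra].
have := nrmD (z - l) l; rewrite subrK l1.
have : Num.min e 1 <= e by rewrite ge_min lexx.
move: h; move: (nrm _) (nrm _) => a b; lra.
Qed.

(** The contribution of a neighbourhood of [l] to T^n P. *)
Definition piece chi r (l : C) n : X -> X :=
  J (fun z => sd chi z * zpow (sf_bump l r) n z).

Section Pieces.
Variables (r0 rho : R) (chi : smoothfun R).
Hypothesis r01 : 0 < r0 <= 1.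
Hypothesis sep : forall l l', l \in L -> l' \in L -> l != l' -> 4 * r0 <= nrm (l - l').
Hypothesis rho01 : 0 < rho < 1.
Hypothesis hc : is_cutoff chi.
Hypothesis supp : forall z, (chi z != 0) || (sd chi z != 0) ->
    (exists2 l, l \in L & nrm (z - l) < r0) \/ nrm z < rho.

(** The bumps sum to 1 near [L], so what is left out comes from the disc of
    radius [rho]. *)
Lemma pieces_sum : uniq L -> exists2 M, 0 < M & forall n v,
  nrm (iter n T (J (sd chi) v) - \sum_(l <- L) piece chi r0 l n v) <= M * rho ^+ n * nrm v.
Proof.
move=> uL; have [/andP[r0_gt0 _] /andP[rho0 _]] := (r01, rho01).
have self : 0 < r0 <= r0 by rewrite r0_gt0 lexx.
pose th z := \sum_(l <- L) sf_bump l r0 z.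
have lth z : @lip_at R C^o th z.
  rewrite /th; elim: (L) => [|l s IH].
    by under [X in lip_at X]eq_fun do rewrite big_nil; exact: lip_cst.
  under [X in lip_at X]eq_fun do rewrite big_cons.
  exact: lipD (smooth_lip _ _) IH.
have ag : spectral_weight T (fun z => sd chi z * (1 - th z)).
  apply: spectral_weightM (weight_cutoff hc) _ => z.
  by apply: lipD (lip_cst _ _) _; exact: lipN.
have [M M0 hM] := J_bound bT o ag.
exists M => // n v.
have -> : iter n T (J (sd chi) v) - \sum_(l <- L) piece chi r0 l n v =
   J (fun z => sd chi z * (1 - th z) * sf_exp (sf_id R) n z) v.
  rewrite -J_pow // -J_sum; last by move=> l; exact: weight_cutoffM.
  rewrite -JB //; last 2 first.
  - exact: weight_cutoffM.
  - by apply: spectral_weight_sum => l; exact: weight_cutoffM.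
  congr J; apply/funext => z; rewrite zpowE exp_id mul1r mulrBr mulr1 mulrBl; congr (_ - _).
  by rewrite /th mulr_sumr mulr_suml; apply: eq_bigr => l _; rewrite zpowE mulrA.
apply: hM; last by rewrite exprn_ge0 // ltW.
  by move=> z; exact: smooth_lip.
move=> z; rewrite mulf_eq0 negb_or => /andP[sz tz].
rewrite exp_id nrmX lerXn2r ?nnegrE ?nrm_ge0 ?(ltW rho0) //.
have [|[l lL h]|/ltW //] := @supp z; first by rewrite sz orbT.
case/negP: tz; rewrite subr_eq0 eq_sym; apply/eqP.
rewrite /th (bigD1_seq l) // big1_seq ?addr0.
  by have [-> _] := bump_sep sep self lL lL h; rewrite eqxx; exact: addr0.
move=> l' /andP[ll' l'L].
by have [-> _] := bump_sep sep self l'L lL h; rewrite (negPf ll').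
Qed.

(** By [J_zpowS], piece (n+1) v differs from piece n (T v) by an integral over
    the annulus where the bump varies; there the cutoff lives in the disc of
    radius [rho], so the difference is O(rho^n) |v|.  Unrolling this recursion
    expresses the amplitude by the present and the past of the orbit of [v]. *)
Lemma piece_amp l : l \in L -> exists2 M, 0 < M & forall n v,
  nrm (piece chi r0 l n v) <=
    M * (nrm (iter n T v) + \sum_(0 <= k < n) rho ^+ k * nrm (iter (n - k.+1) T v)).
Proof.
move=> lL; have [/andP[r0_gt0 _] /andP[rho0 _]] := (r01, rho01).
have self : 0 < r0 <= r0 by rewrite r0_gt0 lexx.
have [_ _ h3] := hc.
have [_ _ [M M0 hM]] := J_blin bT o (weight_cutoffM (zpow (sf_bump l r0) 0) hc).
have [B B0 hB] : exists2 B, 0 < B & forall z, nrm (chi z * sd (sf_bump l r0) z) <= B.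
  apply: (@sf_bounded (fun z => chi z * sd (sf_bump l r0) z)) => z.
    exact: lipZ (smooth_lip chi z) (smooth_lipd (sf_bump l r0) z).
  by move=> /h3[-> _]; rewrite mul0r.
have hE k v : nrm (E (fun z => chi z * sd (sf_bump l r0) z * z ^+ k) v) <= 64 * B * (rho ^+ k * nrm v).
  rewrite -mulrA [B * _]mulrA; apply: E_bound.
    move=> z; have := lipZ (lipZ (smooth_lip chi z) (smooth_lipd (sf_bump l r0) z)) (smooth_lip (sf_exp (sf_id R) k) z).
    by apply: lip_near_pt; exists 1 => // w _; rewrite exp_id.
  move=> z; rewrite nrmM nrmX.
  have [z0|z0] := eqVneq (chi z * sd (sf_bump l r0) z) 0.
    by rewrite z0 nrm0 mul0r mulr_ge0 ?exprn_ge0 ?ltW.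
  apply: ler_pM; rewrite ?nrm_ge0 ?exprn_ge0 ?hB ?nrm_ge0 //.
  rewrite lerXn2r ?nnegrE ?nrm_ge0 ?(ltW rho0) //.
  move: z0; rewrite mulf_eq0 negb_or => /andP[cz bz].
  have [|[l' l'L h]|/ltW //] := @supp z; first by rewrite cz.
  have [_ e] := bump_sep sep self lL l'L h.
  by rewrite e eqxx in bz.
exists (M + 64 * B); first by rewrite addr_gt0 // mulr_gt0.
have MB : 0 <= M + 64 * B by rewrite addr_ge0 ?mulr_ge0 ?ltW.
elim=> [|n IH] v.
  rewrite big_geq // addr0 /=; apply: le_trans (hM v) _.
  by rewrite ler_wpM2r ?nrm_ge0 // lerDl mulr_ge0 // ltW.
rewrite /piece J_zpowS // -/(piece chi r0 l n v).
have -> : T (piece chi r0 l n v) = piece chi r0 l n (T v).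
  by rewrite /piece (@J_comm _ _ T bT o T _ v bT) //; exact: weight_cutoffM.
apply: le_trans (nrmB _ _) _; apply: le_trans (lerD (IH _) (hE n v)) _.
rewrite -!iterSr big_nat_recr //= subnn /= addrA [X in _ <= X]mulrDr; apply: lerD.
  rewrite ler_wpM2l // lerD2l; apply: ler_sum_nat => k kn.
  by rewrite -iterSr (_ : n.+1 - k.+1 = (n - k.+1).+1)%N //; lia.
by rewrite ler_wpM2r ?mulr_ge0 ?nrm_ge0 ?exprn_ge0 ?(ltW rho0) // lerDr ltW.
Qed.

(** Shrinking the cutoff and the bump changes the piece by an exponentially small
    amount, since the changes take place in a disc of radius less than 1.  On the
    support of the small bump w = z / l - 1 satisfies |w| <= eta, and
    z^n = l^n (1 + w)^n is expanded by the binomial formula. *)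
Lemma piece_poly eta : 0 < eta -> exists rho1, 0 < rho1 < 1 /\
  exists c : C -> nat -> X -> X, forall l, l \in L -> exists2 M, 0 < M & forall v,
    (forall k, nrm (c l k v) <= M * eta ^+ k * nrm v) /\
    forall n, nrm (piece chi r0 l n v - l ^+ n *: \sum_(0 <= k < n.+1) ('C(n, k))%:R *: c l k v)
      <= M * rho1 ^+ n * nrm v.
Proof.
move=> eta0; have [/andP[r0_gt0 r0_le1] /andP[rho0 rho1]] := (r01, rho01).
have self : 0 < r0 <= r0 by rewrite r0_gt0 lexx.
(* A bump of radius r has support in the disc of radius 2 r. *)
pose r := Num.min (eta / 2) r0.
have r_gt0 : 0 < r by rewrite lt_min divr_gt0.
have rr0 : r <= r0 by rewrite ge_min lexx orbT.
have reta : 2 * r <= eta.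
  have : r <= eta / 2 by rewrite ge_min lexx.
  lra.
have rr : 0 < r <= r0 by rewrite r_gt0.
have rr1 : 0 < r <= 1 by rewrite r_gt0 (le_trans rr0).
have [rh [ch [/andP[rh0 rh1] hch such]]] := cut_family rr1.
exists (Num.max rho rh); split; first by rewrite lt_max rho0 gt_max rho1.
have m0 : 0 <= Num.max rho rh by rewrite le_max ltW.
pose w l := sf_sub (sf_mul (sf_cst l^-1) (sf_id R)) (sf_cst 1).
have wE l z : w l z = z / l - 1 by rewrite svB svM mulrC.
exists (fun l k => J (fun z => sd ch z * sf_mul (sf_bump l r) (sf_exp (w l) k) z)) => l lL.
have l0 : l != 0.
  by apply/eqP => e; have := L1 lL; rewrite e nrm0 => /eqP; rewrite eq_sym oner_eq0.
have ag := weight_cutoffM (sf_bump l r) hch.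
have [M1 M10 hM1] := J_bound bT o ag.
have ad := weight_cutoff_diff (sf_bump l r0) hc hch.
have [M2 M20 hM2] := J_bound bT o ad.
have at_ := weight_cutoffM (sf_sub (sf_bump l r0) (sf_bump l r)) hch.
have [M3 M30 hM3] := J_bound bT o at_.
exists (M1 + M2 + M3); first by rewrite !addr_gt0.
move=> v; split=> [k|n].
  have -> : (fun z => sd ch z * sf_mul (sf_bump l r) (sf_exp (w l) k) z) =
     (fun z => sd ch z * sf_bump l r z * sf_exp (w l) k z).
    by apply/funext => z; rewrite svM mulrA.
  apply: (@le_trans _ _ (M1 * eta ^+ k * nrm v)); last first.
    by rewrite ler_wpM2r ?nrm_ge0 // ler_wpM2r ?exprn_ge0 ?(ltW eta0) //; lra.
  apply: hM1; last by rewrite exprn_ge0 // ltW.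
    by move=> z; exact: smooth_lip.
  move=> z; rewrite mulf_eq0 negb_or => /andP[_ bz].
  rewrite exp_sf nrmX lerXn2r ?nnegrE ?nrm_ge0 ?(ltW eta0) //.
  have -> : w l z = (z - l) / l by rewrite wE mulrBl mulfV.
  rewrite nrmM nrmV (L1 lL) invr1 mulr1 leNgt; apply/negP => h.
  have [|e _] := @bump0 R l r z r_gt0; last by rewrite e eqxx in bz.
  by lra.
have key : l ^+ n *: \sum_(0 <= k < n.+1) ('C(n, k))%:R *:
    J (fun z => sd ch z * sf_mul (sf_bump l r) (sf_exp (w l) k) z) v = piece ch r l n v.
  have e k : ('C(n, k))%:R *: J (fun z => sd ch z * sf_mul (sf_bump l r) (sf_exp (w l) k) z) v =
     J (fun z => ('C(n, k))%:R * (sd ch z * sf_mul (sf_bump l r) (sf_exp (w l) k) z)) v.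
    by rewrite JZ //; exact: weight_cutoffM.
  under eq_bigr do rewrite e.
  rewrite -J_sum; last by move=> k; apply: spectral_weightZ; exact: weight_cutoffM.
  rewrite -JZ; last by apply: spectral_weight_sum => k; apply: spectral_weightZ; exact: weight_cutoffM.
  congr (resolvent_int T o _ v); apply/funext => z; rewrite zpowE.
  have -> : z ^+ n = l ^+ n * (w l z + 1) ^+ n.
    by rewrite wE subrK -exprMn mulrC divfK.
  have re (a b c d : C) : a * (b * (c * d)) = c * (a * b * d) by ring.
  rewrite re (addrC (w l z)) exprDn big_mkord; congr (_ * _).
  rewrite mulr_sumr; apply: eq_bigr => k _.
  by rewrite svM exp_sf expr1n mul1r mulr_natl mulrnAr mulrA.
rewrite key.
have -> : piece chi r0 l n v - piece ch r l n v =
   J (fun z => sd ch z * sf_sub (sf_bump l r0) (sf_bump l r) z * sf_exp (sf_id R) n z) v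
   - J (fun z => (chi z - ch z) * sd (sf_bump l r0) z * sf_exp (sf_id R) n z) v.
  rewrite /piece (J_change _ _ hc hch) addrAC -[X in X - _ = _]JB //; [|exact: weight_cutoffM|exact: weight_cutoffM].
  congr (_ - _); congr (resolvent_int T o _ v); apply/funext => z; rewrite ?sd_zpow ?exp_id ?zpowE ?svB.
    by rewrite -mulrBr -mulrBl mulrA.
  by rewrite mulrA.
have E3 : nrm (J (fun z => sd ch z * sf_sub (sf_bump l r0) (sf_bump l r) z * sf_exp (sf_id R) n z) v)
    <= M3 * Num.max rho rh ^+ n * nrm v.
  apply: hM3; last by rewrite exprn_ge0.
    by move=> z; exact: smooth_lip.
  move=> z; rewrite mulf_eq0 negb_or svB => /andP[sz bz].
  rewrite exp_id nrmX lerXn2r ?nnegrE ?nrm_ge0 //.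
  have [|[l' l'L h]|h] := such z; first by rewrite sz orbT.
    have [e1 _] := bump_sep sep self lL l'L (lt_le_trans h rr0).
    have [e2 _] := bump_sep sep rr lL l'L h.
    by rewrite e1 e2 subrr eqxx in bz.
  by rewrite le_max (ltW h) orbT.
have E2 : nrm (J (fun z => (chi z - ch z) * sd (sf_bump l r0) z * sf_exp (sf_id R) n z) v)
    <= M2 * Num.max rho rh ^+ n * nrm v.
  apply: hM2; last by rewrite exprn_ge0.
    by move=> z; exact: smooth_lip.
  move=> z; rewrite mulf_eq0 negb_or => /andP[cz bz].
  rewrite exp_id nrmX lerXn2r ?nnegrE ?nrm_ge0 //.
  have far l' : l' \in L -> nrm (z - l') < r0 -> false.
    move=> l'L h; have [_ e] := bump_sep sep self lL l'L h.
    by rewrite e eqxx in bz.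
  have [c0|c0] := eqVneq (chi z) 0.
    have [|[l' l'L h]|h] := such z.
    - by apply/orP; left; apply: contra_neq cz => ->; rewrite c0 subrr.
    - by have := far l' l'L (lt_le_trans h rr0).
    - by rewrite le_max (ltW h) orbT.
  have [|[l' l'L h]|h] := @supp z; first by rewrite c0.
    by have := far l' l'L h.
  by rewrite le_max (ltW h).
apply: le_trans (nrmB _ _) _; apply: le_trans (lerD E3 E2) _.
rewrite -!mulrDl; have : 0 <= Num.max rho rh ^+ n * nrm v by rewrite mulr_ge0 ?nrm_ge0 ?exprn_ge0.
rewrite -!mulrA; move: (_ * nrm v) => a a0; nra.
Qed.

End Pieces.

End Localization.

(** * Norming functionals *)

Section HahnBanach.
Variables (R : realType) (X : normedModType R[i]).
Notation C := R[i].

(** Over the reals: only real scalars are involved. *)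
Definition sublin (p : X -> R) :=
  (forall x y, p (x + y) <= p x + p y) /\ (forall t x, 0 < t -> p (t%:C *: x) <= t * p x).

Lemma sublin0 p : sublin p -> p 0 = 0.
Proof.
move=> [pD pZ]; have h1 := pD 0 0; have := pZ (1 / 2) 0 ltac:(lra).
by rewrite scaler0 addr0 in h1 *; lra.
Qed.

Lemma sublinN p x : sublin p -> - p (- x) <= p x.
Proof. by move=> sp; have [pD _] := sp; have := pD x (- x); rewrite subrr sublin0 //; lra. Qed.

(** A sublinear functional below [p] whose value at [-y] is at most [- p y]; a
    minimal sublinear functional coincides with its tilts, hence is odd and
    therefore additive. *)
Definition tilt (p : X -> R) y x := inf [set p (x + t%:C *: y) - t * p y | t in [set t | 0 <= t]].

Lemma sublin_ge0Z p t x : sublin p -> 0 <= t -> p (t%:C *: x) <= t * p x.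
Proof.
move=> sp; rewrite le_eqVlt => /orP[/eqP <-|]; last by case: sp => _; apply.
by rewrite scale0r mul0r sublin0.
Qed.

Lemma sublin_Zge p t x : sublin p -> 0 <= t -> t * p x <= p (t%:C *: x).
Proof.
move=> sp; rewrite le_eqVlt => /orP[/eqP <-|t0]; first by rewrite scale0r mul0r sublin0.
have [_ pZ] := sp; have := pZ t^-1 (t%:C *: x); rewrite invr_gt0 => /(_ t0).
rewrite scalerA -rmorphM mulVf ?gt_eqF // scale1r => h.
by rewrite -ler_pdivlMl.
Qed.

Lemma tilt_lb p y x : sublin p ->
  lbound [set p (x + t%:C *: y) - t * p y | t in [set t | 0 <= t]] (- p (- x)).
Proof.
move=> sp _ [t /= t0 <-]; have h := sublin_Zge y sp t0; have [pD _] := sp.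
have := pD (x + t%:C *: y) (- x); rewrite addrC addKr; lra.
Qed.

Lemma tilt_le p y x t : sublin p -> 0 <= t -> tilt p y x <= p (x + t%:C *: y) - t * p y.
Proof.
by move=> sp t0; apply: ge_inf; [exists (- p (- x)); exact: tilt_lb | exists t].
Qed.

Lemma le_tilt p y x b : (forall t, 0 <= t -> b <= p (x + t%:C *: y) - t * p y) -> b <= tilt p y x.
Proof.
move=> h; apply: lb_le_inf; first by exists (p (x + 0%:C *: y) - 0 * p y), 0 => /=.
by move=> _ [t /= t0 <-]; exact: h.
Qed.

Lemma tilt_sublin p y : sublin p -> sublin (tilt p y).
Proof.
move=> sp; have [pD pZ] := sp; split=> [x x'|t x t0].
  rewrite -lerBlDr; apply: le_tilt => s s0; rewrite lerBlDr -lerBlDl; apply: le_tilt => t t0.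
  rewrite lerBlDl; apply: le_trans (tilt_le y _ sp (addr_ge0 s0 t0)) _.
  rewrite rmorphD /= scalerDl addrACA; have := pD (x + s%:C *: y) (x' + t%:C *: y); lra.
rewrite -ler_pdivrMl //; apply: le_tilt => s s0; rewrite ler_pdivrMl //.
apply: le_trans (tilt_le y _ sp (mulr_ge0 (ltW t0) s0)) _.
rewrite rmorphM /= -scalerA -scalerDr; have := pZ t (x + s%:C *: y) t0; lra.
Qed.

Lemma tilt_self p y : sublin p -> tilt p y (- y) <= - p y.
Proof.
move=> sp; have := @tilt_le p y (- y) 1 sp ler01.
by rewrite scale1r addNr sublin0 // mul1r sub0r.
Qed.

Lemma tilt_below p y x : sublin p -> tilt p y x <= p x.
Proof. by move=> sp; have := @tilt_le p y x 0 sp (lexx 0); rewrite scale0r addr0 mul0r subr0. Qed.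

Lemma sublin_minimal p0 : sublin p0 -> exists g, [/\ sublin g, forall x, g x <= p0 x &
  forall q, sublin q -> (forall x, q x <= g x) -> forall x, g x <= q x].
Proof.
move=> sp0.
pose D := {p : X -> R | sublin p /\ forall x, p x <= p0 x}.
pose Rel (p q : D) := `[< forall x, sval q x <= sval p x >].
have [||||g gmin] := @Zorn D Rel.
- by move=> p; apply/asboolP.
- by move=> p q r /asboolP h1 /asboolP h2; apply/asboolP => x; apply: le_trans (h2 x) (h1 x).
- move=> [p hp] [q hq] /asboolP /= h1 /asboolP /= h2.
  have e : p = q by apply/funext => x; apply/eqP; rewrite eq_le h1 h2.
  by subst q; congr exist; exact: Prop_irrelevance.
- move=> A Atot; have [[a Aa]|A0] := pselect (exists a, A a); last first.
    by exists (exist _ p0 (conj sp0 (fun x => lexx _))) => s As; case: A0; exists s.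
  pose S x := [set sval p x | p in A].
  have lbS x : lbound (S x) (- p0 (- x)).
    move=> _ [p _ <-]; have [sp le] := svalP p.
    by apply: le_trans (sublinN x sp); rewrite lerN2.
  pose q x := inf (S x).
  have qle p x : A p -> q x <= sval p x.
    by move=> Ap; apply: ge_inf; [exists (- p0 (- x)); exact: lbS | exists p].
  have leq x b : (forall p, A p -> b <= sval p x) -> b <= q x.
    move=> h; apply: lb_le_inf; first by exists (sval a x), a.
    by move=> _ [p Ap <-]; exact: h.
  have sq : sublin q.
    split=> [x y|t x t0].
      rewrite -lerBlDr; apply: (leq) => p Ap; rewrite lerBlDr -lerBlDl; apply: (leq) => p' Ap'.
      rewrite lerBlDl.
      have [/asboolP h|/asboolP h] := Atot _ _ Ap Ap'.
        have [[pD _] _] := svalP p'; apply: le_trans (qle _ _ Ap') _.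
        by apply: le_trans (pD _ _) _; rewrite lerD2r.
      have [[pD _] _] := svalP p; apply: le_trans (qle _ _ Ap) _.
      by apply: le_trans (pD _ _) _; rewrite lerD2l.
    rewrite -ler_pdivrMl //; apply: (leq) => p Ap; rewrite ler_pdivrMl //.
    by have [[_ pZ] _] := svalP p; apply: le_trans (qle _ _ Ap) (pZ _ _ t0).
  have qp x : q x <= p0 x by have [_ h] := svalP a; apply: le_trans (qle _ _ Aa) (h x).
  by exists (exist _ q (conj sq qp)) => s As; apply/asboolP => x; exact: qle.
have [sg gp] := svalP g; exists (sval g); split => // q sq qg x.
have qp y : q y <= p0 y := le_trans (qg y) (gp y).
have := gmin (exist _ q (conj sq qp)) _.
by move=> <-; [exact: lexx | apply/asboolP].
Qed.

(** Take a minimal sublinear functional below the norm tilted at [v]: the tilt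
    forces its value at [-v] down to [- nrm v].  Real linearity suffices, as the
    imaginary direction is recovered by applying [f] to i times a vector. *)
Theorem hahn_banach (v : X) : exists f : X -> R,
  [/\ forall x y, f (x + y) = f x + f y, forall t x, f (t%:C *: x) = t * f x,
      forall x, `|f x| <= nrm x & f v = nrm v].
Proof.
have sn : sublin (fun x => nrm x).
  split=> [x y|t x t0]; first exact: nrmD.
  by rewrite nrmZ nrmR ger0_norm // ltW.
have [f [sf fle fmin]] := sublin_minimal (tilt_sublin v sn).
have fN y : f (- y) <= - f y.
  apply: le_trans (fmin _ (tilt_sublin y sf) _ _) (tilt_self y sf) => x.
  exact: tilt_below.
have fNE y : f (- y) = - f y.
  by apply/eqP; rewrite eq_le fN /=; have := sublinN (- y) sf; rewrite opprK.
have fn x : f x <= nrm x by apply: le_trans (fle x) (tilt_below v x sn).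
have fZ t x : 0 <= t -> f (t%:C *: x) = t * f x.
  by move=> t0; apply/eqP; rewrite eq_le sublin_ge0Z // sublin_Zge.
exists f; split.
- move=> x y; have [fD _] := sf; apply/eqP; rewrite eq_le fD /=.
  by have := fD (x + y) (- y); rewrite addrK fNE; lra.
- move=> t x; have [t0|t0] := leP 0 t; first exact: fZ.
  rewrite -[t in LHS]opprK rmorphN scaleNr fNE fZ; last by rewrite oppr_ge0 ltW.
  by rewrite mulNr opprK.
- move=> x; rewrite ler_norml fn andbT lerNl -fNE -(nrmN x); exact: fn.
- apply/eqP; rewrite eq_le fn /= -lerN2 -fNE.
  exact: le_trans (fle _) (tilt_self v sn).
Qed.

End HahnBanach.

(** * Counting arguments *)

Section Counting.
Variable R : realType.

(** A time N fails because of a spike at N - k.  The last element n of [S] before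
    the spike controls the growth from n to N - k by (1 + e)^(N-k-n), and since
    (1 + e)^q <= tau the spike can only be reached if N - k - n > q k.  So the at
    most k failures after the spike are paid for by a gap of [S] that is q times
    longer. *)
Lemma pliss (S : nat -> Prop) (v : nat -> R) (e tau B B' : R) (q : nat) :
  0 < e -> (0 < q)%N -> (1 + e) ^+ q <= tau -> 0 < B' -> B' <= B ->
  (forall n k, S n -> v (n + k)%N <= B' * (1 + e) ^+ k) ->
  (forall b, (forall n, (n <= b)%N -> ~ S n) -> v b <= B) ->
  forall N, (q * \sum_(0 <= n < N) `[< S n /\ exists2 k, (k <= n)%N & (B * tau ^+ k < v (n - k)%N)%R >] <= N)%N.
Proof.
move=> e0 q0 etau B'0 B'B fwd init.
pose fail := fun n => `[< S n /\ exists2 k, (k <= n)%N & (B * tau ^+ k < v (n - k)%N)%R >].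
have B0 : 0 < B by apply: lt_le_trans B'B.
have tau0 : 0 < tau by apply: lt_le_trans etau; rewrite exprn_gt0 // addr_gt0.
have e1 : 1 <= 1 + e by rewrite lerDl ltW.
suff key N : (q * \sum_(0 <= n < N) fail n <= N)%N by exact: key.
elim/ltn_ind: N => -[|N] IH; first by rewrite big_geq // muln0.
rewrite big_nat_recr //=; case fN : (fail N); last first.
  by rewrite addn0; apply: leq_trans (IH N _) _.
have /asboolP[SN [k kN hk]] := fN.
have tk1 : 1 <= tau ^+ k by rewrite exprn_ege1 // (le_trans _ etau) // exprn_ege1.
have [n [nb Sn last_n]] : exists n, [/\ (n <= N - k)%N, S n & forall n', (n < n' <= N - k)%N -> ~ S n'].
  have exS : exists n, `[< S n >] && (n <= N - k)%N.
    apply: contrapT => nS.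
    suff : v (N - k)%N <= B by rewrite leNgt (le_lt_trans _ hk) // ler_peMr // ltW.
    apply: init => n nb Sn; apply: nS; exists n; rewrite nb andbT; exact/asboolP.
  have bnd n : `[< S n >] && (n <= N - k)%N -> (n <= N - k)%N by move=> /andP[].
  case: (ex_maxnP exS bnd) => n /andP[/asboolP Sn nb] nmax.
  exists n; split => // n' /andP[nn' n'b] Sn'.
  have := nmax n'; rewrite n'b andbT leqNgt nn' => h.
  by have := h (asboolT Sn').
(* A gap of length at most q k would let the forward bound exclude the spike. *)
have gap : (q * k < N - k - n)%N.
  rewrite ltnNge; apply/negP => h.
  have h1 := fwd n (N - k - n)%N Sn; rewrite subnKC // in h1.
  have h2 : (1 + e) ^+ (N - k - n) <= tau ^+ k.
    apply: le_trans (ler_weXn2l e1 h) _.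
    by rewrite exprM lerXn2r ?nnegrE ?exprn_ge0 ?(ltW tau0) // addr_ge0 // ltW.
  have : v (N - k)%N <= B * tau ^+ k.
    apply: le_trans h1 _; apply: ler_pM => //; first exact: ltW.
    by rewrite exprn_ge0 // addr_ge0 // ltW.
  by rewrite leNgt hk.
have k0 : (0 < k)%N.
  rewrite lt0n; apply/eqP => k0; rewrite k0 subn0 muln0 in gap last_n.
  by apply: (last_n N _ SN); rewrite leqnn andbT -subn_gt0.
have a1 : (n.+1 <= (N - k).+1)%N by rewrite ltnS.
have a2 : ((N - k).+1 <= N)%N by clear -k0 kN; lia.
have a3 : (n.+1 <= N)%N by apply: leq_trans a2.
have a4 : (N - (N - k).+1 + 1 = k)%N by clear -k0 kN; lia.
have split_sum : (\sum_(0 <= i < N) fail i + 1 <= \sum_(0 <= i < n.+1) fail i + k)%N.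
  rewrite (@big_cat_nat _ _ _ n.+1 0 N) //=.
  rewrite -addnA leq_add2l (@big_cat_nat _ _ _ (N - k).+1 n.+1 N) //=.
  rewrite (@big_nat_cond _ _ _ n.+1) big1 ?add0n.
    apply: (@leq_trans (\sum_((N - k).+1 <= i < N) 1 + 1)).
      by rewrite leq_add2r; apply: leq_sum => i _; case: (fail i).
    by rewrite sum_nat_const_nat muln1 a4.
  move=> i; rewrite andbT => hi; case E : (fail i) => //.
  have hi' : (n < i <= N - k)%N by rewrite -[(i <= _)%N]ltnS.
  by move/asboolP: E => [Si _]; case: (last_n i hi' Si).
have IHn : (q * \sum_(0 <= i < n.+1) fail i <= n.+1)%N by apply: IH; rewrite ltnS.
have := leq_mul (leqnn q) split_sum; rewrite !mulnDr.
move: IHn gap kN; clear; move: (\sum_(0 <= i < N) _)%N (\sum_(0 <= i < n.+1) _)%N => s t.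
rewrite muln1; move: (q * s)%N (q * t)%N (q * k)%N => a b c; lia.
Qed.

(** A sign change between consecutive integers. *)
Definition chg (p : {poly R}) (n : nat) := (0 <= p.[n%:R]) != (0 <= p.[n.+1%:R]).

Lemma poly_ivl (p : {poly R}) n : p.[n%:R] < 0 -> 0 <= p.[n.+1%:R] ->
  exists2 x, n%:R < x <= n.+1%:R & root p x.
Proof.
move=> h1 h2.
have [||x /andP[x1 x2] rx] := @poly_ivt R p n%:R n.+1%:R; first by rewrite ler_nat.
  by rewrite h2 ltW.
exists x => //; rewrite x2 andbT lt_neqAle x1 andbT; apply/eqP => e.
by move: rx h1; rewrite -e rootE => /eqP ->; rewrite ltxx.
Qed.

(** Each upward change has its own root in (n, n+1]. *)
Lemma count_up (p : {poly R}) N : p != 0 ->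
  (\sum_(0 <= n < N) ((p.[n%:R] < 0)%R && (0 <= p.[n.+1%:R])%R) < size p)%N.
Proof.
move=> p0; pose up n := (p.[n%:R] < 0) && (0 <= p.[n.+1%:R]).
pose f n := if pselect (exists2 x : R, n%:R < x <= n.+1%:R & root p x) is left e then s2val (cid2 e) else 0.
have fP n : up n -> n%:R < f n <= n.+1%:R /\ root p (f n).
  move=> /andP[h1 h2]; rewrite /f; case: pselect => [e|[]]; last exact: poly_ivl.
  by case: (cid2 e).
pose s := [seq f n | n <- iota 0 N & up n].
have us : uniq s.
  rewrite map_inj_in_uniq ?filter_uniq ?iota_uniq // => n n'.
  rewrite !mem_filter => /andP[/fP[/andP[a1 a2] _] _] /andP[/fP[/andP[b1 b2] _] _] e.
  rewrite e in a1 a2; apply/eqP; rewrite eqn_leq; apply/andP; split.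
    by rewrite -ltnS -(ltr_nat R) (lt_le_trans a1 b2).
  by rewrite -ltnS -(ltr_nat R) (lt_le_trans b1 a2).
have := max_poly_roots p0 _ us; rewrite size_map size_filter => h.
have -> : (\sum_(0 <= n < N) up n = count up (iota 0 N))%N.
  by rewrite -sum1_count [RHS]big_mkcond /index_iota subn0; apply: eq_bigr => i _; case: (up i).
by apply: h; apply/allP => y /mapP[n]; rewrite mem_filter => /andP[/fP[_ r] _] ->.
Qed.

(** Downward changes are the upward changes of the polynomial p(N - X). *)
Lemma sign_changes (p : {poly R}) D N : (size p <= D.+1)%N ->
  (\sum_(0 <= n < N) chg p n <= 2 * D)%N.
Proof.
move=> sp; have [->|p0] := eqVneq p 0.
  by rewrite big1 // => n _; rewrite /chg !horner0 lexx.
pose r := p \Po (N%:R%:P - 'X).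
have s2 : size (N%:R%:P - 'X : {poly R}) = 2%N.
  by rewrite addrC size_polyDl size_polyN size_polyX // (leq_ltn_trans (size_polyC_leq1 _)).
have sr : size r = size p by rewrite size_comp_poly2.
have r0 : r != 0 by rewrite -size_poly_eq0 sr size_poly_eq0.
have ev j : (j <= N)%N -> r.[j%:R] = p.[(N - j)%:R].
  by move=> jN; rewrite /r horner_comp hornerD hornerN hornerX hornerC natrB.
have dn : (\sum_(0 <= n < N) ((0 <= p.[n%:R])%R && (p.[n.+1%:R] < 0)%R) < size p)%N.
  rewrite -sr big_nat_rev /= add0n; apply: leq_ltn_trans (count_up N r0).
  rewrite !big_mkord; apply: leq_sum => i _.
  by rewrite (ev i) ?(ev i.+1) ?(ltnW (ltn_ord i)) // subnSK // andbC.
have up := count_up N p0.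
apply: (@leq_trans (\sum_(0 <= n < N) ((p.[n%:R] < 0)%R && (0 <= p.[n.+1%:R])%R) +
   \sum_(0 <= n < N) ((0 <= p.[n%:R])%R && (p.[n.+1%:R] < 0)%R))); last by lia.
rewrite -big_split /=; apply: leq_sum => n _; rewrite /chg !ltNge.
by case: (0 <= _); case: (0 <= _).
Qed.

(** The polynomial X (X - 1) ... (X - k + 1) / k!, which interpolates the binomial
    coefficients. *)
Fixpoint binpoly (k : nat) : {poly R} :=
  if k is k'.+1 then (k'.+1%:R)^-1 *: (binpoly k' * ('X - k'%:R%:P)) else 1.

Lemma binpolyE k n : (binpoly k).[n%:R] = ('C(n, k))%:R.
Proof.
elim: k => [|k IH] /=; first by rewrite hornerC bin0.
rewrite hornerZ hornerM hornerXsubC IH; apply: (@mulfI _ k.+1%:R); first by rewrite pnatr_eq0.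
rewrite mulrA mulfV ?pnatr_eq0 // mul1r -natrM mul_bin_left.
have [kn|nk] := leqP k n; first by rewrite -natrB // -natrM mulnC.
by rewrite bin_small // mul0r muln0.
Qed.

Lemma size_binpoly k : (size (binpoly k) <= k.+1)%N.
Proof.
elim: k => [|k IH] /=; first exact: size_polyC_leq1.
apply: leq_trans (size_scale_leq _ _) _; apply: leq_trans (size_polyMleq _ _) _.
by rewrite size_XsubC; lia.
Qed.

Lemma binomial_poly (b : nat -> R) D : exists2 p : {poly R}, (size p <= D.+1)%N &
  forall n : nat, p.[n%:R] = \sum_(0 <= k < D.+1) ('C(n, k))%:R * b k.
Proof.
exists (\sum_(0 <= k < D.+1) b k *: binpoly k).
  rewrite big_mkord; apply: leq_trans (size_sum _ _ _) _; apply/bigmax_leqP => k _.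
  apply: leq_trans (size_scale_leq _ _) _; apply: leq_trans (size_binpoly _) _.
  exact: ltn_ord.
by move=> n; rewrite horner_sum; apply: eq_bigr => k _; rewrite hornerZ binpolyE mulrC.
Qed.

End Counting.

(** * Splitting of the projected orbit *)

Section Splitting.
Variables (R : realType) (X : completeNormedModType R[i]).
Notation C := R[i].

(** The interface between spectral theory and dynamics: every later argument uses
    the operators [P] and [piece] only through these estimates. *)
Theorem spectral_split (T : X -> X) (K F : C -> Prop) (L : seq C) : blin T ->
  (forall z, ~ in_resolvent T z <-> K z \/ F z) -> (forall z, K z -> nrm z <= 1) ->
  closed_pts K -> closed_pts F -> (forall z, K z -> ~ F z) -> (exists z, K z) ->
  uniq L -> (forall l, l \in L -> nrm l = 1) ->
  (forall z, K z -> nrm z = 1 -> z \in L) ->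
  exists (P : X -> X) (piece : C -> nat -> X -> X) (rho M : R),
  [/\ blin P, forall x, P (T x) = T (P x), exists x, P (P x) != 0, 0 < rho < 1 & 0 < M] /\
  [/\ forall e, 0 < e -> exists2 B, 0 < B &
        forall k v, nrm (iter k T (P v)) <= B * (1 + e) ^+ k * nrm v,
      forall n v, nrm (iter n T (P v) - \sum_(l <- L) piece l n v) <= M * rho ^+ n * nrm v,
      forall l, l \in L -> forall n v, nrm (piece l n v) <=
        M * (nrm (iter n T v) + \sum_(0 <= k < n) rho ^+ k * nrm (iter (n - k.+1) T v))
    & forall eta, 0 < eta -> exists (rho1 B : R) (c : C -> nat -> X -> X),
      [/\ 0 < rho1 < 1, 0 < B & forall l, l \in L -> forall v,
        (forall k, nrm (c l k v) <= B * eta ^+ k * nrm v) /\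
        forall n, nrm (piece l n v - l ^+ n *: \sum_(0 <= k < n.+1) ('C(n, k))%:R *: c l k v)
          <= B * rho1 ^+ n * nrm v]].
Proof.
move=> bT KFs K1 cK cF KF Kne uL L1 KL.
have [ o Ko omax] := K_extreme K1 cK Kne.
have o1 := K1 o Ko.
have acc e : 0 < e -> exists2 z, nrm (z - o) < e & in_resolvent T z.
  move=> e0; have [N N0 hN] := cF o (KF o Ko).
  pose t := Num.min (e / 2) (2 * N)^-1.
  have t0 : 0 < t by rewrite lt_min divr_gt0 // invr_gt0 mulr_gt0.
  have te : t <= e / 2 by rewrite ge_min lexx.
  have tN : t <= (2 * N)^-1 by rewrite ge_min lexx orbT.
  have ot : o + t%:C - o = t%:C by rewrite addrC addKr.
  exists (o + t%:C); first by rewrite ot nrm_h //; lra.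
  apply: contrapT => /KFs[Kz|]; last first.
    apply: hN; rewrite ot nrm_h //.
    have : N * t <= N * (2 * N)^-1 by rewrite ler_pM2l.
    have -> : N * (2 * N)^-1 = 1 / 2 by field; rewrite gt_eqF.
    lra.
  have := omax _ Kz; rewrite raddfD /=; lra.
have [r0 r01 sep] := separation L.
have [rho [chi [rho01 hc supp]]] := cut_family K1 cK cF KF L1 KL r01.
have [M1 M10 hM1] := pieces_sum bT KFs o1 r01 sep rho01 hc supp uL.
have amp := @piece_amp _ _ T bT K F KFs o o1 L r0 rho chi r01 sep rho01 hc supp.
have [M2 M20 hM2] : exists2 M, 0 < M & forall l, l \in L -> forall n v,
   nrm (piece T o chi r0 l n v) <=
    M * (nrm (iter n T v) + \sum_(0 <= k < n) rho ^+ k * nrm (iter (n - k.+1) T v)).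
  apply: (@seq_unif _ (fun l M => forall n v, nrm (piece T o chi r0 l n v) <=
    M * (nrm (iter n T v) + \sum_(0 <= k < n) rho ^+ k * nrm (iter (n - k.+1) T v)))) => //.
  move=> l A A' AA' h n v; apply: le_trans (h n v) _; rewrite ler_wpM2r //.
  rewrite addr_ge0 ?nrm_ge0 // sumr_ge0 // => k _.
  by rewrite mulr_ge0 ?nrm_ge0 ?exprn_ge0 //; case/andP: rho01 => /ltW.
exists (resolvent_int T o (sd chi)), (piece T o chi r0), rho, (M1 + M2); split.
  split => //.
  - by apply: (@J_blin _ _ _ bT o); (apply: weight_cutoff KFs _ hc).
  - by move=> x; apply: (@J_comm _ _ T bT o T) => //; (apply: weight_cutoff KFs _ hc).
  - exact: (@projection_sq_neq0 _ _ T bT K F KFs o o1 chi hc Ko acc).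
  - exact: addr_gt0.
split.
- exact: (projection_growth bT KFs K1 cK cF KF o1 L1 KL hc).
- move=> n v; apply: le_trans (hM1 n v) _.
  rewrite -!mulrA ler_wpM2r ?mulr_ge0 ?nrm_ge0 ?exprn_ge0 //; first by case/andP: rho01 => /ltW.
  by rewrite lerDl ltW.
- move=> l lL n v; apply: le_trans (hM2 l lL n v) _; rewrite ler_wpM2r //; last by rewrite lerDr ltW.
  rewrite addr_ge0 ?nrm_ge0 // sumr_ge0 // => k _.
  by rewrite mulr_ge0 ?nrm_ge0 ?exprn_ge0 //; case/andP: rho01 => /ltW.
move=> eta eta0.
have [rho1 [rho11 [c hc']]] := piece_poly bT KFs K1 cK cF KF o1 L1 KL r01 sep rho01 hc supp eta0.
pose Q l B := forall v, (forall k, nrm (c l k v) <= B * eta ^+ k * nrm v) /\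
        forall n, nrm (piece T o chi r0 l n v - l ^+ n *: \sum_(0 <= k < n.+1) ('C(n, k))%:R *: c l k v)
          <= B * rho1 ^+ n * nrm v.
have [B B0 hB] : exists2 B, 0 < B & forall l, l \in L -> Q l B.
  apply: (@seq_unif _ Q) => // l A A' AA' h v; have [h1 h2] := h v; split=> [k|n].
    apply: le_trans (h1 k) _; rewrite -!mulrA ler_wpM2r ?mulr_ge0 ?nrm_ge0 ?exprn_ge0 //.
    exact: ltW.
  apply: le_trans (h2 n) _; rewrite -!mulrA ler_wpM2r ?mulr_ge0 ?nrm_ge0 ?exprn_ge0 //.
  by case/andP: rho11 => /ltW.
by exists rho1, B, c.
Qed.

End Splitting.

(** * Linear recurrences with slowly varying amplitudes *)

Section Recurrence.
Variables (R : realType) (X : completeNormedModType R[i]).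
Notation C := R[i].

(** The value [u n] lies between two consecutive levels; as long as neither is
    crossed, [u] stays between them.  The bound on [Lv] ensures that the upper
    one is among the levels considered. *)
Lemma levels (u : nat -> R) (A kappa : R) (Lv m n : nat) : 0 < kappa -> `|u n| <= A ->
  2 * A + 2 * kappa <= Lv%:R * kappa ->
  (forall l i, (l <= Lv)%N -> (i < m)%N ->
    (0 <= u (n + i)%N - (l%:R * kappa - A)) = (0 <= u (n + i).+1 - (l%:R * kappa - A))) ->
  forall k, (k <= m)%N -> `|u (n + k)%N - u n| <= kappa.
Proof.
move=> k0; rewrite ler_norml => /andP[u1 u2] hLv same k km.
have q0 : 0 <= (u n + A) / kappa by rewrite divr_ge0 ?(ltW k0) //; lra.
have /andP[] := truncn_itv q0; set l := Num.truncn _.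
rewrite ler_pdivlMr // ltr_pdivrMr // => l1 l2.
have lLv : (l.+1 <= Lv)%N.
  rewrite -(ler_nat R) -(ler_pM2r k0); apply: le_trans hLv.
  rewrite -natr1 mulrDl mul1r; lra.
have const j : (j <= Lv)%N -> forall i, (i <= m)%N ->
    (0 <= u (n + i)%N - (j%:R * kappa - A)) = (0 <= u n - (j%:R * kappa - A)).
  move=> jL; elim=> [|i IH] im; first by rewrite addn0.
  by rewrite addnS -same // IH // ltnW.
have := const l (ltnW lLv) k km; have := const l.+1 lLv k km.
have -> : 0 <= u n - (l%:R * kappa - A) by lra.
have -> : (0 <= u n - (l.+1%:R * kappa - A)) = false by apply/negbTE; rewrite -ltNge; lra.
move/negbT; rewrite -ltNge => h1 h2; move: h1 h2 l2; rewrite -natr1 mulrDl mul1r => h1 h2 l2.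
by rewrite ler_norml; apply/andP; split; lra.
Qed.

Variable T : X -> X.
Hypothesis bT : blin T.

Definition prodT (s : seq C) (v : X) : X := foldr (fun l w => T w - l *: w) v s.

Lemma prodT_blin s : blin (prodT s).
Proof.
elim: s => [|l s IH]; first exact: blin_id.
have h : blin (fun v => T (prodT s v) + - l *: prodT s v).
  by apply: blinD; [exact: blin_comp | exact: blinZ].
by move: h; rewrite /prodT /=; under [X in blin X -> _]eq_fun do rewrite scaleNr.
Qed.

Lemma prodT_comm s (A : X -> X) v : blin A -> (forall y, A (T y) = T (A y)) ->
  prodT s (A v) = A (prodT s v).
Proof.
move=> bA AT; have [_ AZ _] := bA; elim: s => //= l s IH.
by rewrite (blinB _ _ bA) AT AZ IH.
Qed.

(** Multiply [W] by the factors T - l one after the other; if the product becomes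
    0, the last nonzero one is an eigen-operator. *)
Lemma eigen_or_nonzero s (W : X -> X) : blin W -> (forall y, W (T y) = T (W y)) ->
  (exists x, W x != 0) ->
  (exists x, prodT s (W x) != 0) \/
  exists2 l, l \in s & exists V : X -> X, [/\ blin V, forall y, V (T y) = T (V y),
     exists x, V x != 0 & forall x, T (V x) = l *: V x].
Proof.
move=> bW WT W0; elim: s => [|l s IH]; first by left.
have [[x hx]|[l' l's hV]] := IH; last by right; exists l' => //; rewrite inE l's orbT.
have [h|h] := pselect (exists x, prodT (l :: s) (W x) != 0); first by left.
right; exists l; first exact: mem_head.
exists (fun x => prodT s (W x)); split.
- by apply: blin_comp => //; exact: prodT_blin.
- by move=> y; rewrite WT prodT_comm.
- by exists x.
- move=> y; apply/eqP; rewrite -subr_eq0; apply/negPn/negP => hy.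
  by apply: h; exists y.
Qed.

Definition pol (s : seq C) : {poly C} := \prod_(l <- s) ('X - l%:P).

Lemma prodTE s v : prodT s v = \sum_(0 <= k < (size s).+1) (pol s)`_k *: iter k T v.
Proof.
rewrite /pol; elim: s => [|l s IH] /=.
  by rewrite big_nat1 big_nil coef1 scale1r.
rewrite big_cons IH; set p := \prod_(j <- s) _.
have sp : size p = (size s).+1 by rewrite size_prod_XsubC.
rewrite (blin_sum _ _ _ bT) scaler_sumr.
have e1 : \sum_(0 <= k < (size s).+1) T (p`_k *: iter k T v) =
    \sum_(0 <= k < (size s).+2) ('X * p)`_k *: iter k T v.
  rewrite [RHS]big_nat_recl // coefXM /= scale0r add0r; apply: eq_bigr => k _.
  by rewrite coefXM /=; case: bT => _ -> _.
have e2 : \sum_(0 <= k < (size s).+1) l *: (p`_k *: iter k T v) =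
    \sum_(0 <= k < (size s).+2) (l%:P * p)`_k *: iter k T v.
  rewrite [RHS]big_nat_recr //= coefCM [p`_(_.+1)]nth_default ?sp // mulr0 scale0r addr0.
  by apply: eq_bigr => k _; rewrite coefCM scalerA.
rewrite e1 e2 -sumrB; apply: eq_bigr => k _.
by rewrite mulrBl coefB scalerBl.
Qed.

Lemma pol_root s l n : l \in s -> \sum_(0 <= k < (size s).+1) (pol s)`_k * l ^+ (n + k) = 0.
Proof.
move=> ls; have : (pol s).[l] = 0.
  by apply/eqP; rewrite -/(root _ _) /pol root_prod_XsubC.
rewrite horner_coef /pol size_prod_XsubC big_mkord => h.
transitivity (l ^+ n * \sum_(k < (size s).+1) (\prod_(j <- s) ('X - j%:P))`_k * l ^+ k).
  rewrite mulr_sumr; apply: eq_bigr => k _.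
  by rewrite exprD mulrCA.
by rewrite h mulr0.
Qed.

Variable f : X -> R.
Hypothesis fD : forall x y, f (x + y) = f x + f y.
Hypothesis fZ : forall t x, f (t%:C *: x) = t * f x.
Hypothesis f1 : forall x, `|f x| <= nrm x.

Lemma f0 : f 0 = 0. Proof. by have := fZ 0 0; rewrite scale0r mul0r. Qed.

(** [f] is linear over the reals only, so a complex scalar needs a bound on both
    [f v] and the value of [f] at i times [v]. *)
Lemma f_scale (a : C) v kappa : `|f v| <= kappa -> `|f ('i *: v)| <= kappa ->
  `|f (a *: v)| <= nrm a * (2 * kappa).
Proof.
move=> h1 h2; have -> : a = (complex.Re a)%:C + (complex.Im a)%:C * 'i.
  by rewrite {1}[a]complexE mulrC.
rewrite scalerDl -scalerA fD !fZ; apply: le_trans (ler_normD _ _) _; rewrite !normrM.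
have a1 := Re_le a; have a2 := Im_le a.
have e : nrm ((complex.Re a)%:C + (complex.Im a)%:C * 'i) = nrm a.
  by congr nrm; rewrite {3}[a]complexE mulrC.
rewrite e; have -> : nrm a * (2 * kappa) = nrm a * kappa + nrm a * kappa by ring.
by apply: lerD; apply: ler_pM.
Qed.

(** If the amplitudes [Q l] were constant on [n, n + size s], the sum would be
    sum_l l^n p(l) Q l n = 0; the three errors measure the distance to that
    situation, the last one only along [f]. *)
Lemma recurrence_small (s : seq C) (G : nat -> X) (Fr Q : C -> nat -> X) n (e1 e2 kappa : R) :
  (forall l, l \in s -> nrm l = 1) ->
  (forall k, (k <= size s)%N -> nrm (G (n + k)%N - \sum_(l <- s) Fr l (n + k)%N) <= e1) ->
  (forall l k, l \in s -> (k <= size s)%N ->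
     nrm (Fr l (n + k)%N - l ^+ (n + k) *: Q l (n + k)%N) <= e2) ->
  (forall l k, l \in s -> (k <= size s)%N -> `|f (Q l (n + k)%N - Q l n)| <= kappa) ->
  (forall l k, l \in s -> (k <= size s)%N -> `|f ('i *: (Q l (n + k)%N - Q l n))| <= kappa) ->
  `|f (\sum_(0 <= k < (size s).+1) (pol s)`_k *: G (n + k)%N)| <=
  (\sum_(0 <= k < (size s).+1) nrm (pol s)`_k) * (e1 + (size s)%:R * (e2 + 2 * kappa)).
Proof.
move=> s1 h1 h2 h3 h4.
have -> : \sum_(0 <= k < (size s).+1) (pol s)`_k *: G (n + k)%N =
  \sum_(0 <= k < (size s).+1) (pol s)`_k *: ((G (n + k)%N - \sum_(l <- s) Fr l (n + k)%N) +
    \sum_(l <- s) ((Fr l (n + k)%N - l ^+ (n + k) *: Q l (n + k)%N)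
       + l ^+ (n + k) *: (Q l (n + k)%N - Q l n))).
  apply/eqP; rewrite -subr_eq0 -sumrB; apply/eqP.
  transitivity (\sum_(0 <= k < (size s).+1) \sum_(l <- s) ((pol s)`_k * l ^+ (n + k)) *: Q l n).
    apply: eq_bigr => k _; rewrite -scalerBr.
    under [RHS]eq_bigr do rewrite -scalerA.
    rewrite -scaler_sumr; congr (_ *: _).
    have -> : \sum_(l <- s) (Fr l (n + k)%N - l ^+ (n + k) *: Q l (n + k)%N +
        l ^+ (n + k) *: (Q l (n + k)%N - Q l n)) =
        \sum_(l <- s) Fr l (n + k)%N - \sum_(l <- s) l ^+ (n + k) *: Q l n.
      by rewrite -sumrB; apply: eq_bigr => l _; rewrite scalerBr addrA subrK.
    by rewrite addrA subrK opprB addrC subrK.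
  rewrite exchange_big /= big1_seq // => l /andP[_ ls].
  by rewrite -scaler_suml pol_root // scale0r.
have fsum (I : eqType) (r : seq I) (H : I -> X) (b : I -> R) : (forall i, i \in r -> `|f (H i)| <= b i) ->
    `|f (\sum_(i <- r) H i)| <= \sum_(i <- r) b i.
  move=> hb; rewrite (big_morph f fD f0); apply: le_trans (ler_norm_sum _ _ _) _.
  by rewrite big_seq [X in _ <= X]big_seq; apply: ler_sum => i; exact: hb.
rewrite mulr_suml; apply: (fsum) => k; rewrite mem_index_iota ltnS => /= ks.
rewrite scalerDr scaler_sumr fD; apply: le_trans (ler_normD _ _) _; rewrite mulrDr; apply: lerD.
  apply: le_trans (f1 _) _; rewrite nrmZ ler_wpM2l ?nrm_ge0 //; exact: h1.
have -> : nrm (pol s)`_k * ((size s)%:R * (e2 + 2 * kappa)) =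
    \sum_(l <- s) nrm (pol s)`_k * (e2 + 2 * kappa).
  by rewrite big_const_seq count_predT iter_addr_0 -[RHS]mulr_natl [LHS]mulrCA.
apply: (fsum) => l ls; rewrite scalerDr fD; apply: le_trans (ler_normD _ _) _; rewrite mulrDr; apply: lerD.
  apply: le_trans (f1 _) _; rewrite nrmZ ler_wpM2l ?nrm_ge0 //; exact: h2.
rewrite scalerA; apply: le_trans (f_scale _ (h3 l k ls ks) (h4 l k ls ks)) _.
by rewrite nrmM nrmX (s1 l ls) expr1n mulr1.
Qed.

End Recurrence.

(** * Elementary estimates *)

Section Estimates.
Variable R : realType.
Notation C := R[i].

Lemma geom_small (r B e : R) : 0 <= r < 1 -> 0 < e -> exists N, forall n, (N <= n)%N -> B * r ^+ n <= e.
Proof.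
move=> /andP[r0 r1] e0.
have h : (fun n => B * r ^+ n) @ \oo --> (B * 0 : R).
  by apply: cvgMr; apply: cvg_expr; rewrite ger0_norm.
have e0' : 0 < e by [].
move/cvgrPdist_lt : h => /(_ e e0')[N _ hN].
exists N => n /hN /=; rewrite mulr0 sub0r normrN => h.
by apply: le_trans (ltW h); exact: ler_norm.
Qed.

Lemma geom_sum (s : R) n : 0 <= s < 1 -> \sum_(0 <= k < n) s ^+ k <= (1 - s)^-1.
Proof.
move=> /andP[s0 s1]; have s1' : 0 < 1 - s by rewrite subr_gt0.
suff -> : \sum_(0 <= k < n) s ^+ k = (1 - s ^+ n) / (1 - s).
  rewrite ler_pdivrMr // mulVf ?gt_eqF //.
  by rewrite gerBl exprn_ge0.
elim: n => [|n IH]; first by rewrite big_geq // subrr mul0r.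
by rewrite big_nat_recr //= IH exprS; field; rewrite gt_eqF.
Qed.

Lemma small_power (tau : R) q : 1 < tau -> exists2 e, 0 < e & (1 + e) ^+ q <= tau.
Proof.
move=> t1; have p0 : (0 : R) < 3 ^+ q by rewrite exprn_gt0.
(* For e <= 1 one has (1 + e)^q <= 1 + 3^q e, by induction on q. *)
pose e := Num.min 1 ((tau - 1) / 3 ^+ q).
have e0 : 0 < e by rewrite lt_min ltr01 divr_gt0 // subr_gt0.
have e1 : e <= 1 by rewrite ge_min lexx.
have et : e * 3 ^+ q <= tau - 1.
  by rewrite -ler_pdivlMr // ge_min lexx orbT.
exists e => //; suff : (1 + e) ^+ q <= 1 + 3 ^+ q * e by lra.
elim: (q) => [|n IH]; first by rewrite !expr0; lra.
have h1 : (1 : R) <= 3 ^+ n by rewrite exprn_ege1 // ler1n.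
rewrite !exprS; apply: le_trans (ler_wpM2l _ IH) _; first by lra.
have h2 : 0 <= 3 ^+ n * e by rewrite mulr_ge0 // ltW // exprn_gt0.
by move: (3 ^+ n) h1 h2 => t h1 h2; nra.
Qed.

Lemma nat_ge (a : R) : exists n : nat, a <= n.+1%:R.
Proof. by exists (Num.truncn a); exact/ltW/truncnS_gt. Qed.

Variable X : completeNormedModType C.

(** The binomial coefficients of [j] sum to 2^j; eta will be a negative power of
    4 chosen so that eta^D 2^j is small. *)
Lemma binomial_tail (c : nat -> X) (B eta : R) D j : 0 <= B -> 0 <= eta <= 1 ->
  (forall k, nrm (c k) <= B * eta ^+ k) ->
  nrm (\sum_(0 <= k < j.+1) ('C(j, k))%:R *: c k - \sum_(0 <= k < D.+1) ('C(j, k))%:R *: c k)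
    <= B * eta ^+ D * 2 ^+ j.
Proof.
move=> B0 /andP[eta0 eta1] hc; pose W := (j.+1 + D.+1)%N.
have wide : \sum_(0 <= k < j.+1) ('C(j, k))%:R *: c k = \sum_(0 <= k < W) ('C(j, k))%:R *: c k.
  rewrite (@big_cat_nat _ _ _ j.+1 0 W) ?leq_addr //= [X in _ = _ + X]big1_seq ?addr0 // => k.
  rewrite mem_index_iota => /andP[_ /andP[jk _]].
  by rewrite bin_small // scale0r.
have wide1 : \sum_(0 <= k < j.+1) ('C(j, k))%:R = \sum_(0 <= k < W) ('C(j, k))%:R :> R.
  rewrite (@big_cat_nat _ _ _ j.+1 0 W) ?leq_addr //= [X in _ = _ + X]big1_seq ?addr0 // => k.
  rewrite mem_index_iota => /andP[_ /andP[jk _]].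
  by rewrite bin_small.
have tot : \sum_(0 <= k < j.+1) ('C(j, k))%:R = 2 ^+ j :> R.
  rewrite -natr_sum big_mkord -natrX; congr (_%:R).
  by rewrite -[2%N]/(1 + 1)%N expnDn; apply: eq_bigr => k _; rewrite !exp1n !muln1.
rewrite wide (@big_cat_nat _ _ _ D.+1 0 W) ?leq_addl //= [X in X - _]addrC addrK.
apply: le_trans (nrm_sum _ _ _) _.
apply: (@le_trans _ _ (\sum_(D.+1 <= k < W) (B * eta ^+ D) * ('C(j, k))%:R)).
  rewrite big_nat_cond [X in _ <= X]big_nat_cond; apply: ler_sum => k /andP[/andP[Dk _] _].
  have -> : ('C(j, k))%:R = (('C(j, k))%:R : R)%:C :> C by rewrite rmorph_nat.
  rewrite nrmZ nrmR ger0_norm // mulrC ler_wpM2r //.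
  apply: le_trans (hc k) _; rewrite ler_wpM2l //.
  by apply: ler_wiXn2l => //; exact: ltnW.
rewrite -mulr_sumr ler_wpM2l ?mulr_ge0 ?exprn_ge0 // -tot wide1.
by rewrite [X in _ <= X](@big_cat_nat _ _ _ D.+1 0 W) ?leq_addl //= lerDr sumr_ge0.
Qed.

(** Some polynomial of [ps] changes sign during the [m] steps after [n]. *)
Definition badstep (ps : seq {poly R}) m n := has (fun p => has (fun i => chg p (n + i)) (iota 0 m)) ps.

Lemma count_badstep (ps : seq {poly R}) m D N : (forall p, p \in ps -> (size p <= D.+1)%N) ->
  (\sum_(0 <= n < N) badstep ps m n <= size ps * (m * (2 * D)))%N.
Proof.
move=> hps.
apply: (@leq_trans (\sum_(p <- ps) \sum_(0 <= i < m) \sum_(0 <= n < N) chg p (n + i))).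
  under [X in (_ <= X)%N]eq_bigr do rewrite exchange_big /=.
  rewrite [X in (_ <= X)%N]exchange_big /=; apply: leq_sum => n _.
  rewrite /badstep; elim: (ps) => [|p s IH]; first by [].
  rewrite [has _ _]/= big_cons.
  apply: (@leq_trans (has (fun i => chg p (n + i)) (iota 0 m)
     + has (fun p0 => has (fun i => chg p0 (n + i)) (iota 0 m)) s)).
    by case: (has _ (iota 0 m)); case: (has _ s).
  apply: leq_add IH; rewrite /index_iota subn0.
  elim: (iota 0 m) => [|i r IHr]; first by [].
  rewrite [has _ _]/= big_cons; apply: (@leq_trans (chg p (n + i) + has (fun i => chg p (n + i)) r)).
    by case: (chg p (n + i)); case: (has _ r).
  by rewrite leq_add2l.
elim: ps hps => [|p s IH] hps; first by rewrite big_nil.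
rewrite big_cons mulSn; apply: leq_add; last first.
  by apply: IH => p' p's; apply: hps; rewrite inE p's orbT.
have -> : (m * (2 * D) = \sum_(0 <= i < m) 2 * D)%N by rewrite sum_nat_const_nat subn0.
apply: leq_sum => i _.
apply: (@leq_trans (\sum_(0 <= n < N + i) chg p n)).
  rewrite (@big_cat_nat _ _ _ i 0 (N + i)) ?leq_addl //= -[X in index_iota X (N + i)]add0n.
  by rewrite big_addn addnK leq_addl.
by apply: sign_changes; apply: hps; exact: mem_head.
Qed.

Lemma pick_index (S fail bad : nat -> bool) N N1 a b : (N1 <= N)%N ->
  (\sum_(0 <= n < N) fail n <= a)%N -> (\sum_(0 <= n < N) bad n <= b)%N ->
  (N1 + a + b < \sum_(0 <= n < N) S n)%N ->
  exists n, [/\ (N1 <= n < N)%N, S n, ~~ fail n & ~~ bad n].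
Proof.
move=> N1N ha hb hS; apply: contrapT => H.
suff : (\sum_(0 <= n < N) S n <= N1 + a + b)%N by rewrite leqNgt hS.
apply: (@leq_trans (\sum_(0 <= n < N) ((n < N1)%N + fail n + bad n))); last first.
  rewrite !big_split /= leq_add // leq_add //.
  rewrite (@big_cat_nat _ _ _ N1 0 N) //=.
  rewrite [X in (_ + X)%N]big1_seq ?addn0; last first.
    by move=> n; rewrite mem_index_iota => /andP[_ /andP[h _]]; rewrite ltnNge h.
  apply: (@leq_trans (\sum_(0 <= n < N1) 1)); last by rewrite sum_nat_const_nat subn0 muln1.
  by apply: leq_sum => n _; case: (_ < _)%N.
rewrite !big_mkord; apply: leq_sum => n _.
case: (ltnP n N1) => [_|Nn]; first by case: (S n).
case Sn : (S n) => //; case fn : (fail n) => //; case bn : (bad n) => //.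
by case: H; exists n; rewrite Nn ltn_ord Sn fn bn.
Qed.

End Estimates.

(** * Frequent orbits *)

Section Contradiction.
Variables (R : realType) (X : completeNormedModType R[i]).
Notation C := R[i].

(** Positive lower density, counted on initial segments of the integers. *)
Definition frequent (S : nat -> Prop) := exists2 d : R, 0 < d &
  exists N0, forall N, (N0 <= N)%N -> d * N%:R <= (\sum_(0 <= n < N) `[< S n >])%:R.

Definition norm_open (U : X -> Prop) := forall u, U u ->
  exists2 e : R, 0 < e & forall u', nrm (u' - u) < e -> U u'.

Lemma sum5_ge (a b c d : nat) :
  [/\ a <= a + b + c + d + 1, b <= a + b + c + d + 1, c <= a + b + c + d + 1
    & d.+1 <= a + b + c + d + 1]%N.
Proof. by split; lia. Qed.

Lemma frequent_ex S : frequent S -> exists n, S n.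
Proof.
move=> [d d0 [N0 h]]; apply: contrapT => nS.
have := h N0.+1 (leqnSn _); rewrite big1 ?ler0n => [|n _].
  by rewrite leNgt mulr_gt0.
by case: asboolP => // Sn; case: nS; exists n.
Qed.

Lemma blin_lip (A : X -> X) : blin A -> exists2 M : R, 0 < M &
  forall x y, nrm (A x - A y) <= M * nrm (x - y).
Proof. by move=> bA; have [_ _ [M M0 h]] := bA; exists M => // x y; rewrite -blinB. Qed.

(** The norm of V T^n x does not depend on n, so the orbit avoids the open set of
    vectors u with |V u| > |V x|. *)
Lemma eigen_not_frequent (T V : X -> X) l x : blin V -> (forall y, V (T y) = T (V y)) ->
  (exists x, V x != 0) -> (forall x, T (V x) = l *: V x) -> nrm l = 1 ->
  ~ (forall U, norm_open U -> (exists u, U u) -> frequent (fun n => U (iter n T x))).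
Proof.
move=> bV VT [w w0] eig l1 H.
have cst n : nrm (V (iter n T x)) = nrm (V x).
  by elim: n => //= n IH; rewrite VT eig nrmZ l1 mul1r.
have [M M0 hM] := blin_lip bV.
have [||n] := frequent_ex (H (fun u => nrm (V x) < nrm (V u)) _ _).
- move=> u hu; exists ((nrm (V u) - nrm (V x)) / M); first by rewrite divr_gt0 // subr_gt0.
  move=> u'; rewrite ltr_pdivlMr // mulrC => h.
  have := hM u' u; have := nrm_tri (V u') (V u) 0; rewrite !subr0 (nrmBC (V u)); lra.
- have nw := nrm_gt0 w0.
  exists (((nrm (V x) + 1) / nrm (V w))%:C *: w).
  have [_ VZ _] := bV; rewrite VZ nrmZ nrmR ger0_norm; last first.
    by rewrite divr_ge0 ?nrm_ge0 // addr_ge0 ?nrm_ge0.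
  by rewrite divfK ?gt_eqF //; lra.
by rewrite cst ltxx.
Qed.

Variables (T P : X -> X) (piece : C -> nat -> X -> X) (rho M : R) (L : seq C).
Hypothesis bT : blin T.
Hypothesis bP : blin P.
Hypothesis PT : forall x, P (T x) = T (P x).
Hypothesis rho01 : 0 < rho < 1.
Hypothesis M0 : 0 < M.
Hypothesis L1 : forall l, l \in L -> nrm l = 1.
Hypothesis grow : forall e, 0 < e -> exists2 B, 0 < B &
  forall k v, nrm (iter k T (P v)) <= B * (1 + e) ^+ k * nrm v.
Hypothesis split_sum : forall n v,
  nrm (iter n T (P v) - \sum_(l <- L) piece l n v) <= M * rho ^+ n * nrm v.
Hypothesis amp : forall l, l \in L -> forall n v, nrm (piece l n v) <=
  M * (nrm (iter n T v) + \sum_(0 <= k < n) rho ^+ k * nrm (iter (n - k.+1) T v)).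
Hypothesis poly_approx : forall eta, 0 < eta -> exists (rho1 B : R) (c : C -> nat -> X -> X),
  [/\ 0 < rho1 < 1, 0 < B & forall l, l \in L -> forall v,
    (forall k, nrm (c l k v) <= B * eta ^+ k * nrm v) /\
    forall n, nrm (piece l n v - l ^+ n *: \sum_(0 <= k < n.+1) ('C(n, k))%:R *: c l k v)
      <= B * rho1 ^+ n * nrm v].

Lemma iter_P n x : P (iter n T x) = iter n T (P x).
Proof. by elim: n => //= n IH; rewrite PT IH. Qed.

(** The weights rho^k in the bound for a piece absorb the growth tau^k allowed to
    the past orbit. *)
Lemma amplitude tau B n v l : l \in L -> 0 < tau -> rho * tau < 1 -> 0 < B ->
  (forall k, (k <= n)%N -> nrm (iter (n - k) T v) <= B * tau ^+ k) ->
  nrm (piece l n v) <= M * (B * (1 + tau / (1 - rho * tau))).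
Proof.
move=> lL tau0 rt B0 hv; apply: le_trans (amp lL n v) _; rewrite ler_pM2l //.
have [r0 _] := andP rho01.
rewrite mulrDr mulr1; apply: lerD; first by have := hv 0%N isT; rewrite subn0 expr0 mulr1.
have s01 : 0 <= rho * tau < 1 by rewrite rt mulr_ge0 ?ltW.
apply: (@le_trans _ _ (\sum_(0 <= k < n) (B * tau) * (rho * tau) ^+ k)).
  apply: ler_sum_nat => k /andP[_ kn].
  apply: (@le_trans _ _ (rho ^+ k * (B * tau ^+ k.+1))).
    by rewrite ler_wpM2l ?exprn_ge0 ?(ltW r0) //; exact: hv.
  by rewrite exprMn exprS le_eqVlt; apply/orP; left; apply/eqP; ring.
rewrite -mulr_sumr -mulrA ler_wpM2l ?(ltW B0) // ler_wpM2l ?(ltW tau0) //.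
exact: geom_sum.
Qed.

(** The rate [tau] is taken between 1 and 1/rho, and the hypothesis [grow] with
    (1 + e)^q <= tau provides the forward bound of [pliss].  Times before the
    first return are covered by adding finitely many norms to [B]. *)
Lemma few_failures (S : nat -> Prop) x (B0 : R) q : (exists n, S n) -> (0 < q)%N -> 0 < B0 ->
  (forall n, S n -> nrm (iter n T x) <= B0) -> exists tau B,
  [/\ 0 < tau, rho * tau < 1, 0 < B & forall N,
    (q * \sum_(0 <= n < N) `[< S n /\ exists2 k, (k <= n)%N &
       (B * tau ^+ k < nrm (iter (n - k) T (P x)))%R >] <= N)%N].
Proof.
move=> [n1 Sn1] q0 B00 hB0; have [r0 r1] := andP rho01.
(* The midpoint of 1 and 1/rho. *)
pose tau := (1 + rho^-1) / 2.
have ir : 1 < rho^-1 by rewrite invf_gt1.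
have irr : rho * rho^-1 = 1 by rewrite mulfV // gt_eqF.
have tau1 : 1 < tau by rewrite /tau; lra.
have tau0 : 0 < tau by lra.
have rtau : rho * tau < 1 by rewrite /tau mulrA mulrDr mulr1 irr; lra.
have [e e0 he] := small_power q tau1.
have [Bg Bg0 hBg] := grow e0.
pose v n := nrm (iter n T (P x)).
pose B := Bg * B0 + \sum_(0 <= b < n1) v b.
have sv : 0 <= \sum_(0 <= b < n1) v b by rewrite sumr_ge0 // => b _; exact: nrm_ge0.
have BB : Bg * B0 <= B by rewrite lerDl.
have Bp : 0 < Bg * B0 by rewrite mulr_gt0.
exists tau, B; split => //; first by apply: lt_le_trans BB.
apply: (@pliss R S v e tau B (Bg * B0) q) => // [n k Sn|b hb].
  rewrite /v addnC iterD -iter_P; apply: le_trans (hBg _ _) _.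
  rewrite mulrAC ler_wpM2r ?exprn_ge0 ?addr_ge0 ?(ltW e0) //.
  by rewrite ler_wpM2l ?(ltW Bg0) // hB0.
have bn : (b < n1)%N by rewrite ltnNge; apply/negP => h; exact: hb n1 h Sn1.
rewrite /B big_mkord (bigD1 (Ordinal bn)) //= addrCA lerDl; apply: addr_ge0; first exact: ltW.
by apply: sumr_ge0 => i _; exact: nrm_ge0.
Qed.

Variable x : X.
Hypothesis freq : forall U, norm_open U -> (exists u, U u) -> frequent (fun n => U (iter n T x)).

Let Z u := prodT T L (P (P u)).

Lemma recurrence_op_blin : blin Z.
Proof. by apply: blin_comp; [exact: prodT_blin | exact: blin_comp]. Qed.

(** The return set is open because both its conditions are continuous. *)
Lemma functional_hits (f : X -> R) u0 : (forall x y, f (x + y) = f x + f y) ->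
  (forall t x, f (t%:C *: x) = t * f x) -> (forall x, `|f x| <= nrm x) ->
  0 < f (Z u0) -> exists2 B0 : R, 0 < B0 &
  frequent (fun n => nrm (iter n T x) < B0 /\ 1 < f (Z (iter n T x))).
Proof.
move=> fD fZ f1 fu0; have [_ ZZ _] := recurrence_op_blin.
have [Mz Mz0 hMz] := blin_lip recurrence_op_blin.
pose u1 := (2 / f (Z u0))%:C *: u0.
exists (nrm u1 + 1); first by rewrite ltr_wpDl ?nrm_ge0.
apply: (freq (U := fun u => nrm u < nrm u1 + 1 /\ 1 < f (Z u))); last first.
  exists u1; split; first by rewrite ltrDl.
  by rewrite /u1 ZZ fZ divfK ?gt_eqF // ltr1n.
move=> u [h1 h2].
pose e := Num.min (nrm u1 + 1 - nrm u) ((f (Z u) - 1) / Mz).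
exists e; first by rewrite lt_min subr_gt0 h1 divr_gt0 // subr_gt0.
move=> u'; rewrite lt_min => /andP[g1]; rewrite ltr_pdivlMr // mulrC => g2; split.
  by have := nrmD (u' - u) u; rewrite subrK; lra.
have fB a b : f (a - b) = f a - f b.
  by rewrite -scaleN1r -[-1]/(- 1) -(rmorphN1 (real_complex R)) fD fZ mulN1r.
have := le_trans (f1 _) (hMz u' u); rewrite fB ler_norml => /andP[g3 _]; lra.
Qed.

(** The order of the choices matters: [d] and [q] fix [tau], [B] and the bound
    [A] of the amplitudes; then come the mesh [kappa] and the number of levels;
    then [Delta], against which the number of level crossings is negligible, and
    [eta]; the horizon N = (Delta + 1) D is chosen last. *)
Lemma recurrence_zero : forall u, Z u = 0.
Proof.
move=> u0; apply/eqP; apply/negPn/negP => Zu0.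
have [f [fD fZ f1 fv]] := hahn_banach (Z u0).
have fpos : 0 < f (Z u0) by rewrite fv nrm_gt0.
have [B0 B00 oft] := functional_hits fD fZ f1 fpos.
pose S n := nrm (iter n T x) < B0 /\ 1 < f (Z (iter n T x)).
have [d d0 [N0 hd]] := oft.
have [q hq] := nat_ge (4 / d).
have hS n : S n -> nrm (iter n T x) <= B0 by move=> [/ltW].
have [tau [B [tau0 rtau B_gt0 hfail]]] := few_failures (frequent_ex oft) (ltn0Sn q) B00 hS.
pose fail n := `[< S n /\ exists2 k, (k <= n)%N & (B * tau ^+ k < nrm (iter (n - k) T (P x)))%R >].
pose y := P x.
pose A := M * (B * (1 + tau / (1 - rho * tau))) + 1.
pose m := size L.
pose Sp : R := \sum_(0 <= k < m.+1) nrm (pol L)`_k.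
have Sp0 : 0 <= Sp by rewrite sumr_ge0 // => k _; exact: nrm_ge0.
pose kappa : R := (8 * (Sp + 1) * (m%:R + 1))^-1.
have mr0 : 0 <= m%:R :> R by rewrite ler0n.
have k0 : 0 < kappa by rewrite invr_gt0 !mulr_gt0 // ltr_wpDl.
have kE : 8 * (Sp + 1) * (m%:R + 1) * kappa = 1 by rewrite mulfV // !mulf_neq0 // gt_eqF // ltr_wpDl.
have k1 : kappa <= 1.
  rewrite invf_le1; last by rewrite !mulr_gt0 // ltr_wpDl.
  nra.
have [Lv' hLv] := nat_ge ((2 * A + 2 * kappa) / kappa); pose Lv := Lv'.+1.
pose nps := (m * (2 * Lv.+1))%N.
(* The nps polynomials change sign at most 2 D times each, with m shifts; for
   this Delta the total stays below d N / 4. *)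
have [Delta hDelta] := nat_ge ((nps * (m * 2))%:R * (4 / d)).
(* eta^D = 4^-N beats the binomial factor 2^(N + m). *)
pose eta : R := (1 / 4) ^+ Delta.+1.
have eta0 : 0 < eta by rewrite exprn_gt0.
have eta1 : eta <= 1 by apply: exprn_ile1; lra.
have [rho1 [B1 [c [/andP[rho10 rho11] B10 hc]]]] := poly_approx eta0.
have [r0 r1] := andP rho01.
have ny0 := nrm_ge0 y.
have rr : 0 <= rho < 1 by rewrite r1 ltW.
have rr1 : 0 <= rho1 < 1 by rewrite rho11 ltW.
have k2 : 0 < kappa / 2 by rewrite divr_gt0.
have [N2 hN2] := geom_small (M * nrm y) rr k0.
have [N3 hN3] := geom_small (B1 * nrm y) rr1 k2.
have [N4 hN4] := half_lt (2 ^+ m * B1 * nrm y) k2.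
pose N1 := maxn N2 N3.
have [N5 hN5] := nat_ge (4 * N1%:R / d + 1).
pose D := (N0 + N1 + N4 + N5 + 1)%N; pose N := (Delta.+1 * D)%N.
have DN : (D <= N)%N by rewrite /N leq_pmull.
have [D0 D1 D4 D5] := sum5_ge N0 N1 N4 N5.
have NN0 : (N0 <= N)%N := leq_trans D0 DN.
have NN1 : (N1 <= N)%N := leq_trans D1 DN.
have NN4 : (N4 <= N)%N := leq_trans D4 DN.
have NN5 : (N5.+1 <= N)%N := leq_trans D5 DN.
clear D0 D1 D4 D5.
(* The amplitudes truncated to degree D. *)
pose Q l j := \sum_(0 <= k < D.+1) ('C(j, k))%:R *: c l k y.
have trunc l j : l \in L -> (N1 <= j)%N -> (j <= N + m)%N ->
    nrm (piece l j y - l ^+ j *: Q l j) <= kappa.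
  move=> lL Nj jN; have [c1 c2] := hc l lL y.
  have cB k : nrm (c l k y) <= B1 * nrm y * eta ^+ k by rewrite mulrAC; exact: c1.
  have t1 : nrm (l ^+ j *: \sum_(0 <= k < j.+1) ('C(j, k))%:R *: c l k y - l ^+ j *: Q l j)
      <= B1 * nrm y * eta ^+ D * 2 ^+ j.
    rewrite -scalerBr nrmZ nrmX L1 // expr1n mul1r; apply: binomial_tail => //.
      by rewrite mulr_ge0 // ltW.
    by rewrite (ltW eta0).
  have t2 : B1 * nrm y * eta ^+ D * 2 ^+ j <= kappa / 2.
    have t3 : 2 ^+ j <= 2 ^+ m * 2 ^+ N :> R by rewrite -exprD addnC ler_weXn2l // ler1n.
    have t4 : eta ^+ D = (2 ^+ N)^-1 * (2 ^+ N)^-1.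
      by rewrite /eta -exprM -/N -invfM -exprMn -natrM div1r exprVn.
    have p0 := pow2_gt0 R N.
    apply: le_trans (_ : _ <= B1 * nrm y * eta ^+ D * (2 ^+ m * 2 ^+ N)) _.
      by rewrite ler_wpM2l // !mulr_ge0 ?exprn_ge0 ?(ltW B10) ?(ltW eta0).
    have h := hN4 N NN4; apply: le_trans (ltW h).
    by rewrite t4 le_eqVlt; apply/orP; left; apply/eqP; field; rewrite gt_eqF.
  have t5 : B1 * rho1 ^+ j * nrm y <= kappa / 2.
    by rewrite mulrAC; apply: hN3; apply: leq_trans Nj; rewrite leq_maxr.
  apply: le_trans (nrm_tri (l ^+ j *: \sum_(0 <= k < j.+1) ('C(j, k))%:R *: c l k y) _ _) _.
  by have := c2 j; lra.
pose pf l a : {poly R} := s2val (cid2 (binomial_poly (fun k => f (a *: c l k y)) D)).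
have pf_size l a : (size (pf l a) <= D.+1)%N.
  by rewrite /pf; case: (cid2 _).
have f0 : f 0 = 0 by have := fZ 0 0; rewrite scale0r mul0r.
have fn (b : nat) v : f (b%:R *: v) = b%:R * f v.
  by rewrite -fZ rmorph_nat.
have pfE l a (j : nat) : (pf l a).[j%:R] = f (a *: Q l j).
  rewrite /pf; case: (cid2 _) => p /= _ ->.
  rewrite /Q scaler_sumr (big_morph f fD f0); apply: eq_bigr => k _.
  by rewrite scalerA [a * _]mulrC -scalerA fn.
pose lev (i : nat) : R := i%:R * kappa - A.
(* Real polynomials: f of the amplitudes and of i times them, shifted by the
   levels. *)
pose ps := [seq pf la.1 la.2 - (lev i)%:P | la <- [seq (l, a) | l <- L, a <- [:: 1; 'i%C]], i <- iota 0 Lv.+1].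
have sps : size ps = nps.
  by rewrite /ps size_allpairs size_allpairs size_iota /nps /m mulnA.
have ps_size p : p \in ps -> (size p <= D.+1)%N.
  move=> /allpairsP[[[l a] i] /= [_ _ ->]].
  apply: leq_trans (size_polyD _ _) _; rewrite geq_max pf_size size_polyN.
  by apply: leq_trans (size_polyC_leq1 _) _.
have cbad := count_badstep m N ps_size.
(* Early, failing and crossing times each take at most a quarter
   of the density d of S. *)
have [n [nN Sn nfail nbad]] : exists n, [/\ (N1 <= n < N)%N, `[< S n >], ~~ fail n & ~~ badstep ps m n].
  apply: (@pick_index (fun n => `[< S n >]) fail (badstep ps m) N N1
    (\sum_(0 <= n < N) fail n) (\sum_(0 <= n < N) badstep ps m n)) => //.
  have dN : d * N%:R <= (\sum_(0 <= n < N) `[< S n >])%:R by exact: hd.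
  have fN : 4 * (\sum_(0 <= n < N) fail n)%:R <= d * N%:R.
    have h : (q.+1%:R : R) * (\sum_(0 <= n < N) fail n)%:R <= N%:R.
      by rewrite -natrM ler_nat; exact: hfail.
    have h' : 4 <= d * q.+1%:R by rewrite mulrC -ler_pdivrMr.
    apply: le_trans (ler_wpM2l (ltW d0) h); rewrite mulrA ler_wpM2r //.
  have bN : 4 * (\sum_(0 <= n < N) badstep ps m n)%:R <= d * N%:R.
    have h : (\sum_(0 <= n < N) badstep ps m n)%:R <= ((nps * (m * 2))%:R * D%:R : R).
      by rewrite -natrM ler_nat -sps -!mulnA.
    have h' : (nps * (m * 2))%:R * 4 <= d * Delta.+1%:R.
      by rewrite [leRHS]mulrC -ler_pdivrMr // -mulrA.
    rewrite /N natrM mulrA; apply: le_trans (ler_wpM2r _ h') => //.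
    by rewrite mulrAC mulrC ler_wpM2r.
  have N1N : 4 * N1%:R < d * N%:R.
    have h : 4 * N1%:R / d + 1 <= N%:R.
      by apply: le_trans hN5 _; rewrite ler_nat.
    rewrite mulrC [ltRHS]mulrC -ltr_pdivrMr // mulrC.
    by apply: lt_le_trans h; rewrite ltrDl.
  rewrite -(ltr_nat R) !natrD; move: dN fN bN N1N (ler0n R N1); clear.
  set a1 := d * N%:R; set a2 := N1%:R; set a3 := (\sum_(0 <= n < N) fail n)%:R.
  set a4 := (\sum_(0 <= n < N) badstep ps m n)%:R; set a5 := (\sum_(0 <= n < N) _)%:R.
  move: a1 a2 a3 a4 a5 => a1 a2 a3 a4 a5; lra.
have {}Sn := asboolW Sn.
have [_ SZ] := Sn.
have ok k : (k <= n)%N -> nrm (iter (n - k) T y) <= B * tau ^+ k.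
  move=> kn; rewrite leNgt; apply/negP => h; case/negP: nfail; apply/asboolP.
  by split => //; exists k.
have [nN1 nN2] := andP nN.
have uA l a : l \in L -> nrm a = 1 -> `|(pf l a).[n%:R]| <= A.
  move=> lL a1; rewrite pfE; apply: le_trans (f1 _) _; rewrite nrmZ a1 mul1r.
  have -> : nrm (Q l n) = nrm (l ^+ n *: Q l n) by rewrite nrmZ nrmX L1 // expr1n mul1r.
  have h1 := amplitude lL tau0 rtau B_gt0 ok.
  have h2 := trunc l n lL nN1 (leq_trans (ltnW nN2) (leq_addr _ _)).
  have := nrm_tri (piece l n y) (l ^+ n *: Q l n) 0; rewrite !subr0 nrmBC /A; lra.
have small l a k : l \in L -> a \in [:: 1; 'i%C] -> (k <= m)%N ->
    `|f (a *: (Q l (n + k)%N - Q l n))| <= kappa.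
  move=> lL aI km.
  have a1 : nrm a = 1.
    by move: aI; rewrite !inE => /orP[] /eqP ->; rewrite ?nrm1 ?nrmi.
  have fB u w : f (u - w) = f u - f w.
    by rewrite -scaleN1r -[-1]/(- 1) -(rmorphN1 (real_complex R)) fD fZ mulN1r.
  rewrite scalerBr fB -!pfE.
  apply: (@levels R (fun j => (pf l a).[j%:R]) A kappa Lv m n k0 (uA l a lL a1)) => //.
    by rewrite /Lv -ler_pdivrMr.
  move=> i j iLv jm.
  have pin : pf l a - (lev i)%:P \in ps.
    apply/allpairsP; exists ((l, a), i); split => //; last by rewrite mem_iota add0n ltnS.
    by apply/allpairsP; exists (l, a).
  have : ~~ chg (pf l a - (lev i)%:P) (n + j).
    apply/negP => h; case/negP: nbad; apply/hasP; exists (pf l a - (lev i)%:P) => //.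
    by apply/hasP; exists j => //; rewrite mem_iota.
  by rewrite /chg negbK !hornerE => /eqP.
have ZE : Z (iter n T x) = \sum_(0 <= k < m.+1) (pol L)`_k *: iter (n + k) T (P y).
  rewrite /Z prodTE //; apply: eq_bigr => k _; congr (_ *: _).
  by rewrite !iter_P addnC iterD.
have := @recurrence_small R X f fD fZ f1 L (fun j => iter j T (P y)) (fun l j => piece l j y) Q n
  kappa kappa kappa L1.
rewrite -/m -/Sp -ZE => h.
have : `|f (Z (iter n T x))| <= Sp * (kappa + m%:R * (kappa + 2 * kappa)).
  apply: h => [k km|l k lL km|l k lL km|l k lL km].
  - apply: le_trans (split_sum _ _) _; rewrite mulrAC; apply: hN2.
    by apply: leq_trans (leq_addr _ _); apply: leq_trans nN1; rewrite leq_maxl.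
  - apply: trunc => //; first by apply: leq_trans (leq_addr _ _).
    by apply: leq_add => //; exact: ltnW.
  - by have := small l 1 k lL (mem_head _ _) km; rewrite scale1r.
  - by apply: small => //; rewrite !inE eqxx orbT.
rewrite leNgt => /negP; apply; apply: lt_le_trans (ler_norm _).
apply: lt_trans SZ; nra.
Qed.

Lemma split_not_frequent : (exists x, P (P x) != 0) -> False.
Proof.
move=> PP; have bPP : blin (fun x => P (P x)) by exact: blin_comp.
have cPP y : P (P (T y)) = T (P (P y)) by rewrite !PT.
have [[u hu]|[l lL [V [bV VT V0 Vl]]]] := eigen_or_nonzero bT L bPP cPP PP.
  by move: hu; rewrite -/(Z u) recurrence_zero eqxx.
exact: eigen_not_frequent bV VT V0 Vl (L1 lL) freq.
Qed.

End Contradiction.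

(** * Lower density, open sets and the spectrum *)

Section Unwrapping.
Variables (R : realType) (X : completeNormedModType R[i]).
Notation C := R[i].

(** Passing from radii to integers: the elements n < N of [S] are those of modulus
    at most N - 1, and the ratio (N - 1) / N costs a factor 2. *)
Lemma lower_density_frequent (S : nat -> Prop) :
  (0 < lower_density [set (n%:R : C) | n in [set n | S n]])%E -> frequent R S.
Proof.
rewrite /lower_density limf_einfE => /ereal_sup_gt[_ [V FV <-]] h.
have [e e0 he] : exists2 e : R, 0 < e & (e%:E <= ereal_inf [set (counting ([set (n%:R : C) | n in [set n | S n]]
    `&` [set z : C | (`|z| <= r%:C)%R]) * (r^-1)%:E)%E | r in V])%E.
  move: h; case: (ereal_inf _) => [e||] //.
    by rewrite lte_fin => e0; exists e.
  by exists 1 => //; rewrite leey.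
have [M [_ hM]] := FV.
exists (e / 2); first by rewrite divr_gt0.
have [N0 hN0] := nat_ge (`|M| + 1).
exists N0.+3 => N hN.
(* Moduli at most N - 1 select the integers below N. *)
pose r : R := N.-1%:R.
have N1 : N = N.-1.+1 by rewrite prednK // (leq_trans _ hN).
have rN0 : N0.+1%:R <= r by rewrite /r ler_nat -ltnS -N1 (leq_trans _ hN).
have r0 : 0 < r by apply: lt_le_trans rN0; rewrite ltr0n.
have Vr : V r.
  by apply: hM; apply: lt_le_trans rN0; apply: lt_le_trans hN0; rewrite (le_lt_trans (ler_norm M)) // ltrDl.
have hr : (e%:E <= counting ([set (n%:R : C) | n in [set n | S n]]
    `&` [set z : C | (`|z| <= r%:C)%R]) * (r^-1)%:E)%E.
  by apply: le_trans he _; apply: ereal_inf_lbound; exists r.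
pose s := [seq (n%:R : C) | n <- iota 0 N & `[< S n >]].
have nC n : nrm (n%:R : C) = n%:R by rewrite -(rmorph_nat (real_complex R)) nrmR ger0_norm.
have As : [set (n%:R : C) | n in [set n | S n]] `&` [set z : C | (`|z| <= r%:C)%R] = [set` s].
  apply/seteqP; split => [z [[n Sn <-]] /= |z /= /mapP[n]].
    rewrite norm_nrm lecR nC ler_nat => nN; apply/mapP; exists n => //.
    rewrite mem_filter; apply/andP; split; first exact/asboolP.
    by rewrite mem_iota add0n [X in (_ < X)%N]N1 ltnS.
  rewrite mem_filter mem_iota add0n => /andP[/asboolP Sn /andP[_ nN]] ->; split; first by exists n.
  by rewrite /= norm_nrm lecR nC ler_nat -ltnS -N1.
have cs : (counting [set` s] <= (size s)%:R%:E :> \bar R)%E.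
  rewrite /counting; case: asboolP => [_|[]]; last exact: finite_seq.
  rewrite lee_fin ler_nat; apply: uniq_leq_size; first exact: finmap.fset_uniq.
  by move=> z; rewrite in_fset_set ?inE //; exact: finite_seq.
have ss : size s = (\sum_(0 <= n < N) `[< S n >])%N.
  rewrite size_map size_filter -sum1_count big_mkcond /index_iota subn0.
  by apply: eq_bigr => i _; case: `[< _ >].
have : e * r <= (size s)%:R.
  rewrite -ler_pdivlMr // -lee_fin EFinM; apply: le_trans hr _; rewrite As.
  by apply: lee_wpmul2r => //; rewrite lee_fin invr_ge0 ltW.
rewrite ss => h1; apply: le_trans h1.
have -> : (N%:R : R) = r + 1 by rewrite /r [in LHS]N1 natr1.
have : 1 <= r by rewrite (le_trans _ rN0) // ler1n.
by move=> r1; rewrite mulrAC ler_pdivrMr // -mulrA ler_wpM2l ?(ltW e0) //; lra.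
Qed.

Lemma norm_open_open (U : set X) : norm_open U -> open U.
Proof.
move=> hU; rewrite openE => u /hU[e e0 h].
apply/nbhs_ballP; exists e%:C => /=; first by rewrite ltcR.
by move=> u'; rewrite -ball_normE /ball_ /= distrC norm_nrm ltcR; exact: h.
Qed.

Lemma open_near_pt (U : set C^o) z : open U -> U z -> near_pt z U.
Proof.
rewrite openE => hU /hU /nbhs_ballP[e /= e0 h].
have er : 0 < complex.Re e by move: e0; rewrite ltcE => /andP[].
have eE : e = (complex.Re e)%:C by rewrite RRe_real // gtr0_real.
exists (complex.Re e)^-1; first by rewrite invr_gt0.
move=> w; rewrite mulrC ltr_pdivrMr // mul1r => hw; apply: h.
by rewrite -ball_normE /ball_ /= distrC norm_nrm eE ltcR.
Qed.

Lemma spectrum_res (T : {linear X -> X}) z : spectrum T z <-> ~ in_resolvent T z.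
Proof.
rewrite /spectrum /=; split; apply: contra_not.
  move=> [S [bS h1 h2]]; have [S' bS' e] := blin_linear bS.
  by exists S'; split => // y; rewrite !e.
by move=> [S [bS h1 h2]]; exists S; split => //; exact: linear_blin.
Qed.

End Unwrapping.

Theorem theorem1 (R : realType) (X : completeNormedModType R[i])
    (T : {linear X -> X}) (hT : bounded_operator T)
    (K : set R[i]^o)
    (hcomp : exists2 z : R[i]^o, spectrum T z &
               K = connected_component (spectrum T) z)
    (hclosed : exists2 C : set R[i]^o, closed C & K = spectrum T `&` C)
    (hopen : exists2 U : set R[i]^o, open U & K = spectrum T `&` U)
    (hdisk : K `<=` [set z : R[i] | `|z| <= 1])
    (m : nat) (alpha : 'I_m -> R)
    (hA : K `&` [set z : R[i] | `|z| = 1] = [set expi (alpha j) | j in [set: 'I_m]])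
    (halpha : Q_independent alpha) :
  ~ frequently_hypercyclic T.
Proof.
move=> [x hx].
have bT := linear_blin hT.
have [D cD KD] := hclosed; have [U oU KU] := hopen.
pose F z := spectrum T z /\ ~ U z.
pose L := undup [seq expi (alpha j) | j <- enum 'I_m].
have KFs z : ~ in_resolvent T z <-> K z \/ F z.
  split=> [/spectrum_res sz|[|[/spectrum_res //]]].
    have [Uz|nUz] := pselect (U z); [left | by right].
    by rewrite KU.
  by rewrite KU => -[/spectrum_res].
have res_open z : in_resolvent T z -> near_pt z (fun w => in_resolvent T w).
  by move=> /(res_near bT)[M M0 h]; exists M => // w /h[].
have K1 z : K z -> nrm z <= 1.
  by move=> /hdisk /=; rewrite norm_nrm -(rmorph1 (real_complex R)) lecR.
have cK : closed_pts K.
  move=> z nKz; have [rz|nrz] := pselect (in_resolvent T z).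
    by apply: near_pt_imp (res_open z rz) => w rw; rewrite KD => -[/spectrum_res].
  have nD : (~` D) z by move=> Dz; apply: nKz; rewrite KD; split => //; exact/spectrum_res.
  have oD : open (~` D) by rewrite openC.
  by apply: near_pt_imp (open_near_pt oD nD) => w nDw; rewrite KD => -[].
have cF : closed_pts F.
  move=> z nFz; have [rz|nrz] := pselect (in_resolvent T z).
    by apply: near_pt_imp (res_open z rz) => w rw [/spectrum_res].
  have Uz : U z by apply: contrapT => nUz; apply: nFz; split => //; exact/spectrum_res.
  by apply: near_pt_imp (open_near_pt oU Uz) => w Uw [].
have KF z : K z -> ~ F z by rewrite KU => -[_ Uz] [].
have Kne : exists z, K z.
  by have [z sz ->] := hcomp; exists z; exact: connected_component_refl.
have L1 l : l \in L -> nrm l = 1.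
  rewrite mem_undup => /mapP[j _ ->].
  have : [set expi (alpha j) | j in [set: 'I_m]] (expi (alpha j)) by exists j.
  by rewrite -hA => -[_ /=]; rewrite norm_nrm => -[].
have KL z : K z -> nrm z = 1 -> z \in L.
  move=> Kz z1; have : (K `&` [set z : R[i] | `|z| = 1]) z by split => //=; rewrite norm_nrm z1.
  rewrite hA => -[j _ <-]; rewrite mem_undup; apply: map_f.
  by rewrite mem_enum.
have [P [piece [rho [M [[bP PT PP rho01 M0] [grow spl amp pol]]]]]] :=
  spectral_split bT KFs K1 cK cF KF Kne (undup_uniq _) L1 KL.
apply: (@split_not_frequent R X T P piece rho M L bT bP PT rho01 M0 L1 grow spl amp pol x) => //.
move=> V oV [u Vu]; apply: lower_density_frequent.
by apply: hx; [exact: norm_open_open | exists u].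
Qed.
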